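(* Let $C_b=[S_1S_2,b]$ be the commutator of the tensor product $S_1S_2=S\otimes S$ of the dyadic shift $S$ with multiplication by $b$ on $L^2(\mathbb{R}^2)$. Then $$\|b\|_{\mathrm{bmo}}\lesssim \|C_b\|_{L^2(\mathbb{R}^2)\to L^2(\mathbb{R}^2)}\lesssim \|b\|_{\mathrm{bmo}}$$ with constants independent of the symbol $b$ in dyadic little BMO. That is: (lower estimate) there exists $C>0$ such that for every $b\in\mathrm{bmo}$ there exists a nonzero $f\in L^2(\mathbb{R}^2)$ with $\|C_bf\|_{L^2}\geq C\,\|b\|_{\mathrm{bmo}}\|f\|_{L^2}$; (upper estimate) there exists $C>0$ such that for every $b\in\mathrm{bmo}$ and every $f\in L^2(\mathbb{R}^2)$, $\|C_bf\|_{L^2}\leq C\,\|b\|_{\mathrm{bmo}}\|f\|_{L^2}$.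
   Context: $\mathcal{D}$ denotes the family of all dyadic intervals in $\mathbb{R}$. For $I\in\mathcal{D}$, $I_-$ and $I_+$ are its left and right halves, and $h_I=(\mathbf{1}_{I_+}-\mathbf{1}_{I_-})/\sqrt{|I|}$ is the $L^2$-normalized Haar function; $\{h_I\}_{I\in\mathcal{D}}$ is an orthonormal basis of $L^2(\mathbb{R})$. The shift $S$ is the linear operator determined by $h_{I_-}\mapsto -h_{I_+}$ and $h_{I_+}\mapsto h_{I_-}$ for all $I\in\mathcal{D}$, i.e. $Sf=\sum_{I\in\mathcal{D}}\big((f,h_{I_+})h_{I_-}-(f,h_{I_-})h_{I_+}\big)$. On functions of $(x_1,x_2)\in\mathbb{R}^2$, $S_i$ denotes $S$ acting in the variable $x_i$, so $S_1S_2=S\otimes S$. A dyadic rectangle is $R=R_1\times R_2$ with $R_1,R_2\in\mathcal{D}$, and $\langle b\rangle_R=\frac1{|R|}\int_R b$. A locally integrable function $b$ on $\mathbb{R}^2$ is in dyadic little BMO, written $b\in\mathrm{bmo}$, if $\|b\|_{1,\mathrm{bmo}}=\sup_R\frac1{|R|}\int_R|b-\langle b\rangle_R|\,dx<\infty$, the supremum being over all dyadic rectangles $R$. By the John–Nirenberg inequality, for $1<p<\infty$ the quantity $\|b\|_{p,\mathrm{bmo}}=\sup_R\big(\frac1{|R|}\int_R|b-\langle b\rangle_R|^p\,dx\big)^{1/p}$ is an equivalent norm; $\|b\|_{\mathrm{bmo}}$ denotes any fixed one of these equivalent norms. The commutator is $C_bf=[S_1S_2,b]f=S_1S_2(bf)-b\,S_1S_2f$,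 understood initially for bounded compactly supported $f$ and for general $f\in L^2(\mathbb{R}^2)$ via the extension by density; $\|C_b\|_{L^2\to L^2}$ is its operator norm. *)

(* Defs.v *)
From HB Require Import structures.
From mathcomp Require Import all_boot all_order all_algebra finmap.
From mathcomp Require Import all_classical all_reals all_analysis.
Set Implicit Arguments.
Unset Strict Implicit.
Unset Printing Implicit Defensive.
Import Order.TTheory GRing.Theory Num.Theory.
Import numFieldNormedType.Exports.
Local Open Scope classical_set_scope.
Local Open Scope ring_scope.

(* All functions are real-valued and Borel measurable.  Elements of L^2 are
   handled as functions, so an operator on L^2 (whose value is only defined
   almost everywhere) is a relation between its argument and its value. *)

(* (j, k) encodes the dyadic interval [k 2^j, (k + 1) 2^j). *)
Definition dyadic : Type := (int * int)%type.

Definition dyadic_left (I : dyadic) : dyadic := (I.1 - 1, 2 * I.2).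
Definition dyadic_right (I : dyadic) : dyadic := (I.1 - 1, 2 * I.2 + 1).

Section Shift.
Context {R : realType}.
Local Notation leb := (@lebesgue_measure R).

Definition dyadic_len (I : dyadic) : R := 2 ^ I.1.

Definition dyadic_set (I : dyadic) : set R :=
  `[I.2%:~R * dyadic_len I, (I.2 + 1)%:~R * dyadic_len I[.

Definition haar (I : dyadic) (x : R) : R :=
  (\1_(dyadic_set (dyadic_right I)) x - \1_(dyadic_set (dyadic_left I)) x)
  / Num.sqrt (dyadic_len I).

Definition inner (f h : R -> R) : R := \int[leb]_x (f x * h x).

Definition shift_partial (A : {fset int * int}) (f : R -> R) (x : R) : R :=
  \sum_(I <- A) (inner f (haar (dyadic_right I)) * haar (dyadic_left I) x
                 - inner f (haar (dyadic_left I)) * haar (dyadic_right I) x).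

(* [shift f g]: g = S f, the series over all dyadic intervals converging
   unconditionally in L^2(R). *)
Definition shift (f g : R -> R) : Prop :=
  [/\ f \in Lfun leb 2%:E, g \in Lfun leb 2%:E &
    forall e : R, 0 < e -> exists A : {fset int * int},
      forall B : {fset int * int}, (A `<=` B)%fset ->
        ('N[leb]_2%:E[EFin \o (shift_partial B f \- g)%R] < e%:E)%E].

End Shift.

Section Plane.
Context {R : realType}.
Local Notation leb := (@lebesgue_measure R).

Definition leb2 := (leb \x leb)%E.

Definition L2 (f : R * R -> R) : Prop := f \in Lfun leb2 2%:E.

Definition norm2 (f : R * R -> R) : \bar R := 'N[leb2]_2%:E[EFin \o f]%E.

Definition shift1 (f g : R * R -> R) : Prop :=
  [/\ L2 f, L2 g &
    {ae leb, forall x2, shift (fun x1 => f (x1, x2)) (fun x1 => g (x1, x2))}].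

Definition shift2 (f g : R * R -> R) : Prop :=
  [/\ L2 f, L2 g &
    {ae leb, forall x1, shift (fun x2 => f (x1, x2)) (fun x2 => g (x1, x2))}].

Definition shift12 (f g : R * R -> R) : Prop :=
  exists2 h, shift2 f h & shift1 h g.

Definition rect (I J : dyadic) : set (R * R) := dyadic_set I `*` dyadic_set J.

Definition area (I J : dyadic) : R := fine (leb2 (rect I J)).

Definition average (b : R * R -> R) (I J : dyadic) : R :=
  (area I J)^-1 * \int[leb2]_(z in rect I J) b z.

(* At p = 1 the outer power is trivial. *)
Definition bmo_norm (p : R) (b : R * R -> R) : \bar R :=
  ereal_sup [set t | exists I J : dyadic,
    t = (((area I J)^-1)%:E *
         \int[leb2]_(z in rect I J) (`|b z - average b I J| `^ p)%:E)
        `^ p^-1]%E.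

Definition locally_integrable2 (b : R * R -> R) : Prop :=
  measurable_fun setT b /\
  forall K : set (R * R), compact K ->
    (\int[leb2]_(z in K) `|b z|%:E < +oo)%E.

Definition bmo (b : R * R -> R) : Prop :=
  locally_integrable2 b /\ (bmo_norm 1 b < +oo)%E.

Definition bounded_compact_support (f : R * R -> R) : Prop :=
  [/\ measurable_fun setT f,
      exists M : R, forall z, `|f z| <= M &
      exists2 K : set (R * R), compact K & forall z, ~ K z -> f z = 0].

(* g = S1 S2 (b f) - b S1 S2 f; used for f bounded with compact support. *)
Definition commutator_initial (b f g : R * R -> R) : Prop :=
  exists u v, [/\ shift12 (b \* f) u, shift12 f v & g = u \- b \* v].

(* [commutator b f g]: g = C_b f for the extension by density, i.e. C_b is
   defined at the terms of, and its values converge to g along, every sequence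
   of bounded compactly supported functions that tends to f in L^2. *)
Definition commutator (b f g : R * R -> R) : Prop :=
  [/\ L2 f, L2 g &
    forall f_ : nat -> R * R -> R,
      (forall n, bounded_compact_support (f_ n)) ->
      norm2 (f_ n \- f) @[n --> \oo] --> 0%E ->
      exists2 g_ : nat -> R * R -> R,
        (forall n, commutator_initial b (f_ n) (g_ n)) &
        norm2 (g_ n \- g) @[n --> \oo] --> 0%E].

Definition opnorm (T : (R * R -> R) -> (R * R -> R) -> Prop) : \bar R :=
  ereal_sup [set t | exists f g,
    [/\ L2 f, (norm2 f <= 1)%E, T f g & t = norm2 g]].

End Plane.

(* Main.v *)
Require Import Defs.
From HB Require Import structures.
From mathcomp Require Import all_boot all_order all_algebra finmap archimedean.
From mathcomp Require Import all_classical all_reals all_analysis.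
From mathcomp Require Import measurable_realfun.
From mathcomp Require Import ring lra zify.
Set Implicit Arguments.
Unset Strict Implicit.
Unset Printing Implicit Defensive.
Import Order.TTheory GRing.Theory Num.Theory.
Import numFieldNormedType.Exports.
Local Open Scope classical_set_scope.
Local Open Scope ring_scope.

(* In one variable, pairing [S, b] f with a Haar sum g and expanding the products
   over the dyadic tree, the terms in which b enters through its Haar
   coefficients are paraproducts, bounded by the Carleson embedding theorem,
   while those in which it enters through its averages pair up over the two
   halves of each interval, because S only permutes the two halves, and leave
   differences b_- - b_+ of adjacent averages. So |[S, b]| is controlled by the
   BMO norm of b.  In the plane [S1 S2, b] = S1 [S2, b] + [S1, b] S2, and almost
   every one-variable slice of b has a BMO norm at most twice the bmo norm.
   For the lower estimate test on f = h_I' (x) h_J', where I' and J' are the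
   siblings of I and J.  On I x J the image S1 S2 f is +-h_I (x) h_J, and on each
   quarter of I x J the function S1 S2 (b f) is constant, so C_b f measures the
   oscillation of b on the quarters; every dyadic rectangle is such a quarter. *)

(** * Square-integrable functions *)

(** Two obstacles shape the proof. Shifts and commutators are relations, so each of their values has
    to be constructed; in the plane this uses partial Haar sums that converge almost everywhere
    along a subsequence, the mode of convergence that passes to almost every slice. Moreover $b$ is
    unbounded, and $b\,S_1S_2f$ is not known beforehand to be square integrable, so it cannot be
    paired with test functions. The bilinear estimate is therefore proved for bounded $b$ and finite
    Haar sums, where it lives on finite dyadic trees. Its constant sees $b$ only through its
    variances on intervals, which truncation of $b$ does not increase, and Fatou removes the
    truncation. Variances are the right datum because they are the Carleson masses of the Haar
    coefficients of $b$; the John-Nirenberg inequality bounds them by the norm with $p = 1$, to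
    which every other exponent is reduced. Bounds on oscillation are kept strictly positive so that
    one can divide by them; a vanishing norm is covered by an additional $e > 0$ that is removed at
    the end. *)

Lemma eqle d (T : porderType d) (x y : T) : x = y -> (x <= y)%O.
Proof. by move=> ->. Qed.

Section SquareIntegrable.
Context d (T : measurableType d) (R : realType).
Variable mu : {measure set T -> \bar R}.
Implicit Types (f g h : T -> R) (a t : R).

(** The squared norm, extended-valued: Tonelli and Fatou apply to it without any integrability, and
    no square root intervenes. *)
Definition esq f : \bar R := (\int[mu]_x ((f x) ^+ 2)%:E)%E.

Definition sqint f := measurable_fun setT f /\ (esq f < +oo)%E.

Definition ip f g : R := \int[mu]_x (f x * g x).

Lemma esq_ge0 f : (0 <= esq f)%E.
Proof. by apply: integral_ge0 => x _; rewrite lee_fin sqr_ge0. Qed.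

Lemma Lnorm2E f : 'N[mu]_2%:E[EFin \o f]%E = (esq f `^ 2^-1)%E.
Proof.
rewrite unlock /esq; congr (_ `^ _)%E; apply: eq_integral => x _ /=.
by rewrite powR_mulrn// -normrX ger0_norm// sqr_ge0.
Qed.

Lemma poweR_half_lty (x : \bar R) : (0 <= x)%E -> (x `^ 2^-1 < +oo)%E = (x < +oo)%E.
Proof.
case: x => [x| |]//= x0; first by rewrite !ltry.
by rewrite ltxx invr_eq0 pnatr_eq0.
Qed.

Lemma Lfun2P f : f \in Lfun mu 2%:E <-> sqint f.
Proof.
rewrite inE /Lfun/=; split.
  move=> /andP[]; rewrite !inE/= /finite_norm => mf.
  by rewrite Lnorm2E poweR_half_lty ?esq_ge0.
move=> [mf ef]; apply/andP; rewrite !inE/=; split => //.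
by rewrite /finite_norm Lnorm2E poweR_half_lty ?esq_ge0.
Qed.

Lemma measurable_sqr f : measurable_fun setT f ->
  measurable_fun setT (fun x => ((f x) ^+ 2)%:E).
Proof. by move=> mf; apply/measurable_EFinP; exact: measurable_funX. Qed.

Lemma ae_le_esq f g : measurable_fun setT f -> measurable_fun setT g ->
  {ae mu, forall x, `|f x| <= `|g x|} -> (esq f <= esq g)%E.
Proof.
move=> mf mg fg; apply: ae_ge0_le_integral => //.
- by move=> x _; rewrite lee_fin sqr_ge0.
- exact: measurable_sqr.
- by move=> x _; rewrite lee_fin sqr_ge0.
- exact: measurable_sqr.
- apply: filterS fg => x fgx _.
  by rewrite lee_fin -[_ ^+ 2]ger0_norm ?sqr_ge0// -[leRHS]ger0_norm ?sqr_ge0// !normrX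
    lerXn2r ?nnegrE.
Qed.

Lemma le_esq f g : measurable_fun setT f -> measurable_fun setT g ->
  (forall x, `|f x| <= `|g x|) -> (esq f <= esq g)%E.
Proof. by move=> mf mg fg; apply: ae_le_esq => //; exact: aeW. Qed.

Lemma ae_eq_esq f g : measurable_fun setT f -> measurable_fun setT g ->
  {ae mu, forall x, f x = g x} -> esq f = esq g.
Proof.
move=> mf mg fg; apply/eqP; rewrite eq_le; apply/andP; split; apply: ae_le_esq => //;
  by apply: filterS fg => x ->.
Qed.

Lemma esqD f g : measurable_fun setT f -> measurable_fun setT g ->
  (esq (f \+ g)%R <= 2%:E * esq f + 2%:E * esq g)%E.
Proof.
move=> mf mg; rewrite /esq -ge0_integralZl//; last 2 first.
- exact: measurable_sqr.
- by move=> x _; rewrite lee_fin sqr_ge0.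
rewrite -[X in (_ <= _ + X)%E]ge0_integralZl//; last 2 first.
- exact: measurable_sqr.
- by move=> x _; rewrite lee_fin sqr_ge0.
rewrite -ge0_integralD//.
- apply: ge0_le_integral => //.
  + by move=> x _; rewrite lee_fin sqr_ge0.
  + by apply: measurable_sqr; exact: measurable_funD.
  + by apply: emeasurable_funD; apply: measurable_funeM; exact: measurable_sqr.
  + move=> x _; rewrite -!EFinM -EFinD lee_fin.
    by have := sqr_ge0 (f x - g x) => /=; nra.
- by move=> x _; rewrite mule_ge0// lee_fin sqr_ge0.
- by apply: measurable_funeM; exact: measurable_sqr.
- by move=> x _; rewrite mule_ge0// lee_fin sqr_ge0.
- by apply: measurable_funeM; exact: measurable_sqr.
Qed.

Lemma esqN f : esq (\- f)%R = esq f.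
Proof. by apply: eq_integral => x _; rewrite sqrrN. Qed.

Lemma esqB f g : measurable_fun setT f -> measurable_fun setT g ->
  (esq (f \- g)%R <= 2%:E * esq f + 2%:E * esq g)%E.
Proof. by move=> mf mg; rewrite -(esqN g); apply: esqD => //; exact: measurableT_comp. Qed.

Lemma esq_subC f g : esq (f \- g)%R = esq (g \- f)%R.
Proof. by apply: eq_integral => x _ /=; rewrite -sqrrN opprB. Qed.

Lemma esqZ a f : measurable_fun setT f ->
  esq (fun x => a * f x) = ((a ^+ 2)%:E * esq f)%E.
Proof.
move=> mf; rewrite /esq -ge0_integralZl//; last 3 first.
- exact: measurable_sqr.
- by move=> x _; rewrite lee_fin sqr_ge0.
- by rewrite lee_fin sqr_ge0.
by apply: eq_integral => x _; rewrite exprMn EFinM.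
Qed.

Lemma lte2D (x y : \bar R) : (x < +oo)%E -> (y < +oo)%E ->
  (2%:E * x + 2%:E * y < +oo)%E.
Proof. by move=> xy yy; rewrite lte_add_pinfty// lte_mul_pinfty. Qed.

Lemma sqintD f g : sqint f -> sqint g -> sqint (f \+ g)%R.
Proof.
move=> [mf ef] [mg eg]; split; first exact: measurable_funD.
by apply: le_lt_trans (esqD mf mg) _; exact: lte2D.
Qed.

Lemma sqintB f g : sqint f -> sqint g -> sqint (f \- g)%R.
Proof.
move=> [mf ef] [mg eg]; split; first exact: measurable_funB.
by apply: le_lt_trans (esqB mf mg) _; exact: lte2D.
Qed.

Lemma sqintZ a f : sqint f -> sqint (fun x => a * f x).
Proof.
move=> [mf ef]; split; first exact: measurable_funM.
by rewrite esqZ// lte_mul_pinfty// ?lee_fin ?sqr_ge0// esq_ge0.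
Qed.

Lemma sqint0 : sqint (fun=> 0).
Proof.
split; first exact: measurable_cst.
by rewrite /esq; under eq_integral do rewrite expr0n/=; rewrite integral0.
Qed.

Lemma sqint_sum (I : Type) (s : seq I) (F : I -> T -> R) :
  (forall i, sqint (F i)) -> sqint (fun x => \sum_(i <- s) F i x).
Proof.
move=> sF; elim: s => [|i s IH].
  by rewrite (_ : (fun _ => _) = fun=> 0); [exact: sqint0|apply/funext => x; rewrite big_nil].
rewrite (_ : (fun _ => _) = F i \+ (fun x => \sum_(j <- s) F j x)); first exact: sqintD.
by apply/funext => x; rewrite big_cons.
Qed.

Lemma le_sqint f g : measurable_fun setT f -> sqint g ->
  (forall x, `|f x| <= `|g x|) -> sqint f.
Proof. by move=> mf [mg eg] fg; split => //; exact: le_lt_trans (le_esq mf mg fg) eg. Qed.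

Lemma sqint_mul_bounded f g (N : R) : measurable_fun setT f ->
  (forall x, `|f x| <= N) -> sqint g -> sqint (f \* g)%R.
Proof.
move=> mf fN sg; apply: (@le_sqint _ (fun x => N * g x)).
- by apply: measurable_funM => //; case: sg.
- exact: sqintZ.
- by move=> x /=; rewrite !normrM ler_wpM2r// (le_trans (fN x))// ler_norm.
Qed.

Lemma integrable_mul f g : sqint f -> sqint g ->
  mu.-integrable setT (EFin \o (f \* g)%R).
Proof.
move=> [mf ef] [mg eg]; apply/integrableP; split.
  by apply/measurable_EFinP; exact: measurable_funM.
apply: (@le_lt_trans _ _ (2%:E * esq f + 2%:E * esq g)%E); last exact: lte2D.
rewrite /esq -ge0_integralZl//; last 2 first.
- exact: measurable_sqr.
- by move=> x _; rewrite lee_fin sqr_ge0.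
rewrite -[X in (_ <= _ + X)%E]ge0_integralZl//; last 2 first.
- exact: measurable_sqr.
- by move=> x _; rewrite lee_fin sqr_ge0.
rewrite -ge0_integralD//.
- apply: ge0_le_integral => //.
  + by apply: measurableT_comp => //; apply/measurable_EFinP; exact: measurable_funM.
  + by apply: emeasurable_funD; apply: measurable_funeM; exact: measurable_sqr.
  + move=> x _; rewrite -!EFinM -EFinD /= lee_fin normrM.
    have := sqr_ge0 (`|f x| - `|g x|).
    rewrite -(real_normK (num_real (f x))) -(real_normK (num_real (g x))).
    by have := normr_ge0 (f x); have := normr_ge0 (g x); nra.
- by move=> x _; rewrite mule_ge0// lee_fin sqr_ge0.
- by apply: measurable_funeM; exact: measurable_sqr.
- by move=> x _; rewrite mule_ge0// lee_fin sqr_ge0.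
- by apply: measurable_funeM; exact: measurable_sqr.
Qed.

Lemma ipC f g : ip f g = ip g f.
Proof. by apply: eq_Rintegral => x _; rewrite mulrC. Qed.

Lemma ipDl f g h : sqint f -> sqint g -> sqint h ->
  ip (f \+ g)%R h = ip f h + ip g h.
Proof.
move=> sf sg sh; rewrite /ip -RintegralD//; [|exact: integrable_mul..].
by apply: eq_Rintegral => x _; rewrite mulrDl.
Qed.

Lemma ipBl f g h : sqint f -> sqint g -> sqint h ->
  ip (f \- g)%R h = ip f h - ip g h.
Proof.
move=> sf sg sh; rewrite /ip -RintegralB//; [|exact: integrable_mul..].
by apply: eq_Rintegral => x _; rewrite mulrBl.
Qed.

Lemma ipZl a f h : sqint f -> sqint h -> ip (fun x => a * f x) h = a * ip f h.
Proof.
move=> sf sh; rewrite /ip -RintegralZl//; last exact: integrable_mul.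
by apply: eq_Rintegral => x _; rewrite mulrA.
Qed.

Lemma ipBr f g h : sqint f -> sqint g -> sqint h ->
  ip h (f \- g)%R = ip h f - ip h g.
Proof. by move=> *; rewrite ipC ipBl// !(ipC h). Qed.

Lemma ipZr a f h : sqint f -> sqint h -> ip h (fun x => a * f x) = a * ip h f.
Proof. by move=> *; rewrite ipC ipZl// ipC. Qed.

Lemma ip_suml (I : Type) (s : seq I) (F : I -> T -> R) h :
  (forall i, sqint (F i)) -> sqint h ->
  ip (fun x => \sum_(i <- s) F i x) h = \sum_(i <- s) ip (F i) h.
Proof.
move=> sF sh; elim: s => [|i s IH].
  rewrite big_nil /ip (@eq_Rintegral _ _ _ mu _ (fun=> 0)); last first.
    by move=> x _; rewrite big_nil mul0r.
  by rewrite /Rintegral integral0.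
rewrite big_cons -IH -ipDl//; last exact: sqint_sum.
by apply: eq_Rintegral => x _ /=; rewrite big_cons.
Qed.

Lemma esqE f : sqint f -> esq f = (ip f f)%:E.
Proof.
move=> [mf ef]; rewrite /ip /Rintegral fineK; last by
  rewrite (_ : (\int[mu]_x (f x * f x)%:E)%E = esq f)// ge0_fin_numE ?esq_ge0.
by [].
Qed.

Lemma ip_ge0 f : 0 <= ip f f.
Proof. by apply: Rintegral_ge0 => x _; rewrite -expr2 sqr_ge0. Qed.

Lemma ip_cauchy f g : sqint f -> sqint g -> ip f g ^+ 2 <= ip f f * ip g g.
Proof.
move=> sf sg.
have key t : 0 <= t ^+ 2 * ip f f - 2 * t * ip f g + ip g g.
  have stf := sqintZ t sf.
  have := ip_ge0 ((fun x => t * f x) \- g)%R.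
  rewrite ipBl// ?ipBr// ?ipZl// ?ipZr//; try exact: sqintB.
  by rewrite (ipC g f); nra.
(* If [ip f f = 0], the quadratic of [key] is affine in [t]; unless [ip f g = 0], the [t] chosen
   below would give it the value -1. *)
have [f0|f0] := eqVneq (ip f f) 0.
  rewrite f0 mul0r; have gg := ip_ge0 g.
  have [->|fg0] := eqVneq (ip f g) 0; first by rewrite expr0n.
  have := key ((ip g g + 1) / (2 * ip f g)).
  rewrite f0 mulr0 (_ : 2 * _ * _ = ip g g + 1); last by field.
  lra.
have f1 : 0 < ip f f by rewrite lt_neqAle eq_sym f0 ip_ge0.
have := key (ip f g / ip f f).
rewrite (_ : _ + ip g g = ip g g - ip f g ^+ 2 / ip f f); last by field.
by rewrite subr_ge0 ler_pdivrMr// mulrC.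
Qed.

(** * Limit theorems: Fatou, dominated convergence, completeness *)

Lemma cvge0P (a : nat -> \bar R) : (forall n, 0 <= a n)%E ->
  (a n @[n --> \oo] --> 0%E) <->
  (forall e : R, 0 < e -> exists N, forall n, (N <= n)%N -> (a n <= e%:E)%E).
Proof.
move=> a0; split=> [h e e0|h].
  have [b bE] : exists b : nat -> R, b = fine \o a by exists (fine \o a).
  have /fine_cvgP[[N _ af] /cvgrPdist_le /(_ _ e0)[M _ aM]] := h.
  exists (maxn N M) => n; rewrite geq_max => /andP[Nn Mn].
  rewrite -(fineK (af n Nn)) lee_fin; have := aM n Mn.
  by rewrite /= sub0r normrN ger0_norm// fine_ge0.
apply/fine_cvgP; split.
  have [N aN] := h 1 ltr01; exists N => // n /= Nn.
  by rewrite ge0_fin_numE// (le_lt_trans (aN _ Nn))// ltry.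
apply/cvgrPdist_le => e e0; have [N aN] := h e e0; exists N => // n /= Nn.
rewrite sub0r normrN ger0_norm ?fine_ge0//.
rewrite -lee_fin fineK ?aN//.
by rewrite ge0_fin_numE// (le_lt_trans (aN _ Nn))// ltry.
Qed.

Lemma fatou_le (D : set T) (u : nat -> T -> R) f (c : \bar R) : measurable D ->
  (forall n, measurable_fun D (u n)) -> measurable_fun D f ->
  (forall n x, D x -> 0 <= u n x) ->
  {ae mu, forall x, D x -> u n x @[n --> \oo] --> f x} ->
  (forall n, \int[mu]_(x in D) (u n x)%:E <= c)%E ->
  (\int[mu]_(x in D) (f x)%:E <= c)%E.
Proof.
move=> mD mu_ mf u0 uf uc.
apply: (@le_trans _ _ (\int[mu]_(x in D) limn_einf (fun n => (u n x)%:E))%E).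
  apply: eqle.
  apply: ae_eq_integral => //.
  - exact/measurable_EFinP.
  - rewrite (_ : (fun _ => _) = fun x => (- limn_esup (fun n => - (u n x)%:E))%E).
      apply: measurableT_comp => //; apply: measurable_fun_limn_esup => n.
      by apply: measurableT_comp => //; exact/measurable_EFinP.
    by apply/funext => x; rewrite -[in LHS](oppeK (limn_einf _)) -limn_esupN.
  - apply: filterS uf => x /[swap] Dx /(_ Dx) ux.
    have uxE : (u n x)%:E @[n --> \oo] --> (f x)%:E by apply: cvg_EFin => //; exact: nearW.
    by have [-> _] := cvg_limn_einf_sup uxE.
apply: (le_trans (fatou _ _ _ _)) => //.
- by move=> n; exact/measurable_EFinP.
rewrite limn_einf_lim; apply: lime_le; first exact: is_cvg_einfs.
apply: nearW => n; apply: le_trans (uc n).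
by apply: ereal_inf_lbound; exists n => /=.
Qed.

Lemma fatou_esq (u : nat -> T -> R) f (c : \bar R) :
  (forall n, measurable_fun setT (u n)) -> measurable_fun setT f ->
  {ae mu, forall x, u n x @[n --> \oo] --> f x} ->
  (forall n, esq (u n) <= c)%E -> (esq f <= c)%E.
Proof.
move=> mu_ mf uf; apply: fatou_le => //.
- by move=> n; exact: measurable_funX.
- exact: measurable_funX.
- by move=> n x _; rewrite sqr_ge0.
- apply: filterS uf => x ux _; rewrite expr2.
  by under eq_fun do rewrite expr2; exact: cvgM.
Qed.

Lemma cvg_esq_dominated (u : nat -> T -> R) f : sqint f ->
  (forall n, measurable_fun setT (u n)) ->
  (forall n x, `|u n x - f x| <= `|f x|) ->
  (forall x, u n x @[n --> \oo] --> f x) ->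
  esq (u n \- f)%R @[n --> \oo] --> 0%E.
Proof.
move=> [mf ef] mu_ uf ux.
have dom := @dominated_convergence _ _ _ mu setT measurableT
  (fun n x => ((u n x - f x) ^+ 2)%:E) (cst 0%E) (fun x => ((f x) ^+ 2)%:E)
  (fun n => measurable_sqr (measurable_funB (mu_ n) mf)) (measurable_cst _).
have cv : {ae mu, forall x, setT x -> ((u n x - f x) ^+ 2)%:E @[n --> \oo] --> 0%E}.
  apply: aeW => x _ /=.
  have h : (u n x - f x) ^+ 2 @[n --> \oo] --> 0.
    have h0 : u n x - f x @[n --> \oo] --> 0.
      by rewrite -[X in _ --> X](subrr (f x)); apply: cvgB => //; exact: cvg_cst.
    under eq_fun do rewrite expr2.
    by rewrite -(mulr0 (0 : R)); exact: cvgM.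
  by apply: cvg_EFin => //; exact: nearW.
have ig : mu.-integrable setT (fun x => ((f x) ^+ 2)%:E).
  apply/integrableP; split; first exact: measurable_sqr.
  by under eq_integral do rewrite gee0_abs ?lee_fin ?sqr_ge0//.
have le : {ae mu, forall x n, setT x -> (`|((u n x - f x) ^+ 2)%:E| <= ((f x) ^+ 2)%:E)%E}.
  apply: aeW => x n _; rewrite gee0_abs ?lee_fin ?sqr_ge0//.
  by rewrite -[_ ^+ 2]ger0_norm ?sqr_ge0// -[leRHS]ger0_norm ?sqr_ge0// !normrX lerXn2r ?nnegrE.
by have [_ _] := dom cv ig le; rewrite integral0.
Qed.

(** The subsequence belongs to the conclusion because almost everywhere convergence, unlike
    convergence in norm, is inherited by almost every slice of a function of two variables. *)
Lemma riesz_fischer (u : nat -> T -> R) : (forall n, sqint (u n)) ->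
  (forall e : R, 0 < e -> exists N, forall n m, (N <= n)%N -> (N <= m)%N ->
    (esq (u n \- u m)%R <= e%:E)%E) ->
  exists f (k : nat -> nat), [/\ sqint f, forall j, (j <= k j)%N,
    {ae mu, forall x, u (k j) x @[j --> \oo] --> f x} &
    esq (u n \- f)%R @[n --> \oo] --> 0%E].
Proof.
move=> su cu.
have mu_ n : measurable_fun setT (u n) by have [] := su n.
(* The rate $8^{-j}$ leaves room for the weights $4^j$ in [S]: its integral is at most $\sum_j
   2^{-j}$, and wherever [S] is finite the increments [w j] are $O(2^{-j})$, hence summable. *)
have /choice[N NP] : forall j : nat, exists N, forall n m, (N <= n)%N -> (N <= m)%N ->
    (esq (u n \- u m)%R <= ((8^-1 : R) ^+ j)%:E)%E.
  by move=> j; apply: cu; rewrite exprn_gt0// invr_gt0.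
pose k j := (\sum_(i < j.+1) N i + j)%N.
have kN j : (N j <= k j)%N by rewrite /k big_ord_recr/= -addnA addnCA leq_addr.
have kS j : (k j <= k j.+1)%N by rewrite /k [in leqRHS]big_ord_recr/= -addnA leq_add2l addnS ltnW// ltnS leq_addl.
have jk j : (j <= k j)%N by rewrite leq_addl.
pose w j x := u (k j.+1) x - u (k j) x.
have ew j : (esq (w j) <= ((8^-1 : R) ^+ j)%:E)%E.
  by apply: NP => //; exact: leq_trans (kS j).
have mw j : measurable_fun setT (w j) by exact: measurable_funB.
pose S (x : T) : \bar R := (\sum_(j <oo) (4 ^+ j * w j x ^+ 2)%:E)%E.
have mS j : measurable_fun setT (fun x => (4 ^+ j * w j x ^+ 2)%:E).
  by apply/measurable_EFinP; apply: measurable_funM => //; exact: measurable_funX.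
have S0 j x : (0 <= (4 ^+ j * w j x ^+ 2)%:E)%E.
  by rewrite lee_fin mulr_ge0 ?sqr_ge0.
have iS : (\int[mu]_x S x < +oo)%E.
  rewrite integral_nneseries//.
  apply: (@le_lt_trans _ _ (\sum_(j <oo) ((2^-1 : R) ^+ j)%:E)%E).
    apply: lee_nneseries => [j _ _|j _]; first by apply: integral_ge0.
    under eq_integral do rewrite EFinM.
    rewrite ge0_integralZl//; last 2 first.
    - exact: measurable_sqr.
    - by move=> x _; rewrite lee_fin sqr_ge0.
    apply: (@le_trans _ _ ((4 ^+ j)%:E * ((8^-1 : R) ^+ j)%:E)%E).
      by apply: lee_pmul => //; solve [exact: esq_ge0|exact: ew|rewrite lee_fin exprn_ge0].
    by rewrite -EFinM -exprMn lee_fin (_ : 4 / 8 = 2^-1)//; lra.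
  have := @cvg_geometric_series R 1 2^-1 _.
  rewrite gtr0_norm ?invr_gt0// invf_lt1// ltr1n => /(_ isT) h.
  rewrite (_ : (\sum_(j <oo) _)%E = (1 / (1 - 2^-1))%:E) ?ltry//.
  apply/cvg_lim => //; apply: cvg_EFin; first by apply: nearW => n /=; rewrite sumEFin.
  move: h; apply: cvg_trans; apply: near_eq_cvg; apply: nearW => n /=.
  by rewrite /series/= sumEFin/=; apply: eq_bigr => i _; rewrite mul1r.
have aeS : {ae mu, forall x, (S x < +oo)%E}.
  have : mu.-integrable setT S.
    apply/integrableP; split.
      by apply: ge0_emeasurable_sum => // j _ x _ _.
    by under eq_integral do rewrite gee0_abs ?nneseries_ge0//.
  move=> /(integrable_ae measurableT); apply: filterS => x /(_ I).
  by rewrite ge0_fin_numE// nneseries_ge0.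
have cvgu x : (S x < +oo)%E -> cvgn (fun j => u (k j) x).
  move=> Sx.
  have Sf : S x \is a fin_num by rewrite ge0_fin_numE// nneseries_ge0.
  have wS j : `|w j x| <= Num.sqrt (fine (S x)) * 2^-1 ^+ j.
    have : ((4 ^+ j * w j x ^+ 2)%:E <= S x)%E.
      rewrite /S (nneseries_split 0 j.+1)//= big_nat_recr//=.
      rewrite add0n -addeA.
      apply: (@le_trans _ _ (0 + ((4 ^+ j * w j x ^+ 2)%:E + 0))%E); first by rewrite adde0 add0e.
      apply: leeD; first by apply: sume_ge0.
      by apply: leeD => //; apply: nneseries_ge0.
    move=> h0; have h : 4 ^+ j * w j x ^+ 2 <= fine (S x) by rewrite -lee_fin fineK.
    have s0 : 0 <= fine (S x) by rewrite fine_ge0// nneseries_ge0.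
    rewrite -ler_sqr ?nnegrE ?mulr_ge0 ?sqrtr_ge0 ?exprn_ge0 ?invr_ge0//.
    rewrite exprMn sqr_sqrtr// real_normK ?num_real//.
    rewrite -exprM mulnC exprM (_ : 2^-1 ^+ 2 = 4^-1); last by field.
    by rewrite exprVn ler_pdivlMr ?exprn_gt0// mulrC.
  have /normed_cvg : cvgn (series (fun j => `|w j x|)).
    apply: (@series_le_cvg _ _ (geometric (Num.sqrt (fine (S x))) 2^-1)) => //.
    - by move=> n; rewrite mulr_ge0 ?sqrtr_ge0 ?exprn_ge0 ?invr_ge0.
    - by apply: is_cvg_geometric_series; rewrite gtr0_norm ?invr_gt0// invf_lt1// ltr1n.
  move=> /cvg_ex[l wl]; apply/cvg_ex; exists (l + u (k 0) x).
  rewrite (_ : (fun j => u (k j) x) = (fun j => series (fun j => w j x) j + u (k 0) x)).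
    by apply: cvgD => //; exact: cvg_cst.
  apply/funext => j; rewrite /series/= telescope_sumr//= subrK//.
have [B [mB B0 subB]] := aeS.
(* Set to zero on the exceptional null set, the subsequence converges everywhere, which makes its
   limit measurable. *)
pose v j x := u (k j) x * \1_(~` B) x.
have mv j : measurable_fun setT (v j).
  by apply: measurable_funM => //; apply: measurable_indic; exact: measurableC.
have cv x : cvgn (fun j => v j x).
  rewrite /v indicE; have [xB|xB] := boolP (x \in ~` B); last first.
    by under eq_fun do rewrite mulr0; exact: is_cvg_cst.
  under eq_fun do rewrite mulr1; apply: cvgu; apply: contrapT => Sx.
  by move: xB; rewrite inE; apply; exact: subB.
pose f x := limn (fun j => v j x).
have mf : measurable_fun setT f.
  by apply: (@measurable_fun_cvg _ _ _ _ v) => // x _; exact: cv.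
have kf : {ae mu, forall x, u (k j) x @[j --> \oo] --> f x}.
  exists B; split => // x /= xB; apply: contrapT => nB; apply: xB.
  have := cv x; rewrite /f /v indicE mem_set//=.
  by under eq_fun do rewrite mulr1; move/cvg_ex => [l ul]; rewrite (cvg_lim _ ul).
have ec : esq (u n \- f)%R @[n --> \oo] --> 0%E.
  apply/cvge0P; first by move=> n; exact: esq_ge0.
  move=> e e0; have [M MP] := cu e e0; exists M => n Mn.
  (* Fatou along the subsequence turns the Cauchy bound into a bound for the distance to the limit;
     the offset [M] keeps all indices in the Cauchy range. *)
  apply: (@fatou_esq (fun j => u n \- u (k (j + M)%N))%R).
  - by move=> j; exact: measurable_funB.
  - exact: measurable_funB.
  - apply: filterS kf => x kx; apply: cvgB; first exact: cvg_cst.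
    by rewrite (cvg_shiftn M (fun j => u (k j) x)).
  - by move=> j; apply: MP => //; rewrite (leq_trans _ (jk _))// leq_addl.
exists f, k; split => //; split => //.
have [ec1 _] := cvge0P (fun n => esq_ge0 (u n \- f)).
have [M MP] := ec1 ec 1 ltr01.
rewrite (_ : f = u M \- (u M \- f))%R; last by apply/funext => x /=; rewrite opprB addrC subrK.
apply: le_lt_trans (esqB _ _) _ => //; first exact: measurable_funB.
apply: lte2D; first by have [] := su M.
by apply: le_lt_trans (MP M (leqnn _)) _; rewrite ltry.
Qed.

Lemma measurable_EFinS D f : measurable_fun setT f -> measurable_fun D (fun x => (f x)%:E).
Proof. by move=> mf; apply/measurable_EFinP; exact: (measurable_funS measurableT _ mf). Qed.

Lemma ge0_integral_affine D f t a : measurable D -> measurable_fun setT f ->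
  (forall x, 0 <= f x) -> 0 <= t -> 0 <= a ->
  (\int[mu]_(x in D) (t * (f x + a))%:E = t%:E * (\int[mu]_(x in D) (f x)%:E + a%:E * mu D))%E.
Proof.
move=> mD mf f0 t0 a0; have mfD := @measurable_EFinS D _ mf.
rewrite -integral_cst// -ge0_integralD//; last by move=> x _; rewrite lee_fin.
rewrite -ge0_integralZl_EFin//; first by move=> x _; rewrite adde_ge0 ?lee_fin.
by apply: emeasurable_funD => //; exact: measurable_cst.
Qed.

End SquareIntegrable.

(** * Dyadic intervals and the Haar system *)

Section Line.
Context {R : realType}.
Local Notation leb := (@lebesgue_measure R).
Local Notation RR := (measurableTypeR R).
Local Notation dlen := (@dyadic_len R).
Local Notation dset := (@dyadic_set R : dyadic -> set RR).
Local Notation haar := (@haar R : dyadic -> RR -> R).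
Implicit Types (I J K : dyadic) (x y v : R) (f g F G b : RR -> R)
  (c phi psi : dyadic -> R) (s A B : seq dyadic) (n m : nat).

#[global] Instance ae_lebesgue_filter {R : realType} :
  Filter (almost_everywhere (@lebesgue_measure R)) := ae_filter_ringOfSetsType _.

Lemma dlen_gt0 I : 0 < dlen I.
Proof. by rewrite exprz_gt0. Qed.

Lemma dlen_neq0 I : dlen I != 0.
Proof. by rewrite gt_eqF ?dlen_gt0. Qed.

Lemma dlen_left I : dlen (dyadic_left I) = dlen I / 2.
Proof. by rewrite /dyadic_len/= expfzDr// exprN1. Qed.

Lemma dlen_right I : dlen (dyadic_right I) = dlen I / 2.
Proof. exact: dlen_left. Qed.

(** Index of the dyadic interval of length $2^j$ around [x]. It turns membership and nesting of
    dyadic intervals into equations between indices. *)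
Definition didx (j : int) x : dyadic := (j, Num.floor (x / 2 ^ j)).

Lemma dsetP I x : dset I x <-> didx I.1 x = I.
Proof.
case: I => j k; rewrite /dyadic_set/= in_itv/= /didx /dyadic_len/=.
have l0 : 0 < (2 : R) ^ j by rewrite exprz_gt0.
rewrite -ler_pdivlMr// -ltr_pdivrMr//; split.
  by move=> h; rewrite (floor_def h).
by case=> <-; exact: floor_itv.
Qed.

Lemma dset_didx j x : dset (didx j x) x.
Proof. exact/dsetP. Qed.

Definition dparent I : dyadic := (I.1 + 1, (I.2 %/ 2)%Z).

Lemma dparentP I : I = dyadic_left (dparent I) \/ I = dyadic_right (dparent I).
Proof.
case: I => j k; rewrite /dyadic_left /dyadic_right/= addrK.
have := divz_eq k 2; have := @modz_ge0 k 2 isT; have := @ltz_pmod k 2 isT.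
move=> h1 h2 h3; have [h|h] : (k %% 2)%Z = 0 \/ (k %% 2)%Z = 1 by lia.
- by left; congr pair; lia.
- by right; congr pair; lia.
Qed.

Lemma dleft_neq_right I J : dyadic_left I != dyadic_right J.
Proof.
by apply/eqP => -[_ h]; lia.
Qed.

Lemma dleft_inj : injective dyadic_left.
Proof. by move=> [a b] [c e] [/= h1 h2]; congr pair; lia. Qed.

Lemma dright_inj : injective dyadic_right.
Proof. by move=> [a b] [c e] [/= h1 h2]; congr pair; lia. Qed.

Lemma dset_child I x : dset I x <-> dset (dyadic_left I) x \/ dset (dyadic_right I) x.
Proof.
case: I => j k; rewrite /dyadic_set/= !in_itv/= !dlen_left !dlen_right.
have l0 := dlen_gt0 (j, k); set l := dlen _ in l0 *.
rewrite !intrD !intrM; set K := k%:~R.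
have -> : (2 : int)%:~R = 2 :> R by [].
have -> : (1 : int)%:~R = 1 :> R by [].
have h1 : 2 * K * (l / 2) = K * l by field.
have h2 : (2 * K + 1) * (l / 2) = K * l + l / 2 by field.
have h3 : (2 * K + 1 + 1) * (l / 2) = K * l + l by field.
rewrite h1 h2 h3; split.
  move=> /andP[a b]; have [c|c] := ltP x (K * l + l / 2); [left|right].
    by rewrite a.
  by move: b; rewrite mulrDl mul1r => ->.
rewrite mulrDl mul1r; case=> /andP[a b]; apply/andP; split => //; lra.
Qed.

Lemma dset_disj I x : dset (dyadic_left I) x -> dset (dyadic_right I) x -> False.
Proof.
move=> /dsetP h /dsetP /=; rewrite /= in h; rewrite h => /eqP.
by rewrite (negbTE (dleft_neq_right _ _)).
Qed.

Lemma dset_left I x : dset (dyadic_left I) x -> dset I x.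
Proof. by move=> h; apply/dset_child; left. Qed.

Lemma dset_right I x : dset (dyadic_right I) x -> dset I x.
Proof. by move=> h; apply/dset_child; right. Qed.

Lemma didx_parent j x : didx (j + 1) x = dparent (didx j x).
Proof.
have h := dset_didx j x.
have {}h : dset (dparent (didx j x)) x.
  by case: (dparentP (didx j x)) => e; rewrite e in h;
    [have := dset_left h|have := dset_right h].
by move/dsetP : h.
Qed.

Lemma didx_up j j' x y : j <= j' -> didx j x = didx j y -> didx j' x = didx j' y.
Proof.
move=> jj' h; have -> : j' = j + (`|j' - j|%N)%:Z by lia.
elim: `|_|%N => [|n IH]; first by rewrite addr0.
by rewrite -addn1 PoszD addrA !didx_parent IH.
Qed.

Lemma measurable_dset I : measurable (dset I : set RR).
Proof. exact: measurable_itv. Qed.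

Lemma leb_dset I : leb (dset I) = (dlen I)%:E.
Proof.
rewrite /dyadic_set lebesgue_measure_itv/= lte_fin.
rewrite intrD mulrDl mul1r ltrDl dlen_gt0.
by rewrite -EFinB addrAC subrr add0r.
Qed.

Lemma integrable_cst_dset (c : R) I : leb.-integrable (dset I) (EFin \o (fun=> c)).
Proof.
apply/integrableP; split; first exact: measurable_cst.
rewrite (eq_integral (fun=> `|c|%:E))//.
rewrite integral_cst; last exact: measurable_dset.
by rewrite /= leb_dset ltry.
Qed.

Lemma haar0 I x : ~ dset I x -> haar I x = 0.
Proof.
move=> h; rewrite /haar !indicE !memNset ?subrr ?mul0r//.
- by move/dset_left.
- by move/dset_right.
Qed.

Lemma haar_left I x : dset (dyadic_left I) x -> haar I x = - (Num.sqrt (dlen I))^-1.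
Proof.
move=> h; have h' : ~ dset (dyadic_right I) x by move=> /(dset_disj h).
rewrite /haar !indicE (mem_set h) (memNset h').
by rewrite sub0r mulN1r.
Qed.

Lemma haar_right I x : dset (dyadic_right I) x -> haar I x = (Num.sqrt (dlen I))^-1.
Proof.
move=> h; have h' : ~ dset (dyadic_left I) x by move=> /dset_disj /(_ h).
rewrite /haar !indicE (mem_set h) (memNset h').
by rewrite subr0 mul1r.
Qed.

Lemma haar_const I j x y : j < I.1 -> didx j x = didx j y -> haar I x = haar I y.
Proof.
move=> jI xy; have h : didx (I.1 - 1) x = didx (I.1 - 1) y by apply: didx_up xy; lia.
have e K : K.1 = I.1 - 1 -> (\1_(dset K) x : R) = \1_(dset K) y.
  move=> K1; have hK : dset K x <-> dset K y by rewrite !dsetP K1 h.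
  rewrite !indicE; congr (nat_of_bool _)%:R.
  by apply/idP/idP; rewrite !inE => /hK.
by rewrite /haar !e.
Qed.

Lemma measurable_haar I : measurable_fun setT (haar I).
Proof.
by apply: measurable_funM => //; apply: measurable_funB; apply: measurable_indic;
  exact: measurable_dset.
Qed.

Lemma haar_sqr I x : haar I x ^+ 2 = (dlen I)^-1 * \1_(dset I) x.
Proof.
rewrite indicE; have [xI|xI] := boolP (x \in dset I); last first.
  by rewrite haar0 ?expr0n ?mulr0// => h; move/negP: xI; rewrite inE.
move: xI; rewrite inE => /dset_child[] h; rewrite ?(haar_left h) ?(haar_right h) ?sqrrN exprVn
  sqr_sqrtr ?mulr1//; by rewrite ltW// dlen_gt0.
Qed.

Lemma sqint_indic I : sqint leb (\1_(dset I) : RR -> R).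
Proof.
split; first by apply: measurable_indic; exact: measurable_dset.
rewrite /esq (eq_integral (fun x : RR => (\1_(dset I) x)%:E)).
  rewrite integral_indic//; last exact: measurable_dset.
  by rewrite setIT /= leb_dset ltry.
by move=> x _; rewrite indicE; case: (_ \in _); rewrite ?expr1n ?expr0n.
Qed.

Lemma sqint_haar I : sqint leb (haar I).
Proof.
apply: (@le_sqint _ RR R leb _ (fun x => (Num.sqrt (dlen I))^-1 * \1_(dset I) x)).
- exact: measurable_haar.
- by apply: sqintZ; exact: sqint_indic.
- move=> x; rewrite -ler_sqr ?nnegrE// !real_normK ?num_real// haar_sqr.
  rewrite exprMn exprVn sqr_sqrtr; last by rewrite ltW// dlen_gt0.
  by rewrite indicE; case: (_ \in _); rewrite ?expr1n ?expr0n.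
Qed.

Definition locint f := measurable_fun setT f /\
  forall I, leb.-integrable (dset I) (EFin \o f).

Definition din f I : R := \int[leb]_(x in dset I) f x.

Definition dav f I : R := din f I / dlen I.

Lemma locint_sqint f : sqint leb f -> locint f.
Proof.
move=> sf; split; first by case: sf.
move=> I; have := integrable_mul sf (sqint_indic I).
move=> h; apply/integrable_mkcond; first exact: measurable_dset.
apply: eq_integrable h => // x _ /=; rewrite /patch indicE.
by case: (_ \in _); rewrite ?mulr1 ?mulr0.
Qed.

Lemma din_child f I : locint f ->
  din f I = din f (dyadic_left I) + din f (dyadic_right I).
Proof.
move=> [mf fI]; rewrite /din.
have -> : dset I = dset (dyadic_left I) `|` dset (dyadic_right I).
  by apply/seteqP; split => x /dset_child.
rewrite Rintegral_setU//; try exact: measurable_dset.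
- have -> : dset (dyadic_left I) `|` dset (dyadic_right I) = dset I.
    by apply/seteqP; split => x /dset_child.
  exact: fI.
- by apply/disj_setPS => x [/dset_disj h /h].
Qed.

Lemma dav_child f I : locint f ->
  dav f I = (dav f (dyadic_left I) + dav f (dyadic_right I)) / 2.
Proof.
move=> lf; rewrite /dav dlen_left dlen_right (din_child _ lf).
by field; rewrite dlen_neq0.
Qed.

Lemma inner_haar f I : locint f ->
  inner f (haar I) = (din f (dyadic_right I) - din f (dyadic_left I)) / Num.sqrt (dlen I).
Proof.
move=> [mf fI]; rewrite /din Rintegral_mkcond [X in _ = (_ - X) / _]Rintegral_mkcond /inner.
have hR J : leb.-integrable setT (EFin \o (f \_ (dset J))).
  have := (integrable_mkcond (EFin \o f) (measurable_dset J)).1 (fI J).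
  by rewrite restrict_EFin.
rewrite -RintegralB//; try exact: hR.
rewrite -RintegralZr//; last first.
  have := integrableB measurableT (hR (dyadic_right I)) (hR (dyadic_left I)).
  by apply: eq_integrable.
apply: eq_Rintegral => x _; rewrite /haar /patch !indicE mulrA; congr (_ / _).
by case: (_ \in _); case: (_ \in _) => /=; rewrite ?subr0 ?sub0r ?subrr ?mulr1 ?mulr0 ?mulrN1.
Qed.

(** The dyadic martingale difference: the average of [f] jumps by [dd f I] from [I] to its right
    half and by the opposite to its left half. Its square times the length of [I] is the square of
    the Haar coefficient. *)
Definition dd f I : R := (dav f (dyadic_right I) - dav f (dyadic_left I)) / 2.

Lemma dd_inner f I : locint f -> dd f I = inner f (haar I) / Num.sqrt (dlen I).
Proof.
move=> lf; rewrite /dd inner_haar// /dav dlen_left dlen_right -mulrA -invfM -expr2.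
rewrite sqr_sqrtr; last by rewrite ltW// dlen_gt0.
by field; rewrite dlen_neq0.
Qed.

Lemma dav_right f I : locint f -> dav f (dyadic_right I) = dav f I + dd f I.
Proof. by move=> lf; rewrite (dav_child I lf) /dd; field. Qed.

Lemma dav_left f I : locint f -> dav f (dyadic_left I) = dav f I - dd f I.
Proof. by move=> lf; rewrite (dav_child I lf) /dd; field. Qed.

Lemma din_const f I (c : R) : (forall x, dset I x -> f x = c) -> din f I = c * dlen I.
Proof.
move=> fc; rewrite /din (@eq_Rintegral _ RR R leb _ (fun=> c)).
  rewrite Rintegral_cst; last exact: measurable_dset.
  by rewrite /= leb_dset.
by move=> x; rewrite inE => /fc.
Qed.

Lemma dav_const f I (c : R) : (forall x, dset I x -> f x = c) -> dav f I = c.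
Proof. by move=> /din_const; rewrite /dav => ->; rewrite mulfK ?dlen_neq0. Qed.

Lemma inner_haar_const f I (c : R) : (forall x, dset I x -> f x = c) -> inner f (haar I) = 0.
Proof.
move=> fc; rewrite /inner (@eq_Rintegral _ RR R leb _ (fun x => (c * \1_(dset I) x) * haar I x)).
  rewrite -/(inner _ _) inner_haar; last first.
    by apply: locint_sqint; apply: sqintZ; exact: sqint_indic.
  rewrite !(@din_const _ _ c) ?dlen_left ?dlen_right ?subrr ?mul0r// => x h.
  - by rewrite indicE mem_set ?mulr1//; exact: dset_left.
  - by rewrite indicE mem_set ?mulr1//; exact: dset_right.
move=> x _; rewrite indicE; have [xI|xI] := boolP (x \in dset I).
  by move: xI; rewrite inE => /fc ->; rewrite mulr1.
by rewrite haar0 ?mulr0// => h; move/negP: xI; rewrite inE.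
Qed.

Lemma haar_orthonormal I J : inner (haar I) (haar J) = (I == J)%:R.
Proof.
wlog IJ : I J / J.1 <= I.1.
  move=> h; have [/h //|/ltW /h] := leP J.1 I.1.
  by rewrite eq_sym => <-; rewrite /inner; apply: eq_Rintegral => x _; rewrite mulrC.
move: IJ; rewrite le_eqVlt => /predU1P[IJ1|JI].
  have [->|IJ] := eqVneq I J.
    rewrite inner_haar; last exact/locint_sqint/sqint_haar.
    rewrite (din_const (@haar_right J)) (din_const (@haar_left J)) dlen_left dlen_right.
    have s0 : Num.sqrt (dlen J) != 0 by rewrite gt_eqF// sqrtr_gt0 dlen_gt0.
    have : Num.sqrt (dlen J) ^+ 2 = dlen J by rewrite sqr_sqrtr// ltW// dlen_gt0.
    set s := Num.sqrt _ in s0 * => <-.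
    by rewrite /= mulr1n; field.
  apply: (@inner_haar_const _ _ 0) => x /dsetP xJ; apply: haar0 => /dsetP xI.
  by move/eqP: IJ; apply; rewrite -xI -xJ IJ1.
rewrite (_ : I == J = false); last by apply/negbTE/eqP => e; rewrite e ltxx in JI.
(* The function of larger scale is constant on [J]; its value is taken at the left endpoint of
   [J]. *)
apply: (@inner_haar_const _ _ (haar I (J.2%:~R * 2 ^ J.1))) => x xJ.
apply: haar_const JI _; move/dsetP: xJ ->; apply/esym/dsetP.
rewrite /dyadic_set/= in_itv/= lexx/= ltr_pM2r ?dlen_gt0//.
by rewrite ltr_int ltzD1.
Qed.

(** * Differentiation along dyadic intervals *)

(** The origin is interior to no dyadic interval, so the dyadic tree has two halves without a common
    ancestor. Everything that starts at a top interval is therefore done twice. *)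
Lemma dset_cover (m : nat) x : `|x| < 2 ^+ m ->
  dset (m%:Z, 0) x \/ dset (m%:Z, -1) x.
Proof.
rewrite ltr_norml => /andP[h1 h2].
have [x0|x0] := leP 0 x; [left|right]; rewrite /dyadic_set/= in_itv/= /dyadic_len/=.
  by rewrite mul0r x0 add0r mul1r.
by rewrite subrr mul0r mulN1r x0 andbT ltW.
Qed.

Lemma locint_locally f : locint f -> locally_integrable setT f.
Proof.
move=> [mf fI]; split => //; first exact: openT.
move=> K _ cK; have [M [_ MK]] := compact_bounded cK.
have {MK}MK : forall x, K x -> `|x| <= M + 1 by apply: MK; lra.
have [m hm] : exists m : nat, M + 1 < 2 ^+ m.
  by exists (Num.bound (M + 1)); apply: upper_nthrootP.
have mK := compact_measurable cK.
set A := dset (m%:Z, 0); set B := dset (m%:Z, -1).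
have AB : K `<=` A `|` B.
  by move=> x Kx; apply: dset_cover; exact: le_lt_trans (MK _ Kx) hm.
have mn : measurable_fun setT (fun x : RR => `|f x|%:E).
  by apply/measurable_EFinP; exact: measurableT_comp.
apply: (@le_lt_trans _ _ (\int[leb]_(x in A `|` B) `|f x|%:E)%E).
  apply: ge0_subset_integral => //.
  - by apply: measurableU; exact: measurable_dset.
  - exact: measurable_funS mn.
rewrite ge0_integral_setU//; try exact: measurable_dset.
- by apply: lte_add_pinfty; have /integrableP[_] := fI (m%:Z, 0);
    have /integrableP[_] := fI (m%:Z, -1).
- exact: measurable_funS mn.
- apply/disj_setPS => x [/dsetP/= h /dsetP/=]; rewrite h => /eqP.
  by rewrite xpair_eqE eqxx.
Qed.

(** A dyadic interval of length $r$ containing [x] lies in the ball of radius $r$ around [x], whose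
    length is $2r$. This carries Lebesgue differentiation over to dyadic averages. *)
Lemma dav_dist f I x : locint f -> dset I x ->
  (`|dav f I - f x|%:E <= 2%:E * davg f x (dlen I))%E.
Proof.
move=> [mf fI] Ix; set r := dlen I.
have r0 : 0 < r by exact: dlen_gt0.
have mI := @measurable_dset I.
have ic : leb.-integrable (dset I) (EFin \o (fun=> f x)).
  exact: integrable_cst_dset.
have isub : leb.-integrable (dset I) (EFin \o (fun y => f y - f x)).
  by have := integrableB mI (fI I) ic.
have -> : dav f I - f x = (\int[leb]_(y in dset I) (f y - f x)) / r.
  rewrite RintegralB// Rintegral_cst// /= leb_dset /= mulrBl mulfK//.
  exact: dlen_neq0.
have r10 : 0 <= r^-1 by rewrite invr_ge0 ltW.
rewrite normrM (ger0_norm r10) mulrC EFinM.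
have dI : (r^-1%:E * `|\int[leb]_(y in dset I) (f y - f x)|%:E <=
   r^-1%:E * \int[leb]_(y in dset I) `|f y - f x|%:E)%E.
  apply: lee_wpmul2l; first by rewrite lee_fin invr_ge0 ltW.
  rewrite EFin_normr_Rintegral//.
  apply: (le_trans (le_abse_integral _ _ _)) => //.
  by have /integrableP[] := isub.
apply: (le_trans dI).
rewrite /davg /iavg /= lebesgue_measure_ball; last exact: ltW.
rewrite inver mulrn_eq0/= gt_eqF// muleA -EFinM.
rewrite -[r *+ 2]mulr_natr invfM mulrCA divff// mulr1.
apply: lee_wpmul2l; first by rewrite lee_fin invr_ge0 ltW.
apply: ge0_subset_integral => //.
- exact: measurable_ball.
- apply/measurable_EFinP; apply: measurableT_comp => //; apply: measurable_funB => //.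
  exact: measurable_funS mf.
- move=> y; move: Ix; rewrite /dyadic_set/= ball_itv/= !in_itv/=.
  rewrite -/r !intrD !mulrDl mul1r => /andP[a1 a2] /andP[b1 b2].
  by apply/andP; split; lra.
Qed.

Lemma dyadic_differentiation f : locint f ->
  {ae leb, forall x, dav f (didx (- n%:Z) x) @[n --> \oo] --> f x}.
Proof.
move=> lf; apply: filterS (lebesgue_differentiation (locint_locally lf)) => x.
move=> /cvge_at_rightP /(_ (fun n => (2 : R) ^ (- n%:Z))) h.
have e : (fun n : nat => (2 : R) ^ (- n%:Z)) = geometric 1 2^-1.
  by apply/funext => n /=; rewrite mul1r exprVn exprnN.
have {}h : davg f x (2 ^ (- n%:Z)) @[n --> \oo] --> 0%E.
  apply: h; split; first by move=> n; rewrite exprz_gt0.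
  by rewrite e; apply: cvg_geometric; rewrite gtr0_norm ?invr_gt0// invf_lt1// ltr1n.
have : (fun n : nat => `|dav f (didx (- n%:Z) x) - f x|%:E) @ \oo --> 0%E.
  apply: (@squeeze_cvge _ _ _ _ (cst 0%E) _ (fun n : nat => 2%:E * davg f x (2 ^ (- n%:Z)))%E).
  - by apply: nearW => n; rewrite lee_fin normr_ge0/=; apply: dav_dist => //; exact: dset_didx.
  - exact: cvg_cst.
  - by rewrite -(mule0 2%:E); apply: cvgeZl.
move=> /fine_cvgP[_] /= /norm_cvg0P h0.
have : dav f (didx (- n%:Z) x) - f x + f x @[n --> \oo] --> 0 + f x.
  by apply: cvgD => //; exact: cvg_cst.
by rewrite add0r; under eq_fun do rewrite subrK.
Qed.

(** * The dyadic John-Nirenberg inequality *)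

(** Mean over the descendants of generation [n]. It replaces integrals, so that the stopping-time
    argument runs on a finite tree. *)
Fixpoint tav n phi I : R := if n is n'.+1 then
  (tav n' phi (dyadic_left I) + tav n' phi (dyadic_right I)) / 2 else phi I.

Lemma le_tav n phi psi I : (forall J, phi J <= psi J) -> tav n phi I <= tav n psi I.
Proof.
move=> h; elim: n I => [|n IH] I//=.
by have := IH (dyadic_left I); have := IH (dyadic_right I); lra.
Qed.

Lemma tav_affine n phi I (a c : R) :
  tav n (fun J => a * (phi J + c)) I = a * (tav n phi I + c).
Proof. by elim: n I => [|n IH] I//=; rewrite !IH; field. Qed.

Lemma exprD_le (k : nat) (s t : R) : 0 <= s -> 0 <= t ->
  (s + t) ^+ k <= 2 ^+ k * (s ^+ k + t ^+ k).
Proof.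
move=> s0 t0; wlog st : s t s0 t0 / s <= t.
  by move=> h; case: (leP s t) => [/h|/ltW /h]; [exact|rewrite addrC [s ^+ _ + _]addrC; exact].
apply: (@le_trans _ _ ((2 * t) ^+ k)).
  by rewrite lerXn2r ?nnegrE ?addr_ge0 ?mulr_ge0//; lra.
by rewrite exprMn ler_wpM2l ?exprn_ge0// lerDr exprn_ge0.
Qed.

(** Recentring costs $2^k$, so stopping at $\lambda = 2^{k+1}$ lets the restarted trees contribute
    only half of the bound $A$. With $L = \lambda B$ the recursion is $A = L^k + \lambda^{-1}2^k(A +
    (2L)^k)$, and [jncst] is its solution for $B = 1$. *)
Definition jnlam (k : nat) : R := 2 ^+ k.+1.
Definition jncst (k : nat) : R := 2 * jnlam k ^+ k + (2 * jnlam k) ^+ k.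

(* Stop at the maximal nodes where the mean [y c] of [|b - c|] exceeds
   [jnlam k * B], and restart there with the new centre [b Q]; as [y c] is a
   martingale started below [B], the stopped nodes carry a fraction at most
   [1 / jnlam k] of the mass. *)
Lemma john_nirenberg_tree (k : nat) (B : R) (b : dyadic -> R) (y : R -> dyadic -> R) :
  0 < B ->
  (forall (c : R) I, y c I = (y c (dyadic_left I) + y c (dyadic_right I)) / 2) ->
  (forall (c : R) I, `|b I - c| <= y c I) ->
  (forall I, y (b I) I <= B) ->
  forall n I, tav n (fun J => `|b J - b I| ^+ k) I <= jncst k * B ^+ k.
Proof.
move=> B0 yE yb yB.
have y0 (c : R) I : 0 <= y c I by exact: le_trans (yb c I).
pose L := jnlam k * B; pose A := jncst k * B ^+ k.
have l0 : 0 < jnlam k by rewrite exprn_gt0.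
have L0 : 0 < L by rewrite mulr_gt0.
have A0 : 0 <= A by rewrite /A /jncst mulr_ge0 ?addr_ge0 ?mulr_ge0 ?exprn_ge0 ?mulr_ge0// ltW.
pose E := 2 ^+ k * (A + (2 * L) ^+ k).
have E0 : 0 <= E by rewrite mulr_ge0 ?exprn_ge0// addr_ge0// exprn_ge0// mulr_ge0// ltW.
have k0 : (2 : R) ^+ k != 0 by rewrite expf_neq0 ?pnatr_eq0.
have AE : L ^+ k + (jnlam k)^-1 * E = A.
  rewrite /E /jnlam exprS invfM -mulrA [_^-1 * (2 ^+ k * _)]mulrA mulVf// mul1r.
  by rewrite /A /jncst /L !exprMn; field.
move=> n; elim/ltn_ind: n => n IH I.
(* The bound is affine in [y c J], so it passes from the halves to their parent just as the
   martingale [y c] does. The outer hypothesis [IH] is called only below a stopped node, on a tree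
   of smaller depth. *)
have step m (c : R) J : (m <= n)%N -> y c J <= L ->
    tav m (fun K => `|b K - c| ^+ k) J <= L ^+ k + y c J / L * E.
  elim: m c J => [|m IHm] c J mn yJ /=.
    apply: (@le_trans _ _ (L ^+ k)); first by apply: lerXn2r; rewrite ?nnegrE ?(ltW L0)//; exact: le_trans (yb c J) _.
    by rewrite lerDl mulr_ge0// divr_ge0// ltW.
  (* The halves of a node below the threshold stay below [2 * L], since their nonnegative values
     have mean at most [L]. A half beyond [L] is stopped: recentring at [b Q] bounds it by [E], and
     the factor [y c Q / L], then at least 1, pays for this. *)
  have child Q : y c Q <= 2 * L ->
      tav m (fun K => `|b K - c| ^+ k) Q <= L ^+ k + y c Q / L * E.
    move=> yQ; have [yQ1|yQ1] := leP (y c Q) L; first by apply: IHm => //; exact: ltnW.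
    apply: (@le_trans _ _ E).
      apply: (@le_trans _ _ (tav m (fun K => 2 ^+ k * (`|b K - b Q| ^+ k + `|b Q - c| ^+ k)) Q)).
        apply: le_tav => K; apply: le_trans (exprD_le _ _ _) => //.
        by rewrite lerXn2r ?nnegrE ?addr_ge0// (le_trans _ (ler_normD _ _))// subrKA.
      rewrite tav_affine; apply: ler_wpM2l; first by rewrite exprn_ge0.
      apply: lerD; first exact: IH.
      apply: lerXn2r; rewrite ?nnegrE//; first by lra.
      exact: le_trans (yb c Q) _.
    apply: (@le_trans _ _ (y c Q / L * E)); last by rewrite lerDr exprn_ge0// ltW.
    by rewrite -[leLHS]mul1r ler_wpM2r// ler_pdivlMr// mul1r ltW.
  have := yE c J; have := y0 c (dyadic_left J); have := y0 c (dyadic_right J) => h1 h2 h3.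
  have := child (dyadic_left J); have := child (dyadic_right J).
  move=> /(_ ltac:(lra)) h4 /(_ ltac:(lra)) h5.
  have -> : y c J / L * E = (y c (dyadic_left J) / L * E + y c (dyadic_right J) / L * E) / 2.
    by rewrite h3; field; rewrite gt_eqF.
  lra.
have yL : y (b I) I <= L.
  apply: le_trans (yB I) _; rewrite /L ler_peMl ?(ltW B0)//.
  by rewrite /jnlam exprn_ege1// ler1n.
apply: (le_trans (step n (b I) I (leqnn n) yL)).
rewrite -/A -AE lerD2l ler_wpM2r// /L ler_pdivrMr ?mulr_gt0//.
by rewrite mulrA mulVf ?mul1r ?gt_eqF.
Qed.

Lemma tav_integral n psi I : (forall J, 0 <= psi J) ->
  measurable_fun (dset I) (fun x : RR => psi (didx (I.1 - n%:Z) x)) /\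
  (\int[leb]_(x in dset I) (psi (didx (I.1 - n%:Z) x))%:E = (tav n psi I * dlen I)%:E)%E.
Proof.
move=> p0; elim: n I => [|n IH] I.
  have e x : dset I x -> psi (didx (I.1 - 0) x) = psi I by move=> /dsetP; rewrite subr0 => ->.
  split.
    apply: (@eq_measurable_fun _ _ _ _ _ (fun=> psi I)); last exact: measurable_cst.
    by move=> x; rewrite inE => /e ->.
  rewrite (eq_integral (fun=> (psi I)%:E)); last by move=> x; rewrite inE => /e ->.
  rewrite integral_cst; last exact: measurable_dset.
  by rewrite /= leb_dset.
have dE : dset I = dset (dyadic_left I) `|` dset (dyadic_right I).
  by apply/seteqP; split => x /dset_child.
have lE : I.1 - n.+1%:Z = (dyadic_left I).1 - n%:Z by rewrite /=; lia.
have [mL iL] := IH (dyadic_left I); have [mR iR] := IH (dyadic_right I).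
have mI : measurable_fun (dset I) (fun x : RR => psi (didx (I.1 - n.+1%:Z) x)).
  rewrite dE; apply/measurable_funU; [exact: measurable_dset..|].
  by rewrite lE.
split=> //; rewrite dE ge0_integral_setU; [|exact: measurable_dset..| | |].
- by rewrite lE iL iR /= -EFinD dlen_left dlen_right; congr EFin; field.
- by apply/measurable_EFinP; rewrite -dE.
- by move=> x _; rewrite lee_fin.
- by apply/disj_setPS => x [/dset_disj h /h].
Qed.

Lemma din_norm_dist f (c : R) I : locint f -> `|dav f I - c| <= dav (fun x => `|f x - c|) I.
Proof.
move=> [mf fI]; rewrite /dav /din.
have mI := @measurable_dset I.
have ic : leb.-integrable (dset I) (EFin \o (fun=> c)).
  exact: integrable_cst_dset.
have isub : leb.-integrable (dset I) (EFin \o (fun y => f y - c)).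
  by have := integrableB mI (fI I) ic.
have -> : (\int[leb]_(x in dset I) f x) / dlen I - c = (\int[leb]_(y in dset I) (f y - c)) / dlen I.
  rewrite RintegralB// Rintegral_cst// /= leb_dset /= mulrBl mulfK//.
  exact: dlen_neq0.
have r10 : 0 <= (dlen I)^-1 by rewrite invr_ge0 ltW// dlen_gt0.
rewrite normrM (ger0_norm r10).
by apply: ler_wpM2r => //; exact: le_normr_Rintegral.
Qed.

Lemma locint_dist f (c : R) : locint f -> locint (fun x => `|f x - c|).
Proof.
move=> [mf fI]; split.
  by apply: measurableT_comp => //; exact: measurable_funB.
move=> I; have mI := @measurable_dset I.
have ic : leb.-integrable (dset I) (EFin \o (fun=> c)).
  exact: integrable_cst_dset.
by have := integrable_abse (integrableB mI (fI I) ic).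
Qed.

Lemma cvg_exprn (u : nat -> R) (l : R) k : u n @[n --> \oo] --> l ->
  u n ^+ k @[n --> \oo] --> l ^+ k.
Proof.
move=> ul; elim: k => [|k IH]; first by under eq_fun do rewrite expr0; exact: cvg_cst.
by under eq_fun do rewrite exprS; rewrite exprS; exact: cvgM.
Qed.

(** The tree bound does not depend on the depth, so Fatou and dyadic differentiation carry it to the
    integral. The mean of $|f - c|$ serves as the martingale [y c]. *)
Lemma john_nirenberg k (B : R) f : 0 < B -> locint f ->
  (forall I, dav (fun x => `|f x - dav f I|) I <= B) ->
  forall I, (\int[leb]_(x in dset I) (`|f x - dav f I| ^+ k)%:E <=
    (jncst k * B ^+ k * dlen I)%:E)%E.
Proof.
move=> B0 lf fB I.
have h n := john_nirenberg_tree k B0 (fun (c : R) J => dav_child J (locint_dist c lf))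
  (fun (c : R) J => din_norm_dist c J lf) fB n I.
pose psi J := `|dav f J - dav f I| ^+ k.
have psi0 J : 0 <= psi J by rewrite exprn_ge0.
apply: (@fatou_le _ RR R leb (dset I) (fun n x => psi (didx (I.1 - n%:Z) x))).
- exact: measurable_dset.
- by move=> n; have [] := tav_integral n I psi0.
- apply: measurable_funX; apply: measurableT_comp => //; apply: measurable_funB => //.
  by apply: measurable_funS lf.1.
- by move=> n x _.
- apply: filterS (dyadic_differentiation lf) => x fx _.
  apply: cvg_exprn; apply: cvg_norm; apply: cvgB; last exact: cvg_cst.
  (* Scales are counted here from that of [I], in the differentiation theorem from 0; the two shifts
     make the sequences coincide. *)
  pose m := `|I.1|%N; pose m' := `|(m%:Z + I.1)%R|%N.
  rewrite -(cvg_shiftn m' (fun n => dav f (didx (I.1 - n%:Z) x))).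
  move: fx; rewrite -(cvg_shiftn m (fun n => dav f (didx (- n%:Z) x))).
  apply: cvg_trans; apply: near_eq_cvg; apply: nearW => n /=.
  by congr (dav f (didx _ x)); rewrite /m'; lia.
- move=> n; have [_ ->] := tav_integral n I psi0.
  by rewrite lee_fin; apply: ler_wpM2r; [exact/ltW/dlen_gt0|exact: h].
Qed.

(** * Haar sums and the shift *)

Lemma innerE f g : inner f g = ip leb f g.
Proof. by []. Qed.

Definition hs s c : RR -> R := fun x => \sum_(I <- s) c I * haar I x.

Lemma sqint_hs s c : sqint leb (hs s c).
Proof. by apply: sqint_sum => I; apply: sqintZ; exact: sqint_haar. Qed.

Lemma ip_hsl s c f : sqint leb f -> ip leb (hs s c) f = \sum_(I <- s) c I * inner f (haar I).
Proof.
move=> sf; rewrite ip_suml//; last by move=> I; apply: sqintZ; exact: sqint_haar.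
apply: eq_bigr => I _; rewrite ipZl//; last exact: sqint_haar.
by rewrite innerE ipC.
Qed.

Lemma inner_hs s c J : uniq s -> inner (hs s c) (haar J) = if J \in s then c J else 0.
Proof.
move=> us; rewrite innerE ip_hsl; last exact: sqint_haar.
have [Js|Js] := boolP (J \in s).
  rewrite (bigD1_seq J)//= haar_orthonormal eqxx mulr1 big1 ?addr0// => I IJ.
  by rewrite haar_orthonormal eq_sym (negbTE IJ) mulr0.
rewrite big_seq big1// => I Is; rewrite haar_orthonormal eq_sym.
by case: eqVneq => [e|_]; rewrite ?mulr0//; rewrite -e Is in Js.
Qed.

Lemma ip_hs s c : uniq s -> ip leb (hs s c) (hs s c) = \sum_(I <- s) c I ^+ 2.
Proof.
move=> us; rewrite ip_hsl; last exact: sqint_hs.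
by rewrite big_seq [RHS]big_seq; apply: eq_bigr => I Is; rewrite inner_hs// Is.
Qed.

Definition fc f J : R := inner f (haar J).

Lemma ip_sub_hs s f : uniq s -> sqint leb f ->
  ip leb (f \- hs s (fc f))%R (f \- hs s (fc f))%R = ip leb f f - \sum_(I <- s) fc f I ^+ 2.
Proof.
move=> us sf; have sh := sqint_hs s (fc f).
have e : ip leb f (hs s (fc f)) = \sum_(I <- s) fc f I ^+ 2.
  by rewrite ipC ip_hsl//.
rewrite ipBl ?ipBr//; last exact: sqintB.
by rewrite ip_hs// (ipC _ (hs _ _) f) e subrr subr0.
Qed.

Lemma bessel s f : uniq s -> sqint leb f -> \sum_(I <- s) fc f I ^+ 2 <= ip leb f f.
Proof. by move=> us sf; rewrite -subr_ge0 -ip_sub_hs// ip_ge0. Qed.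

(** Partial sums of the shift are indexed by parents. The list of all their halves is closed under
    exchanging siblings, so that sums over it are compatible with the shift. *)
Definition cseq A : seq dyadic := flatten [seq [:: dyadic_left K; dyadic_right K] | K <- A].

Lemma cseq_cons K A : cseq (K :: A) = [:: dyadic_left K, dyadic_right K & cseq A].
Proof. by []. Qed.

Lemma big_cseq A (F : dyadic -> R) :
  \sum_(I <- cseq A) F I = \sum_(K <- A) (F (dyadic_left K) + F (dyadic_right K)).
Proof.
elim: A => [|K A IH]; first by rewrite /cseq !big_nil.
by rewrite cseq_cons !big_cons IH addrA.
Qed.

Lemma cseq_left A K : (dyadic_left K \in cseq A) = (K \in A).
Proof.
elim: A => [|L A IH] //; rewrite cseq_cons !inE IH.
by rewrite (inj_eq dleft_inj) (negbTE (dleft_neq_right _ _)).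
Qed.

Lemma cseq_right A K : (dyadic_right K \in cseq A) = (K \in A).
Proof.
elim: A => [|L A IH] //; rewrite cseq_cons !inE IH.
by rewrite (inj_eq dright_inj) eq_sym (negbTE (dleft_neq_right _ _)).
Qed.

Lemma uniq_cseq A : uniq A -> uniq (cseq A).
Proof.
elim: A => [|K A IH] // /andP[KA uA]; rewrite cseq_cons /=.
by rewrite inE negb_or dleft_neq_right cseq_left cseq_right KA IH.
Qed.

(* [(S f, h_I) = tw (fun J => (f, h_J)) I]: see [fc_shift]. *)
Definition tw c I : R := if I == dyadic_left (dparent I) then c (dyadic_right (dparent I))
  else - c (dyadic_left (dparent I)).

Lemma dparent_left K : dparent (dyadic_left K) = K.
Proof. by case: K => j k; rewrite /dparent /dyadic_left/=; congr pair; lia. Qed.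

Lemma dparent_right K : dparent (dyadic_right K) = K.
Proof. by case: K => j k; rewrite /dparent /dyadic_right/=; congr pair; lia. Qed.

Lemma tw_left c K : tw c (dyadic_left K) = c (dyadic_right K).
Proof. by rewrite /tw dparent_left eqxx. Qed.

Lemma tw_right c K : tw c (dyadic_right K) = - c (dyadic_left K).
Proof. by rewrite /tw dparent_right eq_sym (negbTE (dleft_neq_right _ _)). Qed.

(** The coefficient form of $S^* = -S$; the next lemma is that of the isometry of $S$. *)
Lemma sum_tw A c c' : \sum_(I <- cseq A) c I * tw c' I = - \sum_(I <- cseq A) tw c I * c' I.
Proof.
rewrite !big_cseq -sumrN; apply: eq_bigr => K _.
by rewrite !tw_left !tw_right; ring.
Qed.

Lemma sum_tw_sqr A c : \sum_(I <- cseq A) tw c I ^+ 2 = \sum_(I <- cseq A) c I ^+ 2.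
Proof.
rewrite !big_cseq; apply: eq_bigr => K _.
by rewrite !tw_left !tw_right sqrrN addrC.
Qed.

Lemma shift_partialE (A : {fset int * int}) f :
  shift_partial A f = hs (cseq A) (tw (fc f)).
Proof.
apply/funext => x; rewrite /shift_partial /hs big_cseq; apply: eq_bigr => K _.
by rewrite tw_left tw_right mulNr.
Qed.

Lemma haar_dav f j x : locint f -> fc f (didx j x) * haar (didx j x) x =
  dav f (didx (j - 1) x) - dav f (didx j x).
Proof.
move=> lf; have s0 : Num.sqrt (dlen (didx j x)) != 0 by rewrite gt_eqF// sqrtr_gt0 dlen_gt0.
have e := dd_inner (didx j x) lf; rewrite -/(fc _ _) in e.
have h := dset_didx j x; case/dset_child: (h) => h'.
  rewrite (haar_left h'); move/dsetP: (h') => /= ->; rewrite dav_left// e.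
  by field.
rewrite (haar_right h'); move/dsetP: (h') => /= ->; rewrite dav_right// e.
by field.
Qed.

Lemma parent_haar_dav f j x : locint f ->
  let K := didx j x in
  fc f (dyadic_left K) * haar (dyadic_left K) x + fc f (dyadic_right K) * haar (dyadic_right K) x =
  dav f (didx (j - 2) x) - dav f (didx (j - 1) x).
Proof.
move=> lf K; have -> : j - 2 = j - 1 - 1 by lia.
rewrite -haar_dav//.
have h := dset_didx j x; case/dset_child: (h) => h'; rewrite -/K in h'.
  rewrite (@haar0 (dyadic_right K)) ?mulr0 ?addr0; last by move/(dset_disj h').
  by move/dsetP: (h') => /= ->.
rewrite (@haar0 (dyadic_left K)) ?mulr0 ?add0r; last by move/dset_disj; apply.
by move/dsetP: (h') => /= ->.
Qed.

(** Parents of scales from $-n+1$ to $n$. For $|x| < 2^n$ and $j > -n$ one has $|x/2^j| < 4^n$, so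
    at each of these scales the parent containing $x$ is among them. *)
Definition grid (n : nat) : seq dyadic :=
  [seq (i%:Z - n%:Z + 1, k%:Z - (4 ^ n)%N%:Z) | i <- iota 0 (n + n), k <- iota 0 (4 ^ n + 4 ^ n)].

Lemma uniq_grid n : uniq (grid n).
Proof.
apply: allpairs_uniq; rewrite ?iota_uniq// => -[a b] [a' b'] _ _ [h1 h2].
by congr pair; lia.
Qed.

(** At each scale only the parent containing [x] contributes, by the difference of two consecutive
    averages, so the sum telescopes over the scales. *)
Lemma hs_grid f n x : locint f -> `|x| < 2 ^+ n ->
  hs (cseq (grid n)) (fc f) x = dav f (didx (- n%:Z - 1) x) - dav f (didx (n%:Z - 1) x).
Proof.
move=> lf xn; rewrite /hs big_cseq /grid big_allpairs_dep/=.
rewrite (eq_big_seq (fun i : nat => - dav f (didx (i.+1%:Z - n%:Z - 1) x) -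
    - dav f (didx ((i%:Z - n%:Z) - 1) x))).
  have := @telescope_sumr R 0 (n + n) (fun i : nat => - dav f (didx ((i%:Z - n%:Z) - 1) x)) (leq0n _).
  rewrite /index_iota subn0 => ->.
  rewrite opprK addrC (_ : (n + n)%N%:Z - n%:Z - 1 = n%:Z - 1); last lia.
  by rewrite (_ : 0%N%:Z - n%:Z - 1 = - n%:Z - 1); last lia.
move=> i; rewrite mem_iota add0n => /andP[_ i2n]; set j := i%:Z - n%:Z + 1.
have jn : - n%:Z < j by rewrite /j; lia.
pose k0 := (didx j x).2.
have x4 : `|x / 2 ^ j| < (4 ^ n)%N%:R.
  rewrite normrM (ger0_norm (_ : 0 <= (2 ^ j)^-1)); last by rewrite invr_ge0 exprz_ge0.
  rewrite natrX (_ : 4%:R = 2 * 2)//; last by rewrite -natrM.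
  rewrite exprMn; apply: (@le_lt_trans _ _ (`|x| * 2 ^+ n)).
    apply: ler_wpM2l => //; rewrite invr_expz exprnP.
    by apply: ler_weXz2l; [rewrite ler1n|lia].
  by rewrite ltr_pM2r// exprn_gt0.
have [k0l k0r] : - (4 ^ n)%N%:Z <= k0 /\ k0 < (4 ^ n)%N%:Z.
  move: x4; rewrite ltr_norml => /andP[h1 h2]; rewrite /k0 /didx/=.
  by rewrite floor_ge_int floor_lt_int; split; rewrite ?mulrNz ?ltW.
have kk : (`|(k0 + (4 ^ n)%N%:Z)%R|%N)%:Z - (4 ^ n)%N%:Z = k0 by lia.
rewrite (bigD1_seq (`|(k0 + (4 ^ n)%N%:Z)%R|%N)) ?iota_uniq//=; last first.
  by rewrite mem_iota; apply/andP; split => //; lia.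
rewrite kk (_ : (j, k0) = didx j x)//.
rewrite parent_haar_dav// big1 ?addr0.
  rewrite opprK addrC (_ : j - 2 = i%:Z - n%:Z - 1); last by rewrite /j; lia.
  by rewrite (_ : j - 1 = i.+1%:Z - n%:Z - 1); last by rewrite /j; lia.
move=> k kk0; have nk (L : dyadic) : (dset L x -> dset (j, k%:Z - (4 ^ n)%N%:Z) x) -> haar L x = 0.
  move=> LL; apply: haar0 => /LL /dsetP/= h.
  by move/eqP: kk0; apply; move: kk; rewrite /k0 h/=; lia.
by rewrite !nk ?mulr0 ?addr0//; [exact: dset_right|exact: dset_left].
Qed.

(** Cauchy-Schwarz against the indicator of [I]. It makes the averages over long intervals tend to
    0, which disposes of the coarse end of the telescoping sum. *)
Lemma dav_cauchy f I : sqint leb f -> dav f I ^+ 2 * dlen I <= ip leb f f.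
Proof.
move=> sf; have si := @sqint_indic I.
have e : din f I = ip leb f \1_(dset I).
  rewrite /din Rintegral_mkcond; apply: eq_Rintegral => x _.
  by rewrite /patch indicE; case: (_ \in _); rewrite ?mulr1 ?mulr0.
have e1 : ip leb \1_(dset I) \1_(dset I) = dlen I.
  rewrite -[RHS]mul1r -(@din_const \1_(dset I)); last by move=> x h; rewrite indicE mem_set.
  rewrite /din Rintegral_mkcond; apply: eq_Rintegral => x _.
  by rewrite /patch indicE; case: (_ \in _); rewrite ?mulr1 ?mulr0.
have := ip_cauchy sf si; rewrite -e e1 /dav expr_div_n.
have l0 := dlen_gt0 I.
rewrite -ler_pdivrMr//; apply: le_trans.
by rewrite expr2 invfM -!mulrA mulVf ?mulr1 ?gt_eqF.
Qed.

Lemma hs_grid_cvg f : sqint leb f ->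
  {ae leb, forall x, hs (cseq (grid n)) (fc f) x @[n --> \oo] --> f x}.
Proof.
move=> sf; have lf := locint_sqint sf.
apply: filterS (dyadic_differentiation lf) => x fx.
have h1 : dav f (didx (- n%:Z - 1) x) @[n --> \oo] --> f x.
  move: fx; rewrite -(cvg_shiftn 1 (fun n => dav f (didx (- n%:Z) x))).
  apply: cvg_trans; apply: near_eq_cvg; apply: nearW => n.
  by congr (dav f (didx _ x)); lia.
have h2 : dav f (didx (n%:Z - 1) x) @[n --> \oo] --> 0.
  apply/cvgr0Pnorm_le => e e0.
  have [M hM] : exists M : nat, 2 * ip leb f f / e ^+ 2 < 2 ^+ M.
    by exists (Num.bound (2 * ip leb f f / e ^+ 2)); apply: upper_nthrootP.
  exists M => // n /= Mn.
  have := dav_cauchy (didx (n%:Z - 1) x) sf.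
  rewrite /dyadic_len/= expfzDr// exprN1 -exprnP => h.
  rewrite -ler_sqr ?nnegrE ?(ltW e0)// real_normK ?num_real//.
  have l0 : 0 < (2 : R) ^+ n by rewrite exprn_gt0.
  have : 2 * ip leb f f < 2 ^+ n * e ^+ 2.
    rewrite -ltr_pdivrMr ?exprn_gt0//; apply: (lt_le_trans hM).
    by rewrite ler_eXn2l// ltr1n.
  move=> h'; rewrite -(ler_pM2r l0).
  move: h; rewrite mulrA ler_pdivrMr// => /le_trans; apply.
  by rewrite mulrC (mulrC (e ^+ 2)) ltW.
have [M hM] : exists M : nat, `|x| < 2 ^+ M.
  by exists (Num.bound `|x|); apply: upper_nthrootP.
have h3 : dav f (didx (- n%:Z - 1) x) - dav f (didx (n%:Z - 1) x) @[n --> \oo] --> f x - 0.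
  exact: cvgB.
rewrite subr0 in h3; move: h3; apply: cvg_trans; apply: near_eq_cvg.
exists M => // n /= Mn; rewrite hs_grid//; apply: (lt_le_trans hM).
by rewrite ler_eXn2l// ltr1n.
Qed.

Lemma le_sum_subset s t (F : dyadic -> R) : uniq s -> uniq t -> {subset s <= t} ->
  (forall K, 0 <= F K) -> \sum_(K <- s) F K <= \sum_(K <- t) F K.
Proof.
move=> us ut st F0; rewrite [leRHS](bigID (fun K => K \in s))/=.
have -> : \sum_(K <- t | K \in s) F K = \sum_(K <- s) F K.
  rewrite -big_filter; apply: perm_big; apply: uniq_perm; rewrite ?filter_uniq// => K.
  by rewrite mem_filter; case: (boolP (K \in s)) => //= /st.
by rewrite lerDl sumr_ge0.
Qed.

(* Completeness of the Haar system: the partial sums over [grid n] telescope to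
   dyadic averages, hence converge almost everywhere, and Fatou applies. *)
Lemma parseval f (e : R) : sqint leb f -> 0 < e ->
  exists A : {fset int * int}, forall B : {fset int * int}, (A `<=` B)%fset ->
    ip leb f f - \sum_(I <- cseq B) fc f I ^+ 2 <= e.
Proof.
move=> sf e0; apply: contrapT => nA.
(* If a grid captured more, so would every larger index set, and the grid would be the set [A]
   sought. *)
have key n : \sum_(I <- cseq (grid n)) fc f I ^+ 2 <= ip leb f f - e.
  rewrite leNgt; apply/negP => h; apply: nA.
  exists [fset K in grid n]%fset => B AB.
  rewrite lerBlDr -lerBlDl; apply: (le_trans (ltW h)).
  rewrite !big_cseq; pose F (K : dyadic) := fc f (dyadic_left K) ^+ 2 + fc f (dyadic_right K) ^+ 2.
  have F0 K : 0 <= F K by rewrite addr_ge0 ?sqr_ge0.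
  change (\sum_(K <- grid n) F K <= \sum_(K <- B) F K).
  rewrite (perm_big (enum_fset [fset K in grid n]%fset))/=; last first.
    apply: uniq_perm; [exact: uniq_grid|exact: fset_uniq|].
    by move=> K; rewrite in_fset.
  by apply: le_sum_subset; [exact: fset_uniq|exact: fset_uniq|exact/fsubsetP|exact: F0].
have : (esq leb f <= (ip leb f f - e)%:E)%E.
  apply: (@fatou_esq _ RR R leb (fun n => hs (cseq (grid n)) (fc f))).
  - by move=> n; case: (sqint_hs (cseq (grid n)) (fc f)).
  - by case: sf.
  - exact: hs_grid_cvg.
  - move=> n; rewrite esqE; last exact: sqint_hs.
    by rewrite lee_fin ip_hs//; exact/uniq_cseq/uniq_grid.
by rewrite esqE// lee_fin; lra.
Qed.

Lemma shift_sqint f F : Defs.shift f F -> sqint leb f /\ sqint leb F.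
Proof. by move=> [/Lfun2P sf /Lfun2P sF _]. Qed.

Lemma shift_cvg f F : Defs.shift f F -> forall e : R, 0 < e ->
  exists A : {fset int * int}, forall B : {fset int * int}, (A `<=` B)%fset ->
    ip leb (hs (cseq B) (tw (fc f)) \- F)%R (hs (cseq B) (tw (fc f)) \- F)%R <= e.
Proof.
move=> [/Lfun2P sf /Lfun2P sF h] e e0.
have [A AP] := h (Num.sqrt e) ltac:(by rewrite sqrtr_gt0).
exists A => B AB; have := AP B AB.
have sd : sqint leb (hs (cseq B) (tw (fc f)) \- F)%R by apply: sqintB => //; exact: sqint_hs.
rewrite shift_partialE Lnorm2E esqE// poweR_EFin lte_fin powR12_sqrt ?ip_ge0//.
by rewrite ltr_sqrt// => /ltW.
Qed.

Lemma shiftI f F : sqint leb f -> sqint leb F -> (forall e : R, 0 < e ->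
  exists A : {fset int * int}, forall B : {fset int * int}, (A `<=` B)%fset ->
    ip leb (hs (cseq B) (tw (fc f)) \- F)%R (hs (cseq B) (tw (fc f)) \- F)%R <= e) ->
  Defs.shift f F.
Proof.
move=> sf sF h; split; [exact/Lfun2P|exact/Lfun2P|] => e e0.
have [A AP] := h ((e / 2) ^+ 2) ltac:(by rewrite exprn_gt0// divr_gt0).
exists A => B AB; have := AP B AB.
have sd : sqint leb (hs (cseq B) (tw (fc f)) \- F)%R by apply: sqintB => //; exact: sqint_hs.
rewrite shift_partialE Lnorm2E esqE// poweR_EFin lte_fin powR12_sqrt ?ip_ge0//.
move=> hB; apply: (@le_lt_trans _ _ (e / 2)); last first.
  by rewrite ltr_pdivrMr// ltr_pMr// ltr1n.
have e20 : 0 <= e / 2 by rewrite divr_ge0// ltW.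
by rewrite -(ger0_norm e20) -sqrtr_sqr; exact: ler_wsqrtr.
Qed.

(** * The commutator on the line *)

Fixpoint tsum n phi I : R := if n is n'.+1 then
  phi I + (tsum n' phi (dyadic_left I) + tsum n' phi (dyadic_right I)) else 0.

Lemma eq_tsum n phi psi I : (forall J, phi J = psi J) -> tsum n phi I = tsum n psi I.
Proof. by move=> h; elim: n I => [|n IH] I //=; rewrite h !IH. Qed.

Lemma tsumD n phi psi I :
  tsum n (fun J => phi J + psi J) I = tsum n phi I + tsum n psi I.
Proof. by elim: n I => [|n IH] I /=; rewrite ?addr0// !IH; ring. Qed.

Lemma tsumZ n (a : R) phi I : tsum n (fun J => a * phi J) I = a * tsum n phi I.
Proof. by elim: n I => [|n IH] I /=; rewrite ?mulr0// !IH; ring. Qed.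

Lemma ler_norm_tsum n phi psi I : (forall J, `|phi J| <= psi J) ->
  `|tsum n phi I| <= tsum n psi I.
Proof.
move=> h; elim: n I => [|n IH] I /=; first by rewrite normr0.
apply: le_trans (ler_normD _ _) _; apply: lerD => //.
by apply: le_trans (ler_normD _ _) _; apply: lerD.
Qed.

(** Below the root the nodes are grouped in sibling pairs, the form in which the shift produces its
    cancellation. *)
Lemma tsum_children n phi I :
  tsum n.+1 phi I = phi I + tsum n (fun K => phi (dyadic_left K) + phi (dyadic_right K)) I.
Proof.
elim: n I => [|n IH] I; first by rewrite /= !addr0.
by rewrite [LHS]/= -/(tsum n.+1 _ _) -/(tsum n.+1 _ (dyadic_right I)) !IH/=; ring.
Qed.

(** The variance, not divided by the length. Along the tree it loses exactly the squared Haar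
    coefficient at each node, so that for a symbol it acts as the Carleson mass below [I]. *)
Definition dvar f I : R := din (fun x => f x ^+ 2) I - dlen I * dav f I ^+ 2.

Definition locint2 f := locint f /\ locint (fun x => f x ^+ 2).

Lemma sqint_sqr f : sqint leb f -> locint (fun x => f x ^+ 2).
Proof.
move=> sf; have h := integrable_mul sf sf; split.
  by case: sf => mf _; exact: measurable_funX.
move=> I; apply: (@integrableS _ _ _ _ setT) => //; exact: measurable_dset.
Qed.

Lemma locint2_sqint f : sqint leb f -> locint2 f.
Proof. by move=> sf; split; [exact: locint_sqint|exact: sqint_sqr]. Qed.

Lemma dvar_child f I : locint2 f ->
  dvar f I = dlen I * dd f I ^+ 2 + (dvar f (dyadic_left I) + dvar f (dyadic_right I)).
Proof.
move=> [lf lf2]; rewrite /dvar (din_child I lf2) dav_left// dav_right// dlen_left dlen_right.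
by field.
Qed.

Lemma dvar_cst f I (c : R) : locint2 f ->
  \int[leb]_(x in dset I) ((f x - c) ^+ 2) = dvar f I + dlen I * (dav f I - c) ^+ 2.
Proof.
move=> [[mf lf] [mf2 lf2]].
have mI := @measurable_dset I.
have i1 := lf2 I.
have i2 : leb.-integrable (dset I) (EFin \o (fun x => (- 2 * c) * f x)).
  exact: (integrableZl mI (- 2 * c) (lf I)).
have i3 : leb.-integrable (dset I) (EFin \o (fun=> c ^+ 2)) by exact: integrable_cst_dset.
have i12 := integrableD mI i1 i2.
transitivity (\int[leb]_(x in dset I) ((f x ^+ 2 + (- 2 * c) * f x) + c ^+ 2)).
  by apply: eq_Rintegral => x _; ring.
rewrite RintegralD// RintegralD// RintegralZl// ?lf// Rintegral_cst//= leb_dset /=.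
rewrite /dvar -/(din f I) -/(din (fun x => f x ^+ 2) I).
have -> : din f I = dav f I * dlen I by rewrite /dav divfK// dlen_neq0.
by ring.
Qed.

Lemma dvarE f I : locint2 f ->
  dvar f I = \int[leb]_(x in dset I) ((f x - dav f I) ^+ 2).
Proof. by move=> lf; rewrite dvar_cst// subrr expr0n mulr0 addr0. Qed.

Lemma dvar_ge0 f I : locint2 f -> 0 <= dvar f I.
Proof. by move=> lf; rewrite dvarE//; apply: Rintegral_ge0 => x _; rewrite sqr_ge0. Qed.

Lemma le_dd_dvar f I : locint2 f -> dlen I * dd f I ^+ 2 <= dvar f I.
Proof. by move=> lf; rewrite dvar_child// lerDl addr_ge0// dvar_ge0. Qed.

Lemma tsum_energy n f I : locint2 f ->
  tsum n (fun J => dlen J * dd f J ^+ 2) I <= din (fun x => f x ^+ 2) I.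
Proof.
move=> lf; apply: (@le_trans _ _ (dvar f I)); last first.
  by rewrite lerBlDr lerDl mulr_ge0 ?sqr_ge0// ltW// dlen_gt0.
elim: n I => [|n IH] I /=; first exact: dvar_ge0.
by rewrite (dvar_child I lf) lerD2l lerD.
Qed.

(* Convexity of [(x, M) |-> x ^+ 2 / (1 + M)], with the gain coming from the
   jump [m] of [M]: the Bellman function of the Carleson embedding theorem. *)
Lemma carleson_bellman (x d m M1 M2 : R) : 0 <= m -> 0 <= M1 -> 0 <= M2 ->
  m + (M1 + M2) / 2 <= 1 ->
  m * x ^+ 2 / 4 <= ((x - d) ^+ 2 / (1 + M1) + (x + d) ^+ 2 / (1 + M2)) / 2
    - x ^+ 2 / (1 + (m + (M1 + M2) / 2)).
Proof.
move=> m0 M10 M20 hM; set a := (M1 + M2) / 2.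
have a0 : 0 <= a by rewrite /a divr_ge0// addr_ge0.
have tang (y c M : R) : 0 <= M -> 2 * y * c - c ^+ 2 * (1 + M) <= y ^+ 2 / (1 + M).
  move=> M0; have M1p : 0 < 1 + M by rewrite ltr_pwDl.
  rewrite ler_pdivlMr//; have := sqr_ge0 (y - c * (1 + M)); rewrite sqrrB exprMn.
  by rewrite !expr2 => h; nra.
pose c := x / (1 + a).
have h1 := tang (x - d) c M1 M10; have h2 := tang (x + d) c M2 M20.
have ap : 0 < 1 + a by rewrite ltr_pwDl.
have amp : 0 < 1 + (m + a) by rewrite ltr_pwDl// addr_ge0.
have e1 : c * (1 + a) = x by rewrite /c divfK// gt_eqF.
have h3 : x ^+ 2 / (1 + a) <= ((x - d) ^+ 2 / (1 + M1) + (x + d) ^+ 2 / (1 + M2)) / 2.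
  apply: (@le_trans _ _ ((2 * (x - d) * c - c ^+ 2 * (1 + M1) +
    (2 * (x + d) * c - c ^+ 2 * (1 + M2))) / 2)); last by lra.
  have -> : x ^+ 2 / (1 + a) = c * x by rewrite /c; field; rewrite gt_eqF.
  have -> : (2 * (x - d) * c - c ^+ 2 * (1 + M1) +
    (2 * (x + d) * c - c ^+ 2 * (1 + M2))) / 2 = 2 * x * c - c * (c * (1 + a)).
    by rewrite /a; field.
  by rewrite e1; lra.
apply: le_trans (lerB h3 (lexx _)).
have -> : x ^+ 2 / (1 + a) - x ^+ 2 / (1 + (m + a)) = m * x ^+ 2 / ((1 + a) * (1 + (m + a))).
  by field; rewrite !gt_eqF.
apply: ler_wpM2l; first by rewrite mulr_ge0 ?sqr_ge0.
rewrite lef_pV2 ?posrE ?mulr_gt0//.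
rewrite (_ : 4 = 2 * 2); last by ring.
by rewrite -/a in hM; apply: ler_pM; lra.
Qed.

(** Here [M J] is the normalized Carleson mass, at most 1 and with jump [dd b J ^+ 2 / v ^+ 2]. The
    function [Phi] is nonnegative, at most $4v^2\int f^2$, and from a node to its halves it drops by
    at least the summand, so the sum is bounded by its value at the root. *)
Lemma tsum_carleson n (v : R) b f I : 0 < v -> locint2 b -> locint2 f ->
  (forall J, dvar b J <= v ^+ 2 * dlen J) ->
  tsum n (fun J => dlen J * (dd b J ^+ 2 * dav f J ^+ 2)) I <=
    4 * v ^+ 2 * din (fun x => f x ^+ 2) I.
Proof.
move=> v0 lb lf bv; have v20 : 0 < v ^+ 2 by rewrite exprn_gt0.
pose M J := dvar b J / (v ^+ 2 * dlen J).
have l0 J : 0 < dlen J by exact: dlen_gt0.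
have M0 J : 0 <= M J by rewrite divr_ge0 ?dvar_ge0// mulr_ge0// ltW.
have M1 J : M J <= 1 by rewrite ler_pdivrMr ?mul1r ?mulr_gt0.
have ME J : M J = dd b J ^+ 2 / v ^+ 2 + (M (dyadic_left J) + M (dyadic_right J)) / 2.
  rewrite /M (dvar_child J lb) dlen_left dlen_right; field.
  by rewrite dlen_neq0 gt_eqF.
pose Phi J := 4 * v ^+ 2 * (din (fun x => f x ^+ 2) J - dlen J * (dav f J ^+ 2 / (1 + M J))).
apply: (@le_trans _ _ (Phi I)); last first.
  apply: ler_wpM2l; first by rewrite mulr_ge0// ltW.
  rewrite lerBlDr lerDl mulr_ge0 ?(ltW (l0 I))// divr_ge0 ?sqr_ge0//.
  by rewrite addr_ge0.
elim: n I => [|n IH] I /=.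
  apply: mulr_ge0; first by rewrite mulr_ge0// ltW.
  rewrite subr_ge0.
  have := dvar_ge0 I lf; rewrite subr_ge0; apply: le_trans.
  apply: ler_wpM2l; first exact: ltW.
  rewrite ler_pdivrMr ?ltr_pwDl//.
  by rewrite mulrDr mulr1 lerDl mulr_ge0 ?sqr_ge0.
apply: le_trans (lerD (lexx _) (lerD (IH _) (IH _))) _.
rewrite /Phi (din_child I lf.2) dlen_left dlen_right.
have := @carleson_bellman (dav f I) (dd f I) (dd b I ^+ 2 / v ^+ 2) _ _ _ (M0 (dyadic_left I)) (M0 (dyadic_right I)).
rewrite -ME -(dav_left I lf.1) -(dav_right I lf.1).
move=> /(_ ltac:(by rewrite divr_ge0// ?sqr_ge0// ltW) (M1 I)).
set A := (_ / _ + _ / _) / 2; set C := dav f I ^+ 2 / (1 + M I).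
set D1 := din _ (dyadic_left I); set D2 := din _ (dyadic_right I).
set P := (dav f (dyadic_left I) ^+ 2 / _); set Q := (dav f (dyadic_right I) ^+ 2 / _).
have -> : A = (P + Q) / 2 by [].
move=> h; have hh : dd b I ^+ 2 * dav f I ^+ 2 <= 4 * v ^+ 2 * ((P + Q) / 2 - C).
  have -> : dd b I ^+ 2 * dav f I ^+ 2 =
      4 * v ^+ 2 * (dd b I ^+ 2 / v ^+ 2 * dav f I ^+ 2 / 4).
    by field; rewrite gt_eqF.
  by apply: ler_wpM2l h; rewrite mulr_ge0// ltW.
have := ler_wpM2l (ltW (l0 I)) hh; nra.
Qed.

Definition leafconst f (j : int) := forall x y, didx j x = didx j y -> f x = f y.

Lemma leafconst_dset f I : leafconst f I.1 ->
  forall x, dset I x -> f x = dav f I.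
Proof.
move=> cf x xI; rewrite (@dav_const _ _ (f x))// => y yI; apply: cf.
by move/dsetP: xI ->; move/dsetP: yI ->.
Qed.

(** Averaging $(b \pm db)(f \pm df)(g \pm dg)$ over the two halves keeps the terms with an even
    number of differences. Only [f] and [g] have to be constant on the leaves: there the integral of
    the product sees [b] through its average. *)
Lemma trilinear_tsum n b f g I : locint b -> locint f -> locint g ->
  locint (fun x => b x * f x * g x) ->
  leafconst f (I.1 - n%:Z) -> leafconst g (I.1 - n%:Z) ->
  din (fun x => b x * f x * g x) I = dlen I * (dav b I * dav f I * dav g I) +
   tsum n (fun J => dlen J * (dav b J * (dd f J * dd g J) + dd b J * (dav f J * dd g J + dav g J * dd f J))) I.
Proof.
move=> lb lf lg lt; elim: n I => [|n IH] I cf cg.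
  rewrite subr0 in cf cg; rewrite /= addr0.
  transitivity (din (fun x => dav f I * dav g I * b x) I).
    apply: eq_Rintegral => x; rewrite inE => xI.
    by rewrite -(leafconst_dset cf xI) -(leafconst_dset cg xI); ring.
  rewrite /din RintegralZl; [|exact: measurable_dset|exact: lb.2].
  by rewrite -/(din b I) /dav; field; rewrite dlen_neq0.
have e : I.1 - n.+1%:Z = I.1 - 1 - n%:Z by lia.
rewrite (din_child I lt) !IH /= -?e//.
rewrite !dav_left// !dav_right// dlen_left dlen_right.
by field.
Qed.

(* What [F = S f] means for the martingale differences. *)
Definition haarpair f F := forall K, dd F (dyadic_left K) = dd f (dyadic_right K) /\
  dd F (dyadic_right K) = - dd f (dyadic_left K).

(** With $F = Sf$ and $G = Sg$ the left-hand side is, up to sign, the part over [I] of $([S,b]f,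
    g)$, because $S^* = -S$. The averages of [b] contribute at most $v$ and the paraproducts at most
    $5v/2$ times the bracket. *)
Lemma commutator_tree n (v : R) b f F g G I : 0 < v -> locint2 b ->
  (forall J, dvar b J <= v ^+ 2 * dlen J) ->
  locint2 f -> locint2 F -> locint2 g -> locint2 G ->
  locint (fun x => b x * f x * G x) -> locint (fun x => b x * F x * g x) ->
  [/\ leafconst f (I.1 - n.+1%:Z), leafconst F (I.1 - n.+1%:Z),
      leafconst g (I.1 - n.+1%:Z) & leafconst G (I.1 - n.+1%:Z)] ->
  haarpair f F -> haarpair g G ->
  dav f I = 0 -> dav F I = 0 -> dd f I = 0 -> dd F I = 0 ->
  `|din (fun x => b x * f x * G x) I + din (fun x => b x * F x * g x) I| <=
   4 * v * (din (fun x => f x ^+ 2) I + din (fun x => F x ^+ 2) I +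
    din (fun x => g x ^+ 2) I + din (fun x => G x ^+ 2) I).
Proof.
move=> v0 lb bv lf lF lg lG l1 l2 [cf cF cg cG] fF gG f0 F0 df0 dF0.
rewrite (trilinear_tsum (n := n.+1) lb.1 lf.1 lG.1 l1)//.
rewrite (trilinear_tsum (n := n.+1) lb.1 lF.1 lg.1 l2)//.
rewrite f0 F0 mulr0 !mul0r mulr0 !add0r -tsumD.
(* [T1] collects the averages of [b]: for [F = S f] and [G = S g] its values at
   the two halves of an interval cancel up to differences of adjacent averages.
   [T2] is a sum of paraproducts. *)
pose T1 J := dlen J * (dav b J * (dd f J * dd G J + dd F J * dd g J)).
pose T2 J := dlen J * (dd b J * (dav f J * dd G J) + dd b J * (dav G J * dd f J) +
  dd b J * (dav F J * dd g J) + dd b J * (dav g J * dd F J)).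
rewrite (@eq_tsum _ _ (fun J => T1 J + T2 J)); last by move=> J; rewrite /T1 /T2; ring.
rewrite tsumD.
have l0 J : 0 < dlen J by exact: dlen_gt0.
pose E h J := dlen J * dd h J ^+ 2.
have E0 h J : 0 <= E h J by rewrite mulr_ge0 ?sqr_ge0// ltW.
pose C h J := dlen J * (dd b J ^+ 2 * dav h J ^+ 2).
have bd J : `|dd b J| <= v.
  rewrite -ler_sqr ?nnegrE ?(ltW v0)// real_normK ?num_real//.
  by rewrite -(ler_pM2l (l0 J)) (le_trans (le_dd_dvar J lb))// mulrC bv.
have h1 : `|tsum n.+1 T1 I| <= v * (tsum n.+1 (E f) I + tsum n.+1 (E g) I).
  (* The root has no sibling in the tree, so its own term has to vanish; this is what the conditions
     on [dd f I] and [dd F I] are for. *)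
  rewrite tsum_children {1}/T1 df0 dF0 !mul0r addr0 !mulr0 add0r.
  rewrite -tsumD -tsumZ tsum_children.
  apply: (@le_trans _ _ (tsum n (fun K => v * (E f (dyadic_left K) + E g (dyadic_left K)) +
     v * (E f (dyadic_right K) + E g (dyadic_right K))) I)); last first.
    by rewrite lerDr mulr_ge0 ?addr_ge0// ltW.
  apply: ler_norm_tsum => K; rewrite /T1 /E.
  have [eF1 eF2] := fF K; have [eG1 eG2] := gG K.
  rewrite eF1 eF2 eG1 eG2 (dav_left K lb.1) (dav_right K lb.1) dlen_left dlen_right.
  set fl := dd f (dyadic_left K); set fr := dd f (dyadic_right K).
  set gl := dd g (dyadic_left K); set gr := dd g (dyadic_right K).
  have -> : dlen K / 2 * ((dav b K - dd b K) * (fl * gr + fr * gl)) +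
     dlen K / 2 * ((dav b K + dd b K) * (fr * - gl + - fl * gr)) =
     dlen K * (- dd b K * (fl * gr + fr * gl)) by field.
  rewrite normrM (ger0_norm (ltW (l0 K))).
  have -> : v * (dlen K / 2 * fl ^+ 2 + dlen K / 2 * gl ^+ 2) +
     v * (dlen K / 2 * fr ^+ 2 + dlen K / 2 * gr ^+ 2) =
     dlen K * (v * ((fl ^+ 2 + gr ^+ 2 + (fr ^+ 2 + gl ^+ 2)) / 2)) by field.
  apply: ler_wpM2l; first exact: ltW.
  rewrite normrM normrN; apply: ler_pM => //.
  rewrite ler_norml; apply/andP; split.
    by have := sqr_ge0 (fl + gr); have := sqr_ge0 (fr + gl); lra.
  by have := sqr_ge0 (fl - gr); have := sqr_ge0 (fr - gl); lra.
(* The weight balances the two sides: the Carleson sum is of order $v^2$ and the energy of order 1,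
   so both terms come out of order $v$. *)
have young (x y u : R) : `|u * (x * y)| <= (v^-1 * (u ^+ 2 * x ^+ 2) + v * y ^+ 2) / 2.
  have vV : v * v^-1 = 1 by rewrite divff// gt_eqF.
  have vp : 0 < v^-1 by rewrite invr_gt0.
  have e1 : v^-1 * (u ^+ 2 * x ^+ 2) + v * y ^+ 2 - 2 * (u * (x * y)) = v^-1 * (u * x - v * y) ^+ 2.
    by field; rewrite gt_eqF.
  have e2 : v^-1 * (u ^+ 2 * x ^+ 2) + v * y ^+ 2 + 2 * (u * (x * y)) = v^-1 * (u * x + v * y) ^+ 2.
    by field; rewrite gt_eqF.
  have p1 : 0 <= v^-1 * (u * x - v * y) ^+ 2 by rewrite mulr_ge0 ?sqr_ge0// ltW.
  have p2 : 0 <= v^-1 * (u * x + v * y) ^+ 2 by rewrite mulr_ge0 ?sqr_ge0// ltW.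
  by rewrite ler_norml; apply/andP; split; lra.
have h2 : `|tsum n.+1 T2 I| <=
   tsum n.+1 (fun J => 2^-1 * (v^-1 * (C f J + C G J + C F J + C g J) +
     v * (E G J + E f J + E g J + E F J))) I.
  apply: ler_norm_tsum => J; rewrite /T2 normrM (ger0_norm (ltW (l0 J))).
  have -> : 2^-1 * (v^-1 * (C f J + C G J + C F J + C g J) +
     v * (E G J + E f J + E g J + E F J)) = dlen J * (
     (v^-1 * (dd b J ^+ 2 * dav f J ^+ 2) + v * dd G J ^+ 2) / 2 +
     (v^-1 * (dd b J ^+ 2 * dav G J ^+ 2) + v * dd f J ^+ 2) / 2 +
     (v^-1 * (dd b J ^+ 2 * dav F J ^+ 2) + v * dd g J ^+ 2) / 2 +
     (v^-1 * (dd b J ^+ 2 * dav g J ^+ 2) + v * dd F J ^+ 2) / 2).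
    by rewrite /C /E; field; rewrite gt_eqF.
  apply: ler_wpM2l; first exact: ltW.
  do 3 (apply: le_trans (ler_normD _ _) _; apply: lerD; last exact: young).
  exact: young.
have car h : locint2 h -> tsum n.+1 (C h) I <= 4 * v ^+ 2 * din (fun x => h x ^+ 2) I.
  by move=> lh; exact: tsum_carleson.
have ene h : locint2 h -> tsum n.+1 (E h) I <= din (fun x => h x ^+ 2) I.
  by move=> lh; exact: tsum_energy.
rewrite tsumZ tsumD !tsumZ !tsumD in h2.
have := car f lf; have := car F lF; have := car g lg; have := car G lG.
have := ene f lf; have := ene F lF; have := ene g lg; have := ene G lG.
have dp h : 0 <= din (fun x => h x ^+ 2) I by apply: Rintegral_ge0 => x _; rewrite sqr_ge0.
move: (dp f) (dp F) (dp g) (dp G) h1 h2.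
move: (tsum n.+1 (C f) I) (tsum n.+1 (C F) I) (tsum n.+1 (C g) I) (tsum n.+1 (C G) I).
move: (tsum n.+1 (E f) I) (tsum n.+1 (E F) I) (tsum n.+1 (E g) I) (tsum n.+1 (E G) I).
move: (din (fun x => f x ^+ 2) I) (din (fun x => F x ^+ 2) I) (din (fun x => g x ^+ 2) I)
  (din (fun x => G x ^+ 2) I) (tsum n.+1 T1 I) (tsum n.+1 T2 I).
move=> a1 a2 a3 a4 X Y e1 e2 e3 e4 c1 c2 c3 c4 p1 p2 p3 p4 hX hY g4 g3 g2 g1 k4 k3 k2 k1.
have vi : v^-1 * (c1 + c4 + c2 + c3) <= 4 * v * (a1 + a2 + a3 + a4).
  have -> : 4 * v * (a1 + a2 + a3 + a4) = v^-1 * (4 * v ^+ 2 * (a1 + a2 + a3 + a4)).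
    by field; rewrite gt_eqF.
  by apply: ler_wpM2l; [rewrite invr_ge0 ltW|nra].
have ve1 : v * (e1 + e3) <= v * (a1 + a3) by apply: ler_wpM2l; [exact: ltW|lra].
have ve2 : v * (e4 + e1 + e3 + e2) <= v * (a1 + a2 + a3 + a4) by apply: ler_wpM2l; [exact: ltW|lra].
have va2 : 0 <= v * a2 by rewrite mulr_ge0// ltW.
have va4 : 0 <= v * a4 by rewrite mulr_ge0// ltW.
have va1 : 0 <= v * a1 by rewrite mulr_ge0// ltW.
have va3 : 0 <= v * a3 by rewrite mulr_ge0// ltW.
apply: le_trans (ler_normD _ _) _.
set S := _ + a4 in vi ve2 *.
have hS : v * (a1 + a3) <= v * S by apply: ler_wpM2l; [exact: ltW|rewrite /S; lra].
have e4S : 4 * v * S = 4 * (v * S) by rewrite mulrA.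
rewrite e4S in vi *; lra.
Qed.

(** * From finite Haar sums to square-integrable functions *)

Lemma locint_integrable f : leb.-integrable setT (EFin \o f) -> locint f.
Proof.
move=> fi; split.
  by apply/measurable_EFinP; case/integrableP: fi.
by move=> I; apply: (@integrableS _ _ _ _ setT) => //; exact: measurable_dset.
Qed.

Lemma locint_bounded f (N : R) : measurable_fun setT f -> (forall x, `|f x| <= N) -> locint f.
Proof.
move=> mf fN; split=> // I.
apply: (@le_integrable _ _ _ leb _ _ _ (EFin \o (fun=> N))).
- exact: measurable_dset.
- by apply/measurable_EFinP; exact: measurable_funS mf.
- by move=> x _ /=; rewrite lee_fin (le_trans (fN x))// ler_norm.
- exact: integrable_cst_dset.
Qed.

Lemma locint2_bounded f (N : R) : measurable_fun setT f -> (forall x, `|f x| <= N) -> locint2 f.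
Proof.
move=> mf fN; split; first exact: locint_bounded mf fN.
apply: (@locint_bounded _ (N ^+ 2)); first exact: measurable_funX.
by move=> x; rewrite normrX lerXn2r// nnegrE// (le_trans _ (fN x)).
Qed.

Lemma hsZ s c (t : R) : hs s (fun I => t * c I) = fun x => t * hs s c x.
Proof.
by apply/funext => x; rewrite /hs mulr_sumr; apply: eq_bigr => K _; rewrite mulrA.
Qed.

Lemma twZ c (t : R) : tw (fun I => t * c I) = fun I => t * tw c I.
Proof. by apply/funext => I; rewrite /tw; case: ifP => // _; rewrite mulrN. Qed.

Lemma dset_bound J x : dset J x -> `|x| < 2 ^+ (`|J.1| + `|J.2| + 1)%N.
Proof.
case: J => j k; rewrite /dyadic_set/= in_itv/= /dyadic_len/= => /andP[h1 h2].
have l0 : 0 < (2 : R) ^ j by rewrite exprz_gt0.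
have xk : `|x| <= (`|k|%N + 1)%:R * 2 ^ j.
  have k1 : k%:~R <= (`|k|%N)%:R :> R by rewrite -[leRHS]mulrz_nat ler_int; lia.
  have k2 : - (`|k|%N)%:R <= k%:~R :> R.
    by rewrite -[X in - X]mulrz_nat -mulrNz ler_int; lia.
  rewrite natrD ler_norml; apply/andP; split.
    apply: le_trans h1; rewrite -mulNr; apply: ler_wpM2r; first exact: ltW.
    by lra.
  apply/ltW/(lt_le_trans h2); apply: ler_wpM2r; first exact: ltW.
  by rewrite intrD; lra.
apply: (le_lt_trans xk); rewrite addnAC exprD mulrC.
have j2 : (2 : R) ^ j <= 2 ^+ (`|j|%N + 1).
  by rewrite exprnP; apply: ler_weXz2l; [rewrite ler1n|lia].
have k2 : (`|k|%N + 1)%:R <= (2 : R) ^+ `|k|%N.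
  by rewrite -natrX ler_nat addn1; apply: ltn_expl.
apply: (@le_lt_trans _ _ (2 ^ j * 2 ^+ `|k|%N)); first by apply: ler_wpM2l => //; exact: ltW.
rewrite ltr_pM2r ?exprn_gt0// exprnP.
by rewrite (@ltr_eXz2l R 2) ?ltr1n//; lia.
Qed.

(** One [m] controls position and scale together: all intervals of [s] lie within $(-2^m, 2^m)$ and
    their scales strictly between $-m$ and $m$. A tree of depth $2m + 1$ below scale $m$ therefore
    resolves every Haar sum over [s]. *)
Definition size_le s m := forall J, J \in s -> (`|J.1| + `|J.2| + 1 <= m)%N.

Lemma size_le_exists s : exists m, size_le s m.
Proof.
elim: s => [|J s [m h]]; first by exists 0%N.
exists ((`|J.1| + `|J.2| + 1) + m)%N => K; rewrite inE => /predU1P[->|/h]; lia.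
Qed.

Lemma hs_leafconst s c m : size_le s m -> leafconst (hs s c) (m%:Z - (2 * m).+1%:Z).
Proof.
move=> sm x y xy; rewrite /hs big_seq [RHS]big_seq; apply: eq_bigr => J Js.
by rewrite (@haar_const J _ x y _ xy)//; have := sm J Js; lia.
Qed.

Lemma dd_hs s c J : uniq s ->
  dd (hs s c) J = (if J \in s then c J else 0) / Num.sqrt (dlen J).
Proof. by move=> us; rewrite dd_inner ?inner_hs//; exact/locint_sqint/sqint_hs. Qed.

Lemma haarpair_hs A c : uniq A -> haarpair (hs (cseq A) c) (hs (cseq A) (tw c)).
Proof.
move=> uA K; have us := uniq_cseq uA.
rewrite !dd_hs// !cseq_left !cseq_right tw_left tw_right dlen_left dlen_right.
by split; case: (K \in A) => //; rewrite ?mulNr ?mul0r ?oppr0.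
Qed.

Lemma din_indic f I : din f I = ip leb f \1_(dset I).
Proof.
rewrite /din Rintegral_mkcond; apply: eq_Rintegral => x _.
by rewrite /patch indicE; case: (_ \in _); rewrite ?mulr1 ?mulr0.
Qed.

Lemma dav_hs s c I : (forall J, J \in s -> J.1 <= I.1) -> dav (hs s c) I = 0.
Proof.
move=> sI; rewrite /dav din_indic ip_hsl; last exact: sqint_indic.
rewrite big_seq big1 ?mul0r// => J Js.
rewrite (@inner_haar_const _ _ (\1_(dset I) (J.2%:~R * 2 ^ J.1))) ?mulr0// => x xJ.
have : didx I.1 x = didx I.1 (J.2%:~R * 2 ^ J.1 : R).
  apply: (didx_up (sI J Js)); move/dsetP: xJ ->; apply/esym/dsetP.
  rewrite /dyadic_set/= in_itv/= lexx/= ltr_pM2r ?dlen_gt0//.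
  by rewrite ltr_int ltzD1.
move=> h; rewrite !indicE; congr (nat_of_bool _)%:R.
by apply/idP/idP; rewrite !inE => /dsetP h'; apply/dsetP; rewrite -h' h.
Qed.

Lemma hs_support s c m x : size_le s m -> ~ (dset (m%:Z, 0) x \/ dset (m%:Z, -1) x) ->
  hs s c x = 0.
Proof.
move=> sm nx; rewrite /hs big_seq big1// => J Js; rewrite haar0 ?mulr0// => /dset_bound h.
apply: nx; apply: dset_cover; apply: (lt_le_trans h).
by rewrite ler_weXn2l ?ler1n//; exact: sm.
Qed.

Lemma dset_disj2 m : [disjoint dset (m%:Z, 0) & dset (m%:Z, -1)]%classic.
Proof.
apply/disj_setPS => x [/dsetP/= h /dsetP/=]; rewrite h => /eqP.
by rewrite xpair_eqE eqxx.
Qed.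

Lemma Rintegral_two f m : locint f ->
  (forall x, ~ (dset (m%:Z, 0) x \/ dset (m%:Z, -1) x) -> f x = 0) ->
  \int[leb]_x f x = din f (m%:Z, 0) + din f (m%:Z, -1).
Proof.
move=> [mf fI] f0; set U := dset (m%:Z, 0) `|` dset (m%:Z, -1).
have -> : \int[leb]_x f x = \int[leb]_(x in U) f x.
  rewrite [RHS]Rintegral_mkcond; apply: eq_Rintegral => x _.
  rewrite /patch; have [//|xU] := boolP (x \in U).
  by rewrite f0// => h; move/negP: xU; apply; rewrite inE.
rewrite /U Rintegral_setU//; try exact: measurable_dset.
- apply/integrableP; split.
    by apply/measurable_EFinP; exact: measurable_funS mf.
  rewrite ge0_integral_setU//; try exact: measurable_dset.
  + by apply: lte_add_pinfty; have /integrableP[_] := fI (m%:Z, 0);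
      have /integrableP[_] := fI (m%:Z, -1).
  + by apply: measurableT_comp => //; apply/measurable_EFinP; exact: measurable_funS mf.
  + exact: dset_disj2.
- exact: dset_disj2.
Qed.

(** Both sums are supported in the two intervals of length $2^m$ next to the origin, where the tree
    estimate applies. As the shift preserves the coefficient sums, each of them is counted twice,
    whence 8 in place of 4. *)
Lemma commutator_hs v (N : R) b A B c c' : 0 < v -> measurable_fun setT b ->
  (forall x, `|b x| <= N) -> (forall J, dvar b J <= v ^+ 2 * dlen J) ->
  uniq A -> uniq B ->
  `|ip leb (b \* hs (cseq A) c)%R (hs (cseq B) (tw c')) +
    ip leb (b \* hs (cseq A) (tw c))%R (hs (cseq B) c')| <=
  8 * v * (\sum_(I <- cseq A) c I ^+ 2 + \sum_(I <- cseq B) c' I ^+ 2).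
Proof.
move=> v0 mb bN bv uA uB.
have [m1 sA] := size_le_exists (cseq A); have [m2 sB] := size_le_exists (cseq B).
set m := maxn m1 m2.
have {}sA : size_le (cseq A) m by move=> J /sA /leq_trans; apply; rewrite leq_maxl.
have {}sB : size_le (cseq B) m by move=> J /sB /leq_trans; apply; rewrite leq_maxr.
set f := hs (cseq A) c; set F := hs (cseq A) (tw c).
set g := hs (cseq B) c'; set G := hs (cseq B) (tw c').
have sf : sqint leb f by exact: sqint_hs.
have sF : sqint leb F by exact: sqint_hs.
have sg : sqint leb g by exact: sqint_hs.
have sG : sqint leb G by exact: sqint_hs.
have l1 : locint (fun x => b x * f x * G x).
  apply: locint_integrable; exact: (integrable_mul (sqint_mul_bounded mb bN sf) sG).
have l2 : locint (fun x => b x * F x * g x).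
  apply: locint_integrable; exact: (integrable_mul (sqint_mul_bounded mb bN sF) sg).
have lb := locint2_bounded mb bN.
have usA := uniq_cseq uA.
have tree I : I.1 = m%:Z ->
  `|din (fun x => b x * f x * G x) I + din (fun x => b x * F x * g x) I| <=
   4 * v * (din (fun x => f x ^+ 2) I + din (fun x => F x ^+ 2) I +
    din (fun x => g x ^+ 2) I + din (fun x => G x ^+ 2) I).
  move=> Im; apply: (@commutator_tree (2 * m)) => //; try exact: locint2_sqint.
  - by rewrite Im; split; exact: hs_leafconst.
  - exact: haarpair_hs.
  - exact: haarpair_hs.
  - by apply: dav_hs => J /sA; rewrite Im; lia.
  - by apply: dav_hs => J /sA; rewrite Im; lia.
  - rewrite dd_hs//; case: ifP => [/sA|]; rewrite ?mul0r//; lia.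
  - rewrite dd_hs//; case: ifP => [/sA|]; rewrite ?mul0r//; lia.
have sq h s' c'' : h = hs s' c'' -> uniq s' -> size_le s' m ->
    \sum_(I <- s') c'' I ^+ 2 = din (fun x => h x ^+ 2) (m%:Z, 0) + din (fun x => h x ^+ 2) (m%:Z, -1).
  move=> -> us' sm; rewrite -ip_hs// -Rintegral_two//.
  - exact: (sqint_sqr (sqint_hs _ _)).
  - by move=> x nx; rewrite (hs_support c'' sm nx) expr0n.
rewrite /ip (@Rintegral_two (fun x => b x * f x * G x) m)//; last first.
  by move=> x nx; rewrite /f (hs_support _ sA nx) mulr0 mul0r.
rewrite (@Rintegral_two (fun x => b x * F x * g x) m)//; last first.
  by move=> x nx; rewrite /F (hs_support _ sA nx) mulr0 mul0r.
have t0 := tree (m%:Z, 0) erefl; have t1 := tree (m%:Z, -1) erefl.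
have := sq f _ _ erefl usA sA; have := sq F _ _ erefl usA sA.
have := sq g _ _ erefl (uniq_cseq uB) sB; have := sq G _ _ erefl (uniq_cseq uB) sB.
rewrite !sum_tw_sqr => q1 q2 q3 q4.
rewrite addrACA; apply: (le_trans (ler_normD _ _)); apply: (le_trans (lerD t0 t1)).
rewrite -mulrDr (_ : 8 * v = 4 * v * 2); last by ring.
rewrite -[leRHS]mulrA; apply: ler_wpM2l; first by rewrite mulr_ge0// ltW.
move: q1 q2 q3 q4; do 8 move: (din _ _) => ?.
by rewrite mulrDr; lra.
Qed.

(** Haar coefficients are continuous in $L^2$, and the coefficient of a partial sum at [J] has its
    final value as soon as the parent of [J] is included. *)
Lemma fc_shift f F J : Defs.shift f F -> fc F J = tw (fc f) J.
Proof.
move=> sh; have [sf sF] := shift_sqint sh.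
apply/eqP; rewrite -subr_eq0 -sqrf_eq0 eq_le sqr_ge0 andbT.
apply/ler_addgt0Pl => e e0; rewrite addr0.
have [A AP] := shift_cvg sh e0.
have := AP (A `|` [fset (dparent J)])%fset (fsubsetUl _ _).
set B := (_ `|` _)%fset => hB.
have PB : dparent J \in (B : seq _) by rewrite /B /= in_fsetU in_fset1 eqxx orbT.
have JB : J \in cseq B.
  by have [e1|e1] := dparentP J; rewrite e1 ?cseq_left ?cseq_right.
have uB := uniq_cseq (fset_uniq B).
have sh2 := @sqint_hs (cseq B) (tw (fc f)).
have sh3 := @sqint_haar J.
apply: le_trans hB.
have -> : fc F J - tw (fc f) J = - ip leb (hs (cseq B) (tw (fc f)) \- F)%R (haar J).
  by rewrite ipBl// -!innerE inner_hs// JB opprB.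
rewrite sqrrN; apply: (le_trans (ip_cauchy (sqintB sh2 sF) sh3)).
have hJ : ip leb (haar J) (haar J) = 1 by rewrite -innerE haar_orthonormal eqxx.
by rewrite hJ mulr1.
Qed.

Lemma ler_eps (x y : R) : (forall e, 0 < e -> x <= y + e) -> x <= y.
Proof. by move=> h; apply/ler_addgt0Pr. Qed.

(* The bilinear bound for finite Haar sums, transported to [f] and [F = S f] by
   approximation, the test function [g] being a finite Haar sum. *)
Lemma commutator_test v (N : R) b f F B c t : 0 < v -> 0 < t -> measurable_fun setT b ->
  (forall x, `|b x| <= N) -> (forall J, dvar b J <= v ^+ 2 * dlen J) ->
  Defs.shift f F -> uniq B ->
  `|ip leb (b \* f)%R (hs (cseq B) (tw c)) + ip leb (b \* F)%R (hs (cseq B) c)| <=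
  8 * v * (t * ip leb f f + t^-1 * \sum_(I <- cseq B) c I ^+ 2).
Proof.
move=> v0 t0 mb bN bv sh uB; have [sf sF] := shift_sqint sh.
set G := hs (cseq B) (tw c); set g := hs (cseq B) c.
have sG : sqint leb G by exact: sqint_hs.
have sg : sqint leb g by exact: sqint_hs.
have sbG := sqint_mul_bounded mb bN sG; have sbg := sqint_mul_bounded mb bN sg.
have mv (h k : RR -> R) : ip leb (b \* h)%R k = ip leb h (b \* k)%R.
  by apply: eq_Rintegral => x _ /=; ring.
rewrite !mv; apply: ler_eps => e e0.
set P := ip leb (b \* G)%R (b \* G)%R; set Q := ip leb (b \* g)%R (b \* g)%R.
have P0 : 0 <= P by exact: ip_ge0.
have Q0 : 0 <= Q by exact: ip_ge0.
(* Chosen so that each of the two Cauchy-Schwarz errors is at most [e / 2]; the 1 keeps the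
   denominator positive. *)
pose d := (e / 2) ^+ 2 / (P + Q + 1).
have PQ : 0 < P + Q + 1 by rewrite ltr_wpDl// addr_ge0.
have d0 : 0 < d by rewrite divr_gt0// exprn_gt0// divr_gt0.
have [A1 hA1] := parseval sf d0; have [A2 hA2] := shift_cvg sh d0.
pose A := (A1 `|` A2)%fset.
have uA : uniq (A : seq dyadic) by exact: fset_uniq.
have usA := uniq_cseq uA.
have {}hA1 := hA1 A (fsubsetUl _ _); have {}hA2 := hA2 A (fsubsetUr _ _).
set fA := hs (cseq A) (fc f); set FA := hs (cseq A) (tw (fc f)).
have sfA : sqint leb fA by exact: sqint_hs.
have sFA : sqint leb FA by exact: sqint_hs.
(* Applied to $tf$ and then divided by $t$: the free weight is left for the final absorption. *)
have := @commutator_hs v N b A B (fun I => t * fc f I) c v0 mb bN bv uA uB.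
have -> : (b \* hs (cseq A) (fun I => t * fc f I))%R = (fun x => t * (b \* fA)%R x).
  by rewrite hsZ; apply/funext => x /=; rewrite mulrCA.
have -> : (b \* hs (cseq A) (tw (fun I => t * fc f I)))%R = (fun x => t * (b \* FA)%R x).
  by rewrite twZ hsZ; apply/funext => x /=; rewrite mulrCA.
have sbfA := sqint_mul_bounded mb bN sfA; have sbFA := sqint_mul_bounded mb bN sFA.
rewrite !ipZl//.
have -> : \sum_(I <- cseq A) (t * fc f I) ^+ 2 = t ^+ 2 * \sum_(I <- cseq A) fc f I ^+ 2.
  by rewrite mulr_sumr; apply: eq_bigr => K _; rewrite exprMn.
rewrite -mulrDr normrM (gtr0_norm t0) !mv => h1.
have h2 : `|ip leb fA (b \* G)%R + ip leb FA (b \* g)%R| <=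
    8 * v * (t * ip leb f f + t^-1 * \sum_(I <- cseq B) c I ^+ 2).
  rewrite -(ler_pM2l t0); apply: (le_trans h1).
  rewrite mulrCA; apply: ler_wpM2l; first by rewrite mulr_ge0// ltW.
  rewrite mulrDr [t * (t^-1 * _)]mulrA mulfV ?gt_eqF// mul1r lerD2r mulrA -expr2.
  by apply: ler_wpM2l; [rewrite sqr_ge0|exact: bessel].
have cs (h k : RR -> R) D : sqint leb h -> sqint leb k -> ip leb h h <= d ->
    ip leb k k = D -> 0 <= D -> D <= P + Q + 1 -> `|ip leb h k| <= e / 2.
  move=> sh' sk hd kD D0 DPQ; have e20 : 0 <= e / 2 by rewrite divr_ge0// ltW.
  rewrite -ler_sqr ?nnegrE// real_normK ?num_real//.
  apply: (le_trans (ip_cauchy sh' sk)); rewrite kD.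
  apply: (@le_trans _ _ (d * (P + Q + 1))); first by apply: ler_pM => //; exact: ip_ge0.
  by rewrite /d divfK// gt_eqF.
have c1 : `|ip leb (f \- fA)%R (b \* G)%R| <= e / 2.
  apply: (cs _ _ P) => //; [exact: sqintB| |lra].
  by rewrite ip_sub_hs.
have c2 : `|ip leb (FA \- F)%R (b \* g)%R| <= e / 2.
  by apply: (cs _ _ Q) => //; [exact: sqintB|lra].
rewrite !ipBl// in c1 c2.
move: h2 c1 c2; move: (8 * v * _) => X; do !(move: (ip _ _ _) => ?); rewrite !ler_norml.
move=> /andP[? ?] /andP[? ?] /andP[? ?]; apply/andP; split; lra.
Qed.

Definition comcst : R := 2 ^+ 8.

Lemma comcst_ge0 : 0 <= comcst.
Proof. by rewrite exprn_ge0. Qed.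

(** Duality: the commutator [W] is tested against a partial sum of its own Haar expansion that
    captures its energy up to [e]. *)
Lemma commutator_1d v (N : R) b f F G : 0 < v -> measurable_fun setT b ->
  (forall x, `|b x| <= N) -> (forall J, dvar b J <= v ^+ 2 * dlen J) ->
  Defs.shift f F -> Defs.shift (b \* f)%R G ->
  ip leb (G \- b \* F)%R (G \- b \* F)%R <= comcst * v ^+ 2 * ip leb f f.
Proof.
move=> v0 mb bN bv shf shb.
have [sf sF] := shift_sqint shf; have [sbf sG] := shift_sqint shb.
have sbF := sqint_mul_bounded mb bN sF.
set W := (G \- b \* F)%R; have sW : sqint leb W by exact: sqintB.
apply: ler_eps => e e0.
have [A hA] := parseval sW e0; have {}hA := hA A (fsubset_refl _).
have uA : uniq (A : seq dyadic) by exact: fset_uniq.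
have usA := uniq_cseq uA.
set g := hs (cseq A) (fc W).
have sg : sqint leb g by exact: sqint_hs.
have e1 : ip leb W g = \sum_(I <- cseq A) fc W I ^+ 2 by rewrite ipC ip_hsl.
have e2 : ip leb G g = - ip leb (b \* f)%R (hs (cseq A) (tw (fc W))).
  rewrite ipC ip_hsl// ipC ip_hsl//.
  rewrite -[X in _ = - X]/(\sum_(I <- cseq A) tw (fc W) I * fc (b \* f)%R I) -sum_tw.
  by apply: eq_bigr => K _; rewrite -(fc_shift K shb).
(* With this weight the energy [S] of the test function reappears with factor 1/2 and is absorbed:
   $S \le 128v^2\|f\|^2 + S/2$ gives the constant 256 of [comcst]. *)
have t0 : 0 < 16 * v by rewrite mulr_gt0.
have := commutator_test (fc W) v0 t0 mb bN bv shf uA.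
rewrite -/g; have -> : ip leb (b \* f)%R (hs (cseq A) (tw (fc W))) + ip leb (b \* F)%R g = - ip leb W g.
  by rewrite /W ipBl// e2; ring.
rewrite normrN e1 => h.
have := le_trans (ler_norm _) h; set S := \sum_(I <- cseq A) _ in hA *.
have -> : 8 * v * (16 * v * ip leb f f + (16 * v)^-1 * S) = 128 * v ^+ 2 * ip leb f f + S / 2.
  by field; rewrite gt_eqF.
have -> : comcst = 256 by rewrite /comcst; ring.
lra.
Qed.

Lemma esq_shift f F : Defs.shift f F -> ip leb F F <= ip leb f f.
Proof.
move=> sh; have [sf sF] := shift_sqint sh.
apply: ler_eps => e e0.
have [A hA] := parseval sF e0; have {}hA := hA A (fsubset_refl _).
have uA : uniq (A : seq dyadic) by exact: fset_uniq.
have := bessel (uniq_cseq uA) sf; rewrite -sum_tw_sqr.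
rewrite (eq_bigr (fun I => fc F I ^+ 2)); first by move: hA; lra.
by move=> I _; rewrite (fc_shift I sh).
Qed.

End Line.

(** * Linearity of the shift and its construction from a sequence *)

Section ShiftAlgebra.
Context {R : realType}.
Local Notation leb := (@lebesgue_measure R).
Local Notation RR := (measurableTypeR R).
Implicit Types (f F g : RR -> R) (A B : {fset int * int}).

Lemma fcB f g : sqint leb f -> sqint leb g -> fc (f \- g)%R = fun I => fc f I - fc g I.
Proof.
by move=> sf sg; apply/funext => I; rewrite /fc !innerE ipBl//; exact: sqint_haar.
Qed.

Lemma hsB s (c c' : dyadic -> R) : hs s (fun I => c I - c' I) = (hs s c \- hs s c')%R.
Proof.
apply/funext => x; rewrite /hs /= -sumrB; apply: eq_bigr => I _.
by rewrite mulrBl.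
Qed.

Lemma twB (c c' : dyadic -> R) : tw (fun I => c I - c' I) = fun I => tw c I - tw c' I.
Proof. by apply/funext => I; rewrite /tw; case: ifP => // _; rewrite opprD. Qed.

Lemma ip_sub_le f g h : sqint leb f -> sqint leb g -> sqint leb h ->
  ip leb (f \- g)%R (f \- g)%R <= 2 * ip leb (f \- h)%R (f \- h)%R + 2 * ip leb (h \- g)%R (h \- g)%R.
Proof.
move=> sf sg sh; rewrite -lee_fin EFinD !EFinM.
have sfg := sqintB sf sg; have sfh := sqintB sf sh; have shg := sqintB sh sg.
rewrite -!esqE//; have -> : (f \- g)%R = ((f \- h) \+ (h \- g))%R.
  by apply/funext => x /=; ring.
by apply: esqD; [case: sfh|case: shg].
Qed.

Lemma shift_sub f F g G : Defs.shift f F -> Defs.shift g G ->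
  Defs.shift (f \- g)%R (F \- G)%R.
Proof.
move=> shf shg; have [sf sF] := shift_sqint shf; have [sg sG] := shift_sqint shg.
apply: shiftI => [||e e0]; [exact: sqintB..|].
have e4 : 0 < e / 4 by rewrite divr_gt0.
have [A1 h1] := shift_cvg shf e4; have [A2 h2] := shift_cvg shg e4.
exists (A1 `|` A2)%fset => B /fsubUsetP[B1 B2].
have {}h1 := h1 B B1; have {}h2 := h2 B B2.
rewrite fcB// twB hsB; set P := hs _ _ in h1 *; set Q := hs _ _ in h2 *.
have sP : sqint leb P by exact: sqint_hs.
have sQ : sqint leb Q by exact: sqint_hs.
have spf := sqintB sP sF; have sqg := sqintB sQ sG.
have -> : ((P \- Q) \- (F \- G))%R = ((P \- F) \- (Q \- G))%R.
  by apply/funext => x /=; ring.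
have s0 := @sqint0 _ _ R leb.
have := ip_sub_le spf sqg s0.
have -> : ((P \- F) \- (fun=> 0))%R = (P \- F)%R by apply/funext => x /=; rewrite subr0.
have -> : ip leb ((fun=> 0) \- (Q \- G))%R ((fun=> 0) \- (Q \- G))%R = ip leb (Q \- G)%R (Q \- G)%R.
  by apply: eq_Rintegral => x _ /=; ring.
lra.
Qed.

(** An increasing sequence, cofinal among the finite index sets: the unconditional sums are
    constructed along it, with the same sets on every slice. *)
Definition box (n : nat) : {fset int * int} :=
  [fset K in [seq (i%:Z - n%:Z, k%:Z - n%:Z) | i <- iota 0 (n + n).+1, k <- iota 0 (n + n).+1]]%fset.

Lemma in_box n K : (K \in box n) = (`|K.1| <= n)%N && (`|K.2| <= n)%N.
Proof.
case: K => a b; rewrite in_fset; apply/idP/idP => [|/andP[an bn]].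
  move=> /allpairsP[[i k] [hi hk e]]; rewrite !mem_iota in hi hk.
  by move: e hi hk => [-> ->] /= hi hk; apply/andP; split; lia.
rewrite /= in an bn; apply/allpairsP; exists (`|(a + n%:Z)%R|%N, `|(b + n%:Z)%R|%N); rewrite !mem_iota.
rewrite /fst /snd; split; [lia|lia|congr pair; lia].
Qed.

Lemma box_mono n m : (n <= m)%N -> (box n `<=` box m)%fset.
Proof.
by move=> nm; apply/fsubsetP => K; rewrite !in_box => /andP[h1 h2]; apply/andP; split; lia.
Qed.

Lemma box_exhaust (B : {fset int * int}) : exists n, (B `<=` box n)%fset.
Proof.
have [m h] := size_le_exists (B : seq dyadic); exists m; apply/fsubsetP => K KB.
by have hK := h K KB; rewrite in_box; apply/andP; split; apply: leq_trans hK;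
  rewrite addn1 ltnW// ltnS ?leq_addr ?leq_addl.
Qed.

Lemma ip_hs_sub s t (c : dyadic -> R) : uniq s -> uniq t -> {subset s <= t} ->
  ip leb (hs t c \- hs s c)%R (hs t c \- hs s c)%R =
  \sum_(I <- t) c I ^+ 2 - \sum_(I <- s) c I ^+ 2.
Proof.
move=> us ut st; have ss := @sqint_hs R s c; have tt := @sqint_hs R t c.
have e : ip leb (hs s c) (hs t c) = \sum_(I <- s) c I ^+ 2.
  rewrite ip_hsl// big_seq [RHS]big_seq; apply: eq_bigr => I Is.
  by rewrite inner_hs// (st I Is).
rewrite ipBl ?ipBr//; last exact: sqintB.
by rewrite !ip_hs// (ipC leb (hs t c) (hs s c)) e subrr subr0.
Qed.

Lemma subset_cseq (A B : {fset int * int}) : (A `<=` B)%fset -> {subset cseq A <= cseq B}.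
Proof.
move=> /fsubsetP AB I; case: (dparentP I) => ->; rewrite ?cseq_left ?cseq_right; exact: AB.
Qed.

(** By orthogonality the tails of the shifted series are tails of the Parseval sum of [f], hence
    small beyond a finite set, whatever the order of summation. The almost everywhere limit then
    identifies the sum as [F], by Fatou. *)
Lemma shift_of_ae_cvg f F (k : nat -> nat) : sqint leb f -> sqint leb F ->
  (forall j, (j <= k j)%N) ->
  {ae leb, forall y, hs (cseq (box (k j))) (tw (fc f)) y @[j --> \oo] --> F y} ->
  Defs.shift f F.
Proof.
move=> sf sF jk cF; apply: shiftI => // e e0.
have e4 : 0 < e / 4 by rewrite divr_gt0.
have [A hA] := parseval sf e4; exists A => B AB.
have [n0 An0] := box_exhaust A.
pose h (C : {fset int * int}) := hs (cseq C) (tw (fc f)).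
have sh C : sqint leb (h C) by exact: sqint_hs.
have tail C : (A `<=` C)%fset -> ip leb (h C \- h A)%R (h C \- h A)%R <= e / 4.
  move=> AC; rewrite ip_hs_sub; [|exact/uniq_cseq/fset_uniq..|exact: subset_cseq].
  rewrite !sum_tw_sqr; apply: le_trans (hA A (fsubset_refl _)).
  by rewrite lerB// bessel//; exact/uniq_cseq/fset_uniq.
rewrite -lee_fin -esqE; last by apply: sqintB => //; exact: sqint_hs.
apply: (@fatou_esq _ RR R leb (fun j => h B \- h (box (k (j + n0)%N)))%R).
- by move=> j; case: (sqintB (sh B) (sh (box (k (j + n0)%N)))).
- by case: (sqintB (sh B) sF).
- apply: filterS cF => y hy; apply: cvgB; first exact: cvg_cst.
  by rewrite (cvg_shiftn n0 (fun j => h (box (k j)) y)).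
- move=> j; rewrite esqE; last exact: sqintB.
  rewrite lee_fin; set C := box _.
  have AC : (A `<=` C)%fset.
    apply: fsubset_trans An0 _; apply: box_mono.
    by rewrite (leq_trans _ (jk _))// leq_addl.
  apply: (le_trans (ip_sub_le (sh B) (sh C) (sh A))).
  have -> : ip leb (h A \- h C)%R (h A \- h C)%R = ip leb (h C \- h A)%R (h C \- h A)%R.
    by apply: eq_Rintegral => x _ /=; ring.
  by have := tail _ AB; have := tail _ AC; lra.
Qed.

End ShiftAlgebra.

(* [comcst] unfolds to a unary numeral. *)
Local Opaque comcst.

(** * Slices, null sets and the exchange of the coordinates *)

Section Plane.
Context {R : realType}.
Local Notation leb := (@lebesgue_measure R).
Local Notation RR := (measurableTypeR R).
Local Notation mu2 := (leb \x leb)%E.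
Local Notation dlen := (@dyadic_len R).
Local Notation dset := (@dyadic_set R : dyadic -> set RR).
Local Notation haar := (@haar R : dyadic -> RR -> R).
Local Notation rect := (@Defs.rect R : dyadic -> dyadic -> set (RR * RR)).
Local Notation mfun F := (@measurable_fun _ _ (RR * RR)%type R setT F).
Implicit Types (I J K : dyadic) (f g : RR -> R) (F G H b U V : RR * RR -> R)
  (n m k : nat) (v B p s T : R).

#[global] Instance ae_lebesgue2_filter :
  Filter (almost_everywhere (leb \x leb)%E) := ae_filter_ringOfSetsType _.

Lemma measurable_slice1 F x : measurable_fun setT F -> measurable_fun setT (fun y => F (x, y)).
Proof. exact: measurable_fun_pair2. Qed.

Lemma esq_xy F : measurable_fun setT F ->
  esq mu2 F = (\int[leb]_x esq leb (fun y => F (x, y)))%E.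
Proof.
move=> mF; rewrite /esq (fubini_tonelli1 (fun z => (F z ^+ 2)%:E))//.
- exact: measurable_sqr.
- by move=> z; rewrite lee_fin sqr_ge0.
Qed.

Lemma esq_yx F : measurable_fun setT F ->
  esq mu2 F = (\int[leb]_y esq leb (fun x => F (x, y)))%E.
Proof.
move=> mF; rewrite /esq (fubini_tonelli2 (fun z => (F z ^+ 2)%:E))//.
- exact: measurable_sqr.
- by move=> z; rewrite lee_fin sqr_ge0.
Qed.

Lemma measurable_esq_slice F : measurable_fun setT F ->
  measurable_fun setT (fun x => esq leb (fun y => F (x, y))).
Proof.
move=> mF; apply: (measurable_fun_fubini_tonelli_F (fun z => (F z ^+ 2)%:E)).
- exact: measurable_sqr.
- by move=> z; rewrite lee_fin sqr_ge0.
Qed.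

Definition tsw (z : RR * RR) : RR * RR := (z.2, z.1).

Lemma measurable_tsw : measurable_fun setT tsw.
Proof. by apply: measurable_fun_pair; [exact: measurable_snd|exact: measurable_fst]. Qed.

(** Exchanging the coordinates turns statements on the first variable into statements on the second,
    so that only [shift2] has to be studied. *)
Definition swp F : RR * RR -> R := F \o tsw.

Lemma measurable_swp F : measurable_fun setT F -> measurable_fun setT (swp F).
Proof. by move=> mF; apply: measurableT_comp => //; exact: measurable_tsw. Qed.

Lemma swpK F : swp (swp F) = F.
Proof. by apply/funext => -[x y]. Qed.

Lemma esq_swp F : measurable_fun setT F -> esq mu2 (swp F) = esq mu2 F.
Proof.
move=> mF; rewrite esq_yx; last exact: measurable_swp.
by rewrite esq_xy.
Qed.

Lemma sqint_swp F : sqint mu2 F -> sqint mu2 (swp F).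
Proof. by move=> [mF eF]; split; [exact: measurable_swp|rewrite esq_swp]. Qed.

Lemma ae_ge0_lty (h : RR -> \bar R) : measurable_fun setT h -> (forall x, 0 <= h x)%E ->
  (\int[leb]_x h x < +oo)%E -> {ae leb, forall x, (h x < +oo)%E}.
Proof.
move=> mh h0 ih; have : leb.-integrable setT h.
  by apply/integrableP; split => //; under eq_integral do rewrite gee0_abs//.
move=> /(integrable_ae measurableT); apply: filterS => x /(_ I).
by rewrite ge0_fin_numE.
Qed.

Lemma ae_sqint_slice1 F : sqint mu2 F -> {ae leb, forall x, sqint leb (fun y => F (x, y))}.
Proof.
move=> [mF eF]; have mh := measurable_esq_slice mF.
have := ae_ge0_lty mh (fun x => esq_ge0 _ _).
rewrite -esq_xy// => /(_ eF); apply: filterS => x hx; split => //.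
exact: measurable_slice1.
Qed.

Lemma ae_slice1 (P : RR * RR -> Prop) : {ae mu2, forall z, P z} ->
  {ae leb, forall x, {ae leb, forall y, P (x, y)}}.
Proof.
move=> [N [mN N0 PN]].
have mh : measurable_fun setT (leb \o xsection N) by exact: measurable_fun_xsection.
have h0 : (\int[leb]_x (leb \o xsection N) x = 0)%E by exact: N0.
have : (\int[leb]_x `|(leb \o xsection N) x| = 0)%E.
  by rewrite -[RHS]h0; apply: eq_integral => x _; rewrite gee0_abs.
move=> /(ae_eq_integral_abs leb measurableT mh); apply: filterS => x /(_ I) /= hx.
exists (xsection N x); split => //; first exact: measurable_xsection.
by move=> y /= nP; rewrite /xsection/= inE; exact: PN.
Qed.

(** The measure of a set is the squared norm of its indicator, whose invariance under the exchange
    is Tonelli in both orders. *)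
Lemma ae_swap (P : RR * RR -> Prop) : {ae mu2, forall z, P z} ->
  {ae mu2, forall z, P (tsw z)}.
Proof.
move=> [N [mN N0 PN]].
have mN' : measurable (tsw @^-1` N : set (RR * RR)).
  by rewrite -[_ @^-1` _]setTI; exact: measurable_tsw.
exists (tsw @^-1` N); split => //; last by move=> z nP; exact: PN.
have h A : measurable A -> mu2 A = esq mu2 (\1_A : RR * RR -> R).
  move=> mA; rewrite /esq (eq_integral (fun z => (\1_A z)%:E)).
    by rewrite integral_indic// setIT.
  by move=> z _; rewrite indicE; case: (_ \in _); rewrite ?expr1n ?expr0n.
have mi : measurable_fun setT (\1_N : RR * RR -> R) by exact: measurable_indic.
by rewrite (h _ mN') -[RHS]N0 (h _ mN) -(esq_swp mi).
Qed.

Lemma ae_slice2 (P : RR * RR -> Prop) : {ae mu2, forall z, P z} ->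
  {ae leb, forall y, {ae leb, forall x, P (x, y)}}.
Proof. by move=> /ae_swap/ae_slice1. Qed.

(** Positive and negative parts are treated separately: each is covered by Tonelli, so measurability
    holds without any integrability. *)
Lemma measurable_inner_slice F (h : RR -> R) : measurable_fun setT F -> measurable_fun setT h ->
  measurable_fun setT (fun x => inner (fun y => F (x, y)) h).
Proof.
move=> mF mh; rewrite /inner /Rintegral.
apply: (measurableT_comp (f := fine)) => //.
pose K (z : RR * RR) := (F z * h z.2)%:E.
have mK : measurable_fun setT K.
  apply/measurable_EFinP; apply: measurable_funM => //.
  by apply: measurableT_comp => //; exact: measurable_snd.
rewrite (_ : (fun _ => _) = (fun x => \int[leb]_y (K^\+ (x, y)) - \int[leb]_y (K^\- (x, y)))%E).
  apply: emeasurable_funB.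
  - apply: (measurable_fun_fubini_tonelli_F (K^\+)%E) => //; exact: measurable_funepos.
  - apply: (measurable_fun_fubini_tonelli_F (K^\-)%E) => //; exact: measurable_funeneg.
apply/funext => x; rewrite [LHS]integralE.
by congr (_ - _)%E; apply: eq_integral => y _; rewrite ?funeposE ?funenegE.
Qed.

Lemma L2P F : L2 F <-> sqint mu2 F.
Proof. exact: Lfun2P. Qed.

Lemma norm2E F : norm2 F = (esq mu2 F `^ 2^-1)%E.
Proof. exact: Lnorm2E. Qed.

(** * The shifts of the plane *)

Definition sl1 F (x : RR) : RR -> R := fun y => F (x, y).

(** Partial sums of the series for $S_2F$, jointly measurable in both variables; slice by slice,
    [haar_energy] is their squared norm. *)
Definition haar_trunc F n : RR * RR -> R :=
  fun z => hs (cseq (box n)) (tw (fc (sl1 F z.1))) z.2.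

Definition haar_energy F n (x : RR) : R := \sum_(I <- cseq (box n)) fc (sl1 F x) I ^+ 2.

Lemma measurable_fc F I : measurable_fun setT F -> measurable_fun setT (fun x => fc (sl1 F x) I).
Proof. by move=> mF; apply: measurable_inner_slice => //; exact: measurable_haar. Qed.

Lemma measurable_haar_trunc F n : measurable_fun setT F ->
  measurable_fun setT (haar_trunc F n).
Proof.
move=> mF; apply: measurable_sum => I; apply: measurable_funM.
  apply: (measurableT_comp (f := fun x => tw (fc (sl1 F x)) I)); last exact: measurable_fst.
  rewrite /tw; case: (I == dyadic_left (dparent I)); first exact: measurable_fc.
  by apply: measurableT_comp => //; exact: measurable_fc.
by apply: (measurableT_comp (f := haar I)); [exact: measurable_haar|exact: measurable_snd].
Qed.

Lemma measurable_haar_energy F n : measurable_fun setT F ->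
  measurable_fun setT (haar_energy F n).
Proof.
move=> mF; apply: measurable_sum => I; apply: measurable_funX; exact: measurable_fc.
Qed.

Lemma haar_energy_ge0 F n x : 0 <= haar_energy F n x.
Proof. by apply: sumr_ge0 => I _; rewrite sqr_ge0. Qed.

Lemma haar_energy_le F n : sqint mu2 F ->
  (\int[leb]_x (haar_energy F n x)%:E <= esq mu2 F)%E.
Proof.
move=> sF; have [mF eF] := sF; rewrite esq_xy//.
apply: ae_ge0_le_integral => //.
- by move=> x _; rewrite lee_fin haar_energy_ge0.
- by apply/measurable_EFinP; exact: measurable_haar_energy.
- by move=> x _; exact: esq_ge0.
- exact: measurable_esq_slice.
- apply: filterS (ae_sqint_slice1 sF) => x sx _.
  by rewrite esqE// lee_fin; apply: bessel => //; exact/uniq_cseq/fset_uniq.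
Qed.

(** Pythagoras on almost every slice, integrated. It is stated as a sum because the energies are
    extended reals. *)
Lemma esq_haar_trunc F n m : sqint mu2 F -> (n <= m)%N ->
  (esq mu2 (haar_trunc F m \- haar_trunc F n)%R + \int[leb]_x (haar_energy F n x)%:E =
  \int[leb]_x (haar_energy F m x)%:E)%E.
Proof.
move=> sF nm; have [mF eF] := sF.
have mt k := measurable_haar_trunc k mF.
have me k := measurable_haar_energy k mF.
have md := measurable_funB (mt m) (mt n); have ms := measurable_esq_slice md.
rewrite (esq_xy md) -ge0_integralD//; last 3 first.
- by move=> x _; exact: esq_ge0.
- by move=> x _; rewrite lee_fin haar_energy_ge0.
- by apply/measurable_EFinP; exact: me.
apply: ae_eq_integral => //.
- apply: emeasurable_funD.
    exact: ms.
  by apply/measurable_EFinP; exact: me.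
- by apply/measurable_EFinP; exact: me.
apply: filterS (ae_sqint_slice1 sF) => x sx _.
rewrite (_ : (fun y => _) = (hs (cseq (box m)) (tw (fc (sl1 F x))) \-
  hs (cseq (box n)) (tw (fc (sl1 F x))))%R)//.
rewrite esqE; last by apply: sqintB; exact: sqint_hs.
rewrite ip_hs_sub; [|exact/uniq_cseq/fset_uniq..|exact/subset_cseq/box_mono].
by rewrite !sum_tw_sqr -EFinD subrK.
Qed.

Lemma haar_trunc0 F : sqint mu2 F -> forall n, sqint mu2 (haar_trunc F n).
Proof.
move=> sF n; have [mF eF] := sF; split; first exact: measurable_haar_trunc.
rewrite esq_xy; last exact: measurable_haar_trunc.
apply: le_lt_trans eF; apply: le_trans (haar_energy_le n sF).
apply: ae_ge0_le_integral => //.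
- by move=> x _; exact: esq_ge0.
- by apply: measurable_esq_slice; exact: measurable_haar_trunc.
- by move=> x _; rewrite lee_fin haar_energy_ge0.
- by apply/measurable_EFinP; exact: measurable_haar_energy.
- apply: filterS (ae_sqint_slice1 sF) => x sx _.
  rewrite (_ : (fun y => _) = hs (cseq (box n)) (tw (fc (sl1 F x))))//.
  rewrite esqE; last exact: sqint_hs.
  by rewrite ip_hs ?sum_tw_sqr//; exact/uniq_cseq/fset_uniq.
Qed.

Definition sh2 F H := [/\ sqint mu2 F, sqint mu2 H &
  {ae leb, forall x, Defs.shift (sl1 F x) (sl1 H x)}].

Lemma shift2P F H : shift2 F H <-> sh2 F H.
Proof. by split=> -[/L2P sF /L2P sH h]; split. Qed.

Lemma shift1P F H : shift1 F H <-> sh2 (swp F) (swp H).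
Proof.
split=> -[].
- by move=> /L2P sF /L2P sH h; split; [exact: sqint_swp|exact: sqint_swp|exact: h].
- move=> /sqint_swp + /sqint_swp + h; rewrite !swpK => sF sH.
  by split; [exact/L2P|exact/L2P|exact: h].
Qed.

(** Choosing $S$ slice by slice would not give a measurable function. The partial sums form a Cauchy
    sequence in the plane, their energies being increasing and bounded; the limit along an almost
    everywhere convergent subsequence is then recognized on almost every slice. *)
Lemma sh2_exists F : sqint mu2 F -> exists H, sh2 F H.
Proof.
move=> sF; have [mF eF] := sF.
pose a n : \bar R := (\int[leb]_x (haar_energy F n x)%:E)%E.
have a0 n : (0 <= a n)%E by apply: integral_ge0 => x _; rewrite lee_fin haar_energy_ge0.
have aF n : (a n <= esq mu2 F)%E by exact: haar_energy_le.
have afin n : a n \is a fin_num by rewrite ge0_fin_numE// (le_lt_trans (aF n)).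
have eFfin : esq mu2 F \is a fin_num by rewrite ge0_fin_numE// esq_ge0.
pose al n := fine (a n).
have diff n m : (n <= m)%N -> esq mu2 (haar_trunc F m \- haar_trunc F n)%R = (al m - al n)%:E.
  move=> nm; have := esq_haar_trunc sF nm; rewrite -/(a n) -/(a m).
  rewrite -(fineK (afin n)) -(fineK (afin m)) -/(al n) -/(al m) => h.
  by rewrite EFinB -h addeK.
have mono n m : (n <= m)%N -> al n <= al m.
  by move=> nm; rewrite -subr_ge0 -lee_fin -diff// esq_ge0.
have supal : has_sup (range al).
  split; first by exists (al 0%N), 0%N.
  exists (fine (esq mu2 F)) => _ [n _ <-].
  by rewrite -lee_fin !fineK.
have ub n : al n <= sup (range al) by apply: ub_le_sup; [case: supal|exists n].
have [H [k [sH jk kH _]]] : exists H (k : nat -> nat), [/\ sqint mu2 H, forall j, (j <= k j)%N,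
    {ae mu2, forall z, haar_trunc F (k j) z @[j --> \oo] --> H z} &
    esq mu2 (haar_trunc F n \- H)%R @[n --> \oo] --> 0%E].
  apply: riesz_fischer; first exact: haar_trunc0.
  move=> e e0; have [_ [N _ <-] aN] := sup_adherent e0 supal.
  exists N => n m Nn Nm; wlog nm : n m Nn Nm / (n <= m)%N.
    move=> h; case: (leqP n m) => [|/ltnW]; first exact: h.
    by rewrite esq_subC; exact: h.
  rewrite esq_subC diff// lee_fin.
  by have := mono _ _ Nn; have := ub m; lra.
exists H; split => //.
near=> x; apply: (shift_of_ae_cvg (k := k)) => //.
- by near: x; exact: ae_sqint_slice1.
- by near: x; exact: ae_sqint_slice1.
- by near: x; exact: (ae_slice1 kH).
Unshelve. all: by end_near. Qed.

Lemma esq_sh2 F H : sh2 F H -> (esq mu2 H <= esq mu2 F)%E.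
Proof.
move=> [sF sH h]; have [mF _] := sF; have [mH _] := sH.
rewrite (esq_xy mH) (esq_xy mF); apply: ae_ge0_le_integral.
- exact: measurableT.
- by move=> x _; exact: esq_ge0.
- exact: measurable_esq_slice.
- by move=> x _; exact: esq_ge0.
- exact: measurable_esq_slice.
- apply: filterS h => x hx _; have [sf sh] := shift_sqint hx.
  have := esq_shift hx; rewrite /sl1 => hh.
  by rewrite !esqE// lee_fin.
Qed.

Lemma sh2_sub F F' H H' : sh2 F H -> sh2 F' H' -> sh2 (F \- F')%R (H \- H')%R.
Proof.
move=> [sF sH h] [sF' sH' h']; split; [exact: sqintB..|].
by apply: filterS2 h h' => x hx hx'; exact: (shift_sub hx hx').
Qed.

Lemma shift1_exists F : sqint mu2 F -> exists H, shift1 F H.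
Proof.
move=> /sqint_swp /sh2_exists[H h]; exists (swp H).
by apply/shift1P; rewrite swpK.
Qed.

Lemma esq_shift1 F H : shift1 F H -> (esq mu2 H <= esq mu2 F)%E.
Proof.
move=> h; have [/L2P[mF _] /L2P[mH _] _] := h.
by move/shift1P: h => /esq_sh2; rewrite !esq_swp.
Qed.

Lemma shift1_sub F F' H H' : shift1 F H -> shift1 F' H' -> shift1 (F \- F')%R (H \- H')%R.
Proof.
move=> /shift1P h /shift1P h'; apply/shift1P.
exact: (sh2_sub h h').
Qed.

Lemma shift12_exists F : sqint mu2 F -> exists H, shift12 F H.
Proof.
move=> /sh2_exists[G hG]; have [_ sG _] := hG.
have [H hH] := shift1_exists sG.
by exists H, G => //; exact/shift2P.
Qed.

Lemma shift12_sqint F H : shift12 F H -> sqint mu2 F /\ sqint mu2 H.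
Proof. by move=> [G [/L2P sF _ _] [_ /L2P sH _]]. Qed.

Lemma esq_shift12 F H : shift12 F H -> (esq mu2 H <= esq mu2 F)%E.
Proof. by move=> [G /shift2P/esq_sh2 h /esq_shift1 h']; exact: le_trans h' h. Qed.

Lemma shift12_sub F F' H H' : shift12 F H -> shift12 F' H' ->
  shift12 (F \- F')%R (H \- H')%R.
Proof.
move=> [G /shift2P h1 h2] [G' /shift2P h1' h2']; exists (G \- G')%R.
  by apply/shift2P; exact: sh2_sub.
exact: shift1_sub.
Qed.

Lemma commutator_sh2 (v N : R) b F H G : 0 < v -> measurable_fun setT b ->
  (forall z, `|b z| <= N) ->
  {ae leb, forall x, forall J, dvar (sl1 b x) J <= v ^+ 2 * dyadic_len J} ->
  sh2 F H -> sh2 (b \* F)%R G ->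
  (esq mu2 (G \- b \* H)%R <= (comcst * v ^+ 2)%:E * esq mu2 F)%E.
Proof.
have c0 : 0 <= comcst * v ^+ 2 by rewrite mulr_ge0 ?comcst_ge0 ?sqr_ge0.
move=> v0 mb bN bv [sF sH h] [sbF sG h'].
have [mF _] := sF; have [mH _] := sH; have [mG _] := sG.
have mW : measurable_fun setT (G \- b \* H)%R.
  by apply: measurable_funB; [exact: mG|apply: measurable_funM; [exact: mb|exact: mH]].
rewrite (esq_xy mW) (esq_xy mF) -ge0_integralZl//; last 2 first.
- exact: measurable_esq_slice.
- by move=> x _; exact: esq_ge0.
apply: ae_ge0_le_integral => //.
- by move=> x _; exact: esq_ge0.
- exact: measurable_esq_slice.
- by move=> x _; apply: mule_ge0; [rewrite lee_fin|exact: esq_ge0].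
- by apply: measurable_funeM; exact: measurable_esq_slice.
near=> x => _.
have hx : Defs.shift (sl1 F x) (sl1 H x) by near: x.
have hx' : Defs.shift (sl1 b x \* sl1 F x)%R (sl1 G x) by near: x.
have vx : forall J, dvar (sl1 b x) J <= v ^+ 2 * dyadic_len J by near: x.
have mbx : measurable_fun setT (sl1 b x) by exact: measurable_slice1.
have bNx y : `|sl1 b x y| <= N by exact: bN.
have := commutator_1d v0 mbx bNx vx hx hx'.
have [sf sh] := shift_sqint hx; have [_ sg] := shift_sqint hx'.
have sW : sqint leb (sl1 G x \- sl1 b x \* sl1 H x)%R.
  by apply: sqintB => //; exact: (sqint_mul_bounded mbx bNx).
rewrite (_ : (fun y => F (x, y)) = sl1 F x)//.
rewrite (_ : (fun y => _) = (sl1 G x \- sl1 b x \* sl1 H x)%R)//.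
by rewrite !esqE// -EFinM lee_fin.
Unshelve. all: by end_near. Qed.

(** Both parts cost the same, as the outer $S_1$ of the first and the inner $S_2$ of the second do
    not increase norms. The factor 4 comes from $(s+t)^2 \le 2s^2 + 2t^2$. *)
Lemma commutator_bounded (v N : R) b F U V : 0 < v -> measurable_fun setT b ->
  (forall z, `|b z| <= N) ->
  {ae leb, forall x, forall J, dvar (sl1 b x) J <= v ^+ 2 * dyadic_len J} ->
  {ae leb, forall x, forall J, dvar (sl1 (swp b) x) J <= v ^+ 2 * dyadic_len J} ->
  shift12 F V -> shift12 (b \* F)%R U ->
  (esq mu2 (U \- b \* V)%R <= (4 * (comcst * v ^+ 2))%:E * esq mu2 F)%E.
Proof.
have c0 : 0 <= comcst * v ^+ 2 by rewrite mulr_ge0 ?comcst_ge0 ?sqr_ge0.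
move=> v0 mb bN bv bv' [H /shift2P hH hV] [K /shift2P hK hU].
have [sF sH _] := hH; have [sbF sK _] := hK.
have sbH := sqint_mul_bounded mb bN sH.
have [/L2P _ /L2P sV _] := hV; have [_ /L2P sU _] := hU.
(* [Q = S1 (b S2 F)], as [[S1 S2, b] = S1 [S2, b] + [S1, b] S2]. *)
have [Q hQ] := shift1_exists sbH; have [_ /L2P sQ _] := hQ.
have sbV := sqint_mul_bounded mb bN sV.
have -> : (U \- b \* V)%R = ((U \- Q) \+ (Q \- b \* V))%R.
  by apply/funext => z /=; ring.
have h1 : (esq mu2 (U \- Q)%R <= (comcst * v ^+ 2)%:E * esq mu2 F)%E.
  apply: le_trans (commutator_sh2 v0 mb bN bv hH hK).
  exact: (esq_shift1 (shift1_sub hU hQ)).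
have h2 : (esq mu2 (Q \- b \* V)%R <= (comcst * v ^+ 2)%:E * esq mu2 F)%E.
  have mb' := measurable_swp mb.
  move/shift1P: hV => hV'; move/shift1P: (hQ) => hQ'.
  have := commutator_sh2 v0 mb' (fun z => bN (tsw z)) bv' hV' hQ'.
  have -> : (swp Q \- swp b \* swp V)%R = swp (Q \- b \* V)%R by [].
  have [mW _] := sqintB sQ sbV; have [mH _] := sH.
  rewrite !esq_swp// => /le_trans; apply.
  by apply: lee_wpmul2l; [rewrite lee_fin|exact: esq_sh2].
have [m1 _] := sqintB sU sQ; have [m2 _] := sqintB sQ sbV.
apply: (@le_trans _ _ (2%:E * esq mu2 (U \- Q)%R + 2%:E * esq mu2 (Q \- b \* V)%R)%E).
  exact: esqD.
move: h1 h2; set c := comcst * v ^+ 2 in c0 *; set E := esq mu2 F => h1 h2.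
have E0 : (0 <= E)%E by exact: esq_ge0.
apply: (@le_trans _ _ (2%:E * (c%:E * E) + 2%:E * (c%:E * E))%E).
  by apply: leeD; apply: lee_wpmul2l.
have c1 : 0 <= 2 * c by rewrite mulr_ge0.
rewrite !muleA -!EFinM -ge0_muleDl ?lee_fin// -EFinD.
by apply: lee_wpmul2r => //; rewrite lee_fin; lra.
Qed.

(** * Truncation of the symbol *)

Definition trunc (N t : R) : R := Num.max (- N) (Num.min t N).

Lemma truncP (N t : R) : 0 <= N ->
  [\/ t <= - N /\ trunc N t = - N, - N <= t <= N /\ trunc N t = t | N <= t /\ trunc N t = N].
Proof.
move=> N0; rewrite /trunc; case: (leP t N) => h.
  case: (leP (- N) t) => h'; first by constructor 2; rewrite ?h' ?h.
  by constructor 1; rewrite ltW.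
rewrite (@max_idPr _ _ (- N) N _); last lra.
by constructor 3; rewrite ltW.
Qed.

Lemma trunc_bound (N t : R) : 0 <= N -> `|trunc N t| <= N.
Proof.
move=> N0; rewrite ler_norml.
by case: (truncP t N0) => -[h ->] //; apply/andP; split; lra.
Qed.

Lemma trunc_id (N t : R) : `|t| <= N -> trunc N t = t.
Proof.
by rewrite ler_norml /trunc => /andP[h1 h2]; rewrite (min_idPl h2); apply/max_idPr.
Qed.

Lemma trunc_lipschitz (N s t : R) : 0 <= N -> `|trunc N s - trunc N t| <= `|s - t|.
Proof.
move=> N0; wlog st : s t / s <= t.
  by move=> h; case: (leP s t) => [/h//|/ltW/h]; rewrite distrC (distrC t).
rewrite distrC (distrC s) [leRHS]ger0_norm ?subr_ge0// ler_norml.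
by case: (truncP t N0) => -[h ->]; case: (truncP s N0) => -[h' ->];
  rewrite -?(rwP andP) in h h' *; lra.
Qed.

Lemma trunc_dist (N t : R) : 0 <= N -> `|trunc N t - t| <= `|t|.
Proof.
move=> N0; case: (truncP t N0) => -[h ->]; last 1 first.
- rewrite [leRHS]ger0_norm ?ler_norml; last lra.
  by apply/andP; split; lra.
- rewrite [leRHS]ler0_norm ?ler_norml; last lra.
  by apply/andP; split; lra.
- by rewrite subrr normr0.
Qed.

Lemma measurable_trunc (N : R) : measurable_fun setT (trunc N : RR -> R).
Proof.
by apply: measurable_maxr; [exact: measurable_cst|apply: measurable_minr; [exact: measurable_id|exact: measurable_cst]].
Qed.

Lemma integrable_dist2 f I (c : R) : locint2 f ->
  leb.-integrable (dset I) (EFin \o (fun x => (f x - c) ^+ 2)).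
Proof.
move=> [[mf lf] [mf2 lf2]].
have mI := @measurable_dset R I.
have i2 : leb.-integrable (dset I) (EFin \o (fun x => (- 2 * c) * f x)).
  exact: (integrableZl mI (- 2 * c) (lf I)).
have i3 : leb.-integrable (dset I) (EFin \o (fun=> c ^+ 2)) by exact: integrable_cst_dset.
have := integrableD mI (integrableD mI (lf2 I) i2) i3.
apply: eq_integrable => // x _; rewrite /= -!EFinD; congr EFin; ring.
Qed.

(** The average is the best centre, so the variance of the truncation is bounded by its deviation
    from the truncated average of [f]; truncation is 1-Lipschitz. *)
Lemma dvar_trunc (N : R) f I : 0 <= N -> locint2 f -> dvar (trunc N \o f) I <= dvar f I.
Proof.
move=> N0 lf; have mf := lf.1.1.
have mt : measurable_fun setT (trunc N \o f) by apply: measurableT_comp => //; exact: measurable_trunc.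
have lt := locint2_bounded mt (fun x => trunc_bound (f x) N0).
apply: (@le_trans _ _ (\int[leb]_(x in dset I) ((trunc N (f x) - trunc N (dav f I)) ^+ 2))).
  rewrite dvar_cst// lerDl mulr_ge0 ?sqr_ge0//; exact/ltW/dlen_gt0.
rewrite dvarE//; apply: le_Rintegral.
- exact: measurable_dset.
- exact: integrable_dist2.
- exact: integrable_dist2.
- move=> x _; rewrite -[leLHS]ger0_norm ?sqr_ge0// -[leRHS]ger0_norm ?sqr_ge0// !normrX.
  by rewrite lerXn2r ?nnegrE//; exact: trunc_lipschitz.
Qed.

Definition var_slices (v : R) b :=
  {ae leb, forall x, locint2 (sl1 b x) /\ forall J, dvar (sl1 b x) J <= v ^+ 2 * dlen J}.

(** Truncating [b] gives [Un n], converging to [U] since $b F$ is square integrable and $S_1S_2$ is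
    a contraction. The products of [bn n] with [V] have no such limit, as $b V$ is not known to be
    square integrable; this is why the estimate is first localized to sets where [b] is bounded. *)
Lemma commutator_unbounded (v : R) b F U V : 0 < v -> mfun b ->
  var_slices v b -> var_slices v (swp b) ->
  shift12 F V -> shift12 (b \* F)%R U ->
  (esq mu2 (U \- b \* V)%R <= (8 * (comcst * v ^+ 2))%:E * esq mu2 F)%E.
Proof.
move=> v0 mb bv bv' hV hU.
have [sF sV] := shift12_sqint hV; have [sbF sU] := shift12_sqint hU.
have [mF _] := sF; have [mV _] := sV; have [mU _] := sU.
pose c := comcst * v ^+ 2.
have c0 : 0 <= c by rewrite mulr_ge0 ?comcst_ge0 ?sqr_ge0.
pose bn n := trunc n%:R \o b.
have mbn n : mfun (bn n) by exact: (measurableT_comp (@measurable_trunc _) mb).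
have bnn n z : `|bn n z| <= n%:R by exact: trunc_bound.
have sbn n := sqint_mul_bounded (mbn n) (bnn n) sF.
have /choice[Un hUn] : forall n, exists Un, shift12 (bn n \* F)%R Un.
  by move=> n; exact: shift12_exists.
have sUn n : sqint mu2 (Un n) by have [] := shift12_sqint (hUn n).
have h1 n : (esq mu2 (Un n \- bn n \* V)%R <= (4 * c)%:E * esq mu2 F)%E.
  apply: (@commutator_bounded v n%:R) => //.
  - apply: filterS bv => x [lx hx] J; apply: le_trans (hx J).
    exact: (dvar_trunc _ (ler0n _ n) lx).
  - apply: filterS bv' => x [lx hx] J; apply: le_trans (hx J).
    exact: (dvar_trunc _ (ler0n _ n) lx).
have h2 : esq mu2 (Un n \- U)%R @[n --> \oo] --> 0%E.
  have cv : esq mu2 ((bn n \* F) \- (b \* F))%R @[n --> \oo] --> 0%E.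
    apply: cvg_esq_dominated => //.
    - by move=> n; exact: (measurable_funM (mbn n) mF).
    - move=> n z /=; rewrite -mulrBl !normrM ler_wpM2r//; exact: trunc_dist.
    - move=> z /=; apply: cvgM; last exact: cvg_cst.
      apply: cvg_near_cst; near=> n; rewrite /bn/= trunc_id//.
      by near: n; exact: nbhs_infty_ger.
  apply/cvge0P => [n|e e0]; first exact: esq_ge0.
  have [N hN] := (cvge0P (fun n => esq_ge0 _ _)).1 cv e e0.
  exists N => n Nn; apply: le_trans (hN n Nn).
  exact: (esq_shift12 (shift12_sub (hUn n) hU)).
(* The truncations agree with [b] where [|b| <= M]; let first [n] and then [M]
   tend to infinity. *)
pose A (M : nat) := [set z | `|b z| <= M%:R] : set (RR * RR).
have mA M : measurable (A M).
  have : mfun (fun z => `|b z|) by exact: (measurableT_comp (@normr_measurable _ _) mb).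
  move=> /(_ measurableT `]-oo, M%:R]%classic (measurable_itv _)); rewrite setTI.
  by congr measurable; apply/seteqP; split => z; rewrite /A/= in_itv.
pose W M : RR * RR -> R := (\1_(A M) \* (U \- b \* V))%R.
have mUb : mfun (U \- b \* V)%R by exact: (measurable_funB mU (measurable_funM mb mV)).
have mW M : mfun (W M) by exact: (measurable_funM (measurable_indic (mA M)) mUb).
apply: (@fatou_esq _ _ R mu2 W); [exact: mW|exact: mUb| |].
  apply: aeW => z; apply: cvg_near_cst; near=> M.
  rewrite /W/= indicE mem_set ?mul1r// /A/=.
  by near: M; exact: nbhs_infty_ger.
move=> M; apply/lee_addgt0Pr => e e0.
have [N hN] := (cvge0P (fun n => esq_ge0 _ _)).1 h2 (e / 2) (divr_gt0 e0 (ltr0n _ 2)).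
pose n := maxn N M; have {}hN := hN n (leq_maxl _ _).
have [mUn _] := sUn n.
have m1 : mfun (Un n \- bn n \* V)%R by exact: (measurable_funB mUn (measurable_funM (mbn n) mV)).
have m2 : mfun (Un n \- U)%R by exact: (measurable_funB mUn mU).
(* On [A M] the truncation at height [n >= M] is inactive, so the unbounded product never has to be
   estimated. *)
have hW : (esq mu2 (W M) <= esq mu2 ((Un n \- bn n \* V) \- (Un n \- U))%R)%E.
  apply: le_esq; [exact: mW|exact: (measurable_funB m1 m2)|].
  move=> z; rewrite /W/= indicE; have [zA|zA] := boolP (z \in A M).
    rewrite mul1r /bn/= trunc_id; last first.
      by move: zA; rewrite inE => zA; apply: le_trans zA _; rewrite ler_nat leq_maxr.
    by apply: eqle; congr (`| _ |); ring.
  by rewrite mul0r normr0.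
apply: le_trans hW _; apply: le_trans (@esqB _ _ R mu2 _ _ m1 m2) _.
have E0 : (0 <= esq mu2 F)%E by exact: esq_ge0.
apply: leeD.
  rewrite (_ : 8 * _ = 2 * (4 * c)); last by rewrite /c; ring.
  by rewrite EFinM -muleA; apply: lee_wpmul2l.
apply: (@le_trans _ _ (2%:E * (e / 2)%:E)%E); first by apply: lee_wpmul2l.
by rewrite -EFinM lee_fin; lra.
Unshelve. all: by end_near. Qed.

(** * Little BMO on rectangles *)

Lemma measurable_rect I J : measurable (rect I J).
Proof. by apply: measurableX; exact: measurable_dset. Qed.

Lemma mu2_rect I J : mu2 (rect I J) = (dlen I * dlen J)%:E.
Proof.
rewrite product_measure1E; [|exact: measurable_dset..].
by rewrite EFinM; congr (_ * _)%E; exact: leb_dset.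
Qed.

Lemma areaE I J : area I J = dlen I * dlen J.
Proof. by rewrite /area (_ : leb2 _ = (dlen I * dlen J)%:E)//; exact: mu2_rect. Qed.

Lemma area_gt0 I J : 0 < @area R I J.
Proof. by rewrite areaE mulr_gt0// dlen_gt0. Qed.

(* Only used for nonnegative integrands. *)
Definition rin F I J : \bar R := (\int[mu2]_(z in rect I J) (F z)%:E)%E.
Definition lin f I : \bar R := (\int[leb]_(x in dset I) (f x)%:E)%E.

Lemma lin_ge0 f I : (forall x, 0 <= f x) -> (0 <= lin f I)%E.
Proof. by move=> f0; apply: integral_ge0 => x _; rewrite lee_fin. Qed.

Lemma lin_indic f I : lin f I = (\int[leb]_x (f x * \1_(dset I) x)%:E)%E.
Proof.
rewrite /lin integral_mkcond; apply: eq_integral => x _.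
by rewrite /patch indicE; case: (_ \in _); rewrite ?mulr1 ?mulr0.
Qed.

Lemma rin_indic F I J :
  rin F I J = (\int[mu2]_z (F z * (\1_(dset I) z.1 * \1_(dset J) z.2))%:E)%E.
Proof.
rewrite /rin integral_mkcond; apply: eq_integral => -[x y] _.
rewrite /patch !indicE /rect in_setX/=.
by case: (_ \in _); case: (_ \in _); rewrite /= ?mulr1 ?mulr0.
Qed.

Lemma measurable_rect_indic I J : mfun (fun z => \1_(dset I) z.1 * \1_(dset J) z.2).
Proof.
apply: measurable_funM.
  apply: (measurableT_comp (f := \1_(dset I) : RR -> R)) => //.
  by apply: measurable_indic; exact: measurable_dset.
apply: (measurableT_comp (f := \1_(dset J) : RR -> R)) => //.
by apply: measurable_indic; exact: measurable_dset.
Qed.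

Lemma measurable_lin_slice F J : mfun F -> (forall z, 0 <= F z) ->
  measurable_fun setT (fun x : RR => lin (sl1 F x) J).
Proof.
move=> mF F0.
pose h (z : RR * RR) := (F z * \1_(dset J) z.2)%:E.
have mh : measurable_fun setT h.
  apply/measurable_EFinP; apply: measurable_funM; first exact: mF.
  apply: (measurableT_comp (f := \1_(dset J) : RR -> R)) => //.
  by apply: measurable_indic; exact: measurable_dset.
have h0 z : (0 <= h z)%E by rewrite lee_fin mulr_ge0// indicE.
rewrite (_ : (fun x => _) = fubini_F leb h).
  exact: (measurable_fun_fubini_tonelli_F h mh h0).
by apply/funext => x; rewrite lin_indic.
Qed.

Lemma rin_xy F I J : mfun F -> (forall z, 0 <= F z) ->
  rin F I J = (\int[leb]_(x in dset I) lin (sl1 F x) J)%E.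
Proof.
move=> mF F0; rewrite rin_indic (@fubini_tonelli1 _ _ RR RR R leb leb); last first.
- by move=> z; rewrite lee_fin !mulr_ge0// indicE.
- by apply/measurable_EFinP; apply: measurable_funM; [exact: mF|exact: measurable_rect_indic].
rewrite [RHS]integral_mkcond; apply: eq_integral => x _.
rewrite /fubini_F/= /patch; case: ifPn => xI.
  rewrite lin_indic; apply: eq_integral => y _.
  by rewrite [\1_(dset I) x]indicE xI mul1r.
rewrite integral0_eq// => y _.
by rewrite [\1_(dset I) x]indicE (negbTE xI) mul0r mulr0.
Qed.

Lemma rin_swp F I J : mfun F -> (forall z, 0 <= F z) -> rin (swp F) J I = rin F I J.
Proof.
move=> mF F0; rewrite !rin_indic (@fubini_tonelli2 _ _ RR RR R leb leb); last first.
- by move=> z; rewrite lee_fin !mulr_ge0// ?indicE//; exact: F0.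
- apply/measurable_EFinP; apply: measurable_funM; first exact: measurable_swp.
  exact: measurable_rect_indic.
rewrite (@fubini_tonelli1 _ _ RR RR R leb leb); last first.
- by move=> z; rewrite lee_fin !mulr_ge0// indicE.
- by apply/measurable_EFinP; apply: measurable_funM; [exact: mF|exact: measurable_rect_indic].
apply: eq_integral => x _; apply: eq_integral => y _ /=.
by rewrite [\1_(dset J) y * _]mulrC.
Qed.

Lemma ae_dyadic (P : dyadic -> RR -> Prop) : (forall I, {ae leb, forall x, P I x}) ->
  {ae leb, forall x, forall I, P I x}.
Proof.
move=> h; pose Q (n : nat) (x : RR) := if (choice.unpickle n : option dyadic) is Some K then P K x else True.
have : {ae leb, forall x, forall n, Q n x}.
  by apply: ae_foralln => n; rewrite /Q; case: (choice.unpickle n : option dyadic) => [K|]; [exact: h|exact: aeW].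
by apply: filterS => x hx I; have := hx (choice.pickle I); rewrite /Q choice.pickleK.
Qed.

Lemma locint_ge0 f : measurable_fun setT f -> (forall x, 0 <= f x) ->
  (forall I, (lin f I < +oo)%E) -> locint f.
Proof.
move=> mf f0 fI; split=> // I; apply/integrableP; split.
  by apply/measurable_EFinP; exact: measurable_funS mf.
under eq_integral do rewrite /= ger0_norm//.
exact: fI.
Qed.

Lemma locint_abs f : measurable_fun setT f ->
  (forall I, (lin (fun x => `|f x|%R) I < +oo)%E) -> locint f.
Proof.
move=> mf fI; split=> // I; apply/integrableP; split; last exact: fI.
by apply/measurable_EFinP; exact: measurable_funS mf.
Qed.

Lemma lin_din f I : locint f -> lin f I = (din f I)%:E.
Proof.
move=> [mf fI]; rewrite /din /Rintegral fineK//.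
exact: (integrable_fin_num (measurable_dset I) (fI I)).
Qed.

Lemma lin_dav f I : locint f -> lin f I = (dav f I * dlen I)%:E.
Proof. by move=> lf; rewrite lin_din// /dav divfK// dlen_neq0. Qed.

Lemma ae_le_dav f (K : R) : measurable_fun setT f -> (forall x, 0 <= f x) ->
  (forall I, (lin f I <= (K * dlen I)%:E)%E) -> {ae leb, forall x, f x <= K}.
Proof.
move=> mf f0 fK.
have lf : locint f by apply: locint_ge0 => // I; exact: le_lt_trans (fK I) (ltry _).
apply: filterS (dyadic_differentiation lf) => x hx.
rewrite -(cvg_lim (@Rhausdorff R) hx); apply: limr_le; first by apply/cvg_ex; exists (f x).
apply: nearW => n; have := fK (didx (- n%:Z) x).
by rewrite lin_dav// lee_fin ler_pM2r// dlen_gt0.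
Qed.

Definition lint2 b := mfun b /\ forall I J, (rin (fun z => `|b z|%R) I J < +oo)%E.

Lemma mfun_norm b : mfun b -> mfun (fun z => `|b z|).
Proof. by move=> mb; exact: (measurableT_comp (@normr_measurable _ _) mb). Qed.

Lemma ae_locint_slice b : lint2 b -> {ae leb, forall x, locint (sl1 b x)}.
Proof.
move=> [mb bI]; have mB := mfun_norm mb.
have h I J : {ae leb, forall x, dset I x -> (lin (fun y => `|sl1 b x y|%R) J < +oo)%E}.
  pose g x : \bar R := lin (sl1 (fun z => `|b z|%R) x) J.
  pose h := g \_ (dset I).
  have mg : measurable_fun setT g := measurable_lin_slice J mB (fun z => normr_ge0 (b z)).
  have mh : measurable_fun setT h.
    apply: (measurable_restrictT g (@measurable_dset R I)).1.
    exact: (measurable_funS measurableT _ mg).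
  have h0 x : (0 <= h x)%E.
    by rewrite /h /patch; case: ifP => // _; apply: lin_ge0 => y; exact: normr_ge0.
  have ih : (\int[leb]_x h x < +oo)%E.
    by apply: le_lt_trans (bI I J); rewrite rin_xy// [leRHS]integral_mkcond.
  apply: filterS (ae_ge0_lty mh h0 ih) => x; rewrite /h /patch => + xI.
  by rewrite mem_set.
apply: filterS (ae_dyadic (fun I => ae_dyadic (h I))) => x hx.
apply: locint_abs; first exact: measurable_slice1.
(* Localization in the first variable only served to have finite integrals; any interval containing
   [x] will do, here the one of length 1. *)
by move=> J; exact: (hx (didx 0 x) J (dset_didx _ _)).
Qed.

Lemma measurable_dav_slice F J : mfun F -> measurable_fun setT (fun x => dav (sl1 F x) J).
Proof.
move=> mF; apply: measurable_funM => //.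
rewrite (_ : (fun x => _) = fun x => inner (fun y => F (x, y)) (\1_(dset J) : RR -> R)).
  by apply: measurable_inner_slice => //; apply: measurable_indic; exact: measurable_dset.
by apply/funext => x; rewrite din_indic.
Qed.

(** The case $p = 1$ with a free centre, equivalent to the norm up to a factor 2. A free centre
    survives the exchange of coordinates and the passage to slices without any computation of
    averages. *)
Definition bmo1 (B : R) b := lint2 b /\ forall I J, exists c : R,
  (rin (fun z => `|b z - c|%R) I J <= (B * (dlen I * dlen J))%:E)%E.

Lemma bmo1_swp (B : R) b : bmo1 B b -> bmo1 B (swp b).
Proof.
move=> [[mb bI] h]; split.
  split; first exact: measurable_swp.
  move=> I J; have := bI J I; rewrite -rin_swp//; exact: mfun_norm.
move=> I J; have [c hc] := h J I; exists c; rewrite [dlen I * _]mulrC.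
apply: le_trans hc; rewrite -[leRHS]rin_swp//.
by apply: mfun_norm; apply: measurable_funB.
Qed.

Lemma dav_osc_le f (c : R) I : locint f ->
  dav (fun x => `|f x - dav f I|) I <= 2 * dav (fun x => `|f x - c|) I.
Proof.
move=> lf; have h := din_norm_dist c I lf.
have l1 := locint_dist (dav f I) lf; have l2 := locint_dist c lf.
apply: (@le_trans _ _ (dav (fun x => `|f x - c|) I + `|dav f I - c|)); last by lra.
have d0 := @dlen_gt0 R I.
rewrite -(ler_pM2r d0) mulrDl -lee_fin EFinD -!lin_dav//.
have mI := @measurable_dset R I.
have cE : (`|dav f I - c| * dlen I)%:E = (\int[leb]_(x in dset I) (`|dav f I - c|)%:E)%E.
  by rewrite integral_cst// /= leb_dset.
rewrite cE /lin -ge0_integralD//; last first.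
- exact: (measurable_EFinS l2.1).
apply: ge0_le_integral => //.
- exact: (measurable_EFinS l1.1).
- apply/measurable_EFinP; apply: measurable_funD => //.
  exact: (measurable_funS measurableT _ l2.1).
- move=> x _; rewrite lee_fin.
  rewrite (_ : f x - dav f I = (f x - c) - (dav f I - c)); last by ring.
  exact: ler_normB.
Qed.

Lemma lin_le f g I : measurable_fun setT f -> measurable_fun setT g -> (forall x, 0 <= f x) ->
  {ae leb, forall x, f x <= g x} -> (forall x, 0 <= g x) -> (lin f I <= lin g I)%E.
Proof.
move=> mf mg f0 fg g0; apply: ae_ge0_le_integral => //.
- exact: measurable_dset.
- by move=> x _; rewrite lee_fin.
- exact: (measurable_EFinS mf).
- by move=> x _; rewrite lee_fin.
- exact: (measurable_EFinS mg).
- by apply: filterS fg => x h _; rewrite lee_fin.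
Qed.

Lemma lin_affine f (t a : R) I : measurable_fun setT f -> (forall x, 0 <= f x) -> 0 <= t -> 0 <= a ->
  lin (fun x => t * (f x + a)) I = (t%:E * (lin f I + (a * dlen I)%:E))%E.
Proof.
move=> mf f0 t0 a0; rewrite EFinM -leb_dset.
exact: (ge0_integral_affine leb (measurable_dset I) mf f0 t0 a0).
Qed.

Lemma lin_le_rin (h : RR -> R) F I J (t : R) : measurable_fun setT h -> (forall x, 0 <= h x) ->
  mfun F -> (forall z, 0 <= F z) -> 0 <= t ->
  {ae leb, forall x, ((h x * dlen J)%:E <= t%:E * lin (sl1 F x) J)%E} ->
  ((dlen J)%:E * lin h I <= t%:E * rin F I J)%E.
Proof.
move=> mh h0 mF F0 t0 hF; have mI := @measurable_dset R I.
have dJ0 := ltW (@dlen_gt0 R J); have mhI := @measurable_EFinS _ _ R (dset I) h mh.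
have mg : measurable_fun (dset I) (fun x => lin (sl1 F x) J).
  exact: (measurable_funS measurableT _ (measurable_lin_slice J mF F0)).
have g0 x : (0 <= lin (sl1 F x) J)%E by apply: lin_ge0 => y; exact: F0.
rewrite rin_xy// -ge0_integralZl_EFin//; last by move=> x _; rewrite lee_fin.
rewrite -ge0_integralZl_EFin//; apply: ae_ge0_le_integral => //.
- by move=> x _; rewrite mule_ge0 ?lee_fin.
- exact: measurable_funeM.
- by move=> x _; rewrite mule_ge0.
- exact: measurable_funeM.
- by apply: filterS hF => x + _; rewrite mulrC EFinM.
Qed.

Definition osc b J (x : RR) : R := dav (fun y => `|sl1 b x y - dav (sl1 b x) J|) J.

Lemma mfun_slice_dist b J : mfun b -> mfun (fun z => `|b z - dav (sl1 b z.1) J|).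
Proof.
move=> mb; apply: mfun_norm; apply: measurable_funB; first exact: mb.
apply: (measurableT_comp (f := fun x => dav (sl1 b x) J)); last exact: measurable_fst.
exact: measurable_dav_slice.
Qed.

Lemma measurable_osc b J : mfun b -> measurable_fun setT (osc b J).
Proof.
move=> mb; exact: (measurable_dav_slice J (mfun_slice_dist J mb)).
Qed.

Lemma osc_ge0 b J x : 0 <= osc b J x.
Proof.
by apply: divr_ge0; [exact: Rintegral_ge0|exact/ltW/dlen_gt0].
Qed.

(** For fixed [J], the rectangle condition bounds the mean of the slice oscillation over every [I]
    by [2 * B]; letting [I] shrink to a point gives the pointwise bound. There are countably many
    [J], hence one null set. *)
Lemma ae_slice_osc (B : R) b : bmo1 B b ->
  {ae leb, forall x, locint (sl1 b x) /\ forall J, osc b J x <= 2 * B}.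
Proof.
move=> [lb h]; have [mb _] := lb; have al := ae_locint_slice lb.
suff : forall J, {ae leb, forall x, osc b J x <= 2 * B}.
  by move=> /ae_dyadic; apply: filterS2 al => x lx hx.
move=> J; apply: ae_le_dav; [exact: measurable_osc|exact: osc_ge0|].
move=> I; have [c hc] := h I J.
have mc : mfun (fun z => `|b z - c|) by apply: mfun_norm; apply: measurable_funB.
have dJ := @dlen_gt0 R J; have dI := @dlen_gt0 R I.
have key : ((dlen J)%:E * lin (osc b J) I <= 2%:E * rin (fun z => `|b z - c|%R) I J)%E.
  apply: lin_le_rin => //; [exact: measurable_osc|exact: osc_ge0|].
  apply: filterS al => x lx.
  rewrite (_ : lin _ J = lin (fun y => `|sl1 b x y - c|%R) J)//.
  rewrite lin_dav; last exact: locint_dist.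
  by rewrite -!EFinM lee_fin mulrA ler_pM2r//; exact: dav_osc_le.
rewrite -(@lee_pmul2l _ (dlen J)%:E) ?lte_fin//.
apply: le_trans key _; apply: (@le_trans _ _ (2%:E * (B * (dlen I * dlen J))%:E)%E).
  exact: lee_wpmul2l.
by rewrite -!EFinM lee_fin; apply: eqle; ring.
Qed.

Definition smean b J : RR -> R := fun x => dav (sl1 b x) J.

(** Averaging over [J] can only decrease the oscillation around a constant, so the slice averages
    form a function of bounded mean oscillation in the first variable. *)
Lemma smean_dist B b I J : bmo1 B b -> exists c : R,
  (lin (fun x => `|smean b J x - c|%R) I <= (B * dlen I)%:E)%E.
Proof.
move=> [lb h]; have [mb _] := lb; have [c hc] := h I J; exists c.
have dJ := @dlen_gt0 R J; have dJ0 := ltW dJ.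
have mc : mfun (fun z => `|b z - c|) by apply: mfun_norm; apply: measurable_funB.
have ms : measurable_fun setT (smean b J) by exact: measurable_dav_slice.
have md : measurable_fun setT (fun x => `|smean b J x - c|).
  by apply: measurableT_comp => //; apply: measurable_funB.
rewrite -(@lee_pmul2l _ (dlen J)%:E) ?lte_fin//.
rewrite (_ : (dlen J)%:E * (B * dlen I)%:E = (B * (dlen I * dlen J))%:E)%E; last first.
  by rewrite -EFinM; congr EFin; ring.
apply: le_trans hc; rewrite -[leRHS]mul1e.
apply: lin_le_rin => //; apply: filterS (ae_locint_slice lb) => x lx.
rewrite mul1e (_ : lin _ J = lin (fun y => `|sl1 b x y - c|%R) J)//.
rewrite lin_dav; last exact: locint_dist.
by rewrite lee_fin ler_pM2r//; exact: din_norm_dist.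
Qed.

Lemma locint_smean B b J : bmo1 B b -> locint (smean b J).
Proof.
move=> hb; have [[mb _] _] := hb.
have ms : measurable_fun setT (smean b J) by exact: measurable_dav_slice.
apply: locint_abs => // I; have [c hc] := smean_dist I J hb.
have md : measurable_fun setT (fun x => `|smean b J x - c|).
  by apply: measurableT_comp => //; apply: measurable_funB.
apply: (@le_lt_trans _ _ (lin (fun x => 1 * (`|smean b J x - c| + `|c|)) I)).
  apply: lin_le => //.
  - by apply: measurableT_comp.
  - by apply: measurable_funM => //; apply: measurable_funD.
  - apply: aeW => x; rewrite mul1r.
    by rewrite -[X in `|X| <= _](subrK c) ler_normD.
rewrite lin_affine// mul1e lte_add_pinfty ?ltry//.
exact: le_lt_trans hc (ltry _).
Qed.

Lemma smean_osc B b J I : bmo1 B b ->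
  dav (fun x => `|smean b J x - dav (smean b J) I|) I <= 2 * B.
Proof.
move=> hb; have ls := locint_smean J hb; have [c hc] := smean_dist I J hb.
apply: le_trans (dav_osc_le c I ls) _; rewrite ler_pM2l//.
by move: hc; rewrite lin_dav ?lee_fin ?ler_pM2r ?dlen_gt0//; exact: locint_dist.
Qed.

(** The inner product is the one-variable bound at oscillation [2 * B]; it occurs twice, for the
    slices and for their averages, and [2 ^+ k] is the cost of splitting a power of a sum. *)
Definition bmocst k : R := 2 ^+ k * (2 * (jncst k * 2 ^+ k)).

Lemma jncst_ge0 k : 0 <= jncst k :> R.
Proof.
by rewrite /jncst addr_ge0 ?mulr_ge0 ?exprn_ge0 ?mulr_ge0// /jnlam exprn_ge0.
Qed.

(* One-dimensional John-Nirenberg twice: for the slices [b (x, -)] and for their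
   averages over [J], which have bounded mean oscillation in [x]. *)
Lemma rect_john_nirenberg B b I J : 0 < B -> bmo1 B b -> exists c : R, forall k,
  (rin (fun z => (`|b z - c| ^+ k)%R) I J <= (bmocst k * B ^+ k * (dlen I * dlen J))%:E)%E.
Proof.
move=> B0 hb; have [[mb lb] _] := hb.
have ls := locint_smean J hb; have [ms _] := ls.
pose c := dav (smean b J) I; exists c => k.
pose A := jncst k * (2 * B) ^+ k.
have B2 : 0 < 2 * B by rewrite mulr_gt0.
have A0 : 0 <= A by rewrite mulr_ge0 ?jncst_ge0 ?exprn_ge0// ltW.
have dJ := @dlen_gt0 R J; have dI := @dlen_gt0 R I.
have mc : mfun (fun z => `|b z - c| ^+ k).
  by apply: measurable_funX; apply: mfun_norm; apply: measurable_funB.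
have md : measurable_fun setT (fun x => `|smean b J x - c| ^+ k).
  by apply: measurable_funX; apply: measurableT_comp => //; apply: measurable_funB.
have mg := measurable_lin_slice J mc (fun z => exprn_ge0 k (normr_ge0 _)).
have h1 : (lin (fun x => (`|smean b J x - c| ^+ k)%R) I <= (A * dlen I)%:E)%E.
  exact: (john_nirenberg k B2 ls (fun I => smean_osc J I hb)).
rewrite rin_xy//.
apply: (@le_trans _ _ (lin (fun x => (2 ^+ k * dlen J) * (`|smean b J x - c| ^+ k + A)) I)).
  apply: ae_ge0_le_integral.
  - exact: measurable_dset.
  - by move=> x _; apply: lin_ge0 => y; rewrite exprn_ge0// normr_ge0.
  - exact: (measurable_funS measurableT _ mg).
  - move=> x _; rewrite lee_fin mulr_ge0 ?addr_ge0 ?exprn_ge0//.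
    by rewrite mulr_ge0 ?exprn_ge0// ltW.
  - apply/measurable_EFinP; apply: measurable_funM => //; apply: measurable_funD => //.
    exact: (measurable_funS measurableT _ md).
  - apply: filterS (ae_slice_osc hb) => x [lx hx] _.
    have mx := lx.1.
    have mdx : measurable_fun setT (fun y => `|sl1 b x y - smean b J x| ^+ k).
      by apply: measurable_funX; apply: measurableT_comp => //; apply: measurable_funB.
    have h2 : (lin (fun y => (`|sl1 b x y - smean b J x| ^+ k)%R) J <= (A * dlen J)%:E)%E.
      exact: (john_nirenberg k B2 lx hx J).
    apply: (@le_trans _ _ (lin (fun y => 2 ^+ k *
        (`|sl1 b x y - smean b J x| ^+ k + `|smean b J x - c| ^+ k)) J)).
      apply: lin_le.
      - by apply: measurable_funX; apply: measurableT_comp => //; apply: measurable_funB.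
      - by apply: measurable_funM => //; apply: measurable_funD.
      - by move=> y; rewrite exprn_ge0// normr_ge0.
      - apply: aeW => y; apply: le_trans (exprD_le k (normr_ge0 _) (normr_ge0 _)).
        rewrite lerXn2r ?nnegrE ?normr_ge0 ?addr_ge0//.
        rewrite (_ : sl1 _ _ _ - c = (sl1 b x y - smean b J x) + (smean b J x - c)); last by ring.
        exact: ler_normD.
      - by move=> y; rewrite mulr_ge0 ?addr_ge0 ?exprn_ge0.
    rewrite lin_affine ?exprn_ge0//.
    apply: (@le_trans _ _ ((2 ^+ k)%:E * ((A * dlen J)%:E + (`|smean b J x - c| ^+ k * dlen J)%:E))%E).
      by apply: lee_wpmul2l; [rewrite lee_fin exprn_ge0|apply: leeD].
    by rewrite -EFinD -EFinM lee_fin; apply: eqle; ring.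
have t0 : 0 <= 2 ^+ k * dlen J by rewrite mulr_ge0 ?exprn_ge0// ltW.
rewrite lin_affine//.
apply: (@le_trans _ _ ((2 ^+ k * dlen J)%:E * ((A * dlen I)%:E + (A * dlen I)%:E))%E).
  by apply: lee_wpmul2l; [rewrite lee_fin|apply: leeD].
rewrite -EFinD -EFinM lee_fin; apply: eqle.
by rewrite /A /bmocst exprMn; ring.
Qed.

Lemma integrable_rect b I J : lint2 b -> mu2.-integrable (rect I J) (EFin \o b).
Proof.
move=> [mb bI]; apply/integrableP; split; last exact: bI.
exact: (measurable_EFinS mb).
Qed.

Lemma averageE b I J : average b I J = (dlen I * dlen J)^-1 * \int[mu2]_(z in rect I J) b z.
Proof. by rewrite /average areaE. Qed.

Lemma average_dist b I J (c : R) : lint2 b ->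
  ((`|average b I J - c| * (dlen I * dlen J))%:E <= rin (fun z => `|b z - c|%R) I J)%E.
Proof.
move=> lb; have [mb bI] := lb; have mR := @measurable_rect I J.
have d0 : 0 < dlen I * dlen J by rewrite mulr_gt0// dlen_gt0.
have ic : mu2.-integrable (rect I J) (EFin \o (fun=> c)).
  apply/integrableP; split; first exact: measurable_cst.
  apply: le_lt_trans (ltry (`|c| * (dlen I * dlen J))).
  rewrite (eq_integral (fun=> `|c|%:E))// integral_cst// [in leRHS]EFinM.
  by apply: eqle; congr (_ * _)%E; exact: mu2_rect.
have ib := integrable_rect I J lb.
have ibc : mu2.-integrable (rect I J) (EFin \o (fun z => b z - c)).
  by have := integrableB mR ib ic.
have fin : rin (fun z => `|b z - c|%R) I J = (\int[mu2]_(z in rect I J) `|b z - c|)%:E.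
  rewrite /Rintegral fineK//.
  exact: (integrable_fin_num mR (integrable_abse ibc)).
rewrite fin lee_fin; apply: le_trans (le_normr_Rintegral mR ibc).
rewrite RintegralB// Rintegral_cst//.
have -> : fine (mu2 (rect I J)) = dlen I * dlen J by rewrite mu2_rect.
rewrite averageE -[X in _ * X]gtr0_norm// -normrM mulrBl mulrAC.
by rewrite mulVf ?mul1r// gt_eqF.
Qed.

Lemma rin_ge0 F I J : (forall z, 0 <= F z) -> (0 <= rin F I J)%E.
Proof. by move=> F0; apply: integral_ge0 => z _; rewrite lee_fin. Qed.

Lemma le_rin F G I J : mfun F -> mfun G -> (forall z, 0 <= F z) ->
  (forall z, F z <= G z) -> (rin F I J <= rin G I J)%E.
Proof.
move=> mF mG F0 FG; apply: ge0_le_integral => //.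
- exact: measurable_rect.
- by move=> z _; rewrite lee_fin.
- exact: (measurable_EFinS mF).
- exact: (measurable_EFinS mG).
- by move=> z _; rewrite lee_fin.
Qed.

Lemma rin_affine F (t a : R) I J : mfun F -> (forall z, 0 <= F z) -> 0 <= t -> 0 <= a ->
  rin (fun z => t * (F z + a)) I J = (t%:E * (rin F I J + (a * (dlen I * dlen J))%:E))%E.
Proof.
move=> mF F0 t0 a0; rewrite EFinM -mu2_rect.
exact: (ge0_integral_affine mu2 (measurable_rect I J) mF F0 t0 a0).
Qed.

(** Supremum, normalization and outer power are cleared at once, so that norms are compared through
    integrals over single rectangles. *)
Lemma bmo_normP p b s : 0 < p -> 0 <= s -> (bmo_norm p b <= s%:E)%E <->
  forall I J, (rin (fun z => (`|b z - average b I J| `^ p)%R) I J <=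
    (s `^ p * (dlen I * dlen J))%:E)%E.
Proof.
move=> p0 s0.
pose X I J : \bar R := rin (fun z => (`|b z - average b I J| `^ p)%R) I J.
have X0 I J : (0 <= X I J)%E by apply: rin_ge0 => z; exact: powR_ge0.
have key I J : ((((area I J)^-1)%:E * X I J) `^ p^-1 <= s%:E)%E =
    (X I J <= (s `^ p * (dlen I * dlen J))%:E)%E.
  have a0 := @area_gt0 I J; have Y0 : (0 <= ((area I J)^-1)%:E * X I J)%E.
    by rewrite mule_ge0// lee_fin invr_ge0 ltW.
  rewrite -areaE mulrC EFinM -lee_pdivrMl//.
  move: Y0; set Y := (_ * _)%E => Y0; apply/idP/idP => h.
    have -> : Y = ((Y `^ p^-1) `^ p)%E by rewrite -poweRrM mulVf ?poweRe1// gt_eqF.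
    rewrite -poweR_EFin; apply: gt0_ler_poweR => //; first exact: ltW.
      by rewrite in_itv/= poweR_ge0 leey.
    by rewrite in_itv/= lee_fin s0 leey.
  have -> : s%:E = ((s `^ p)%:E `^ p^-1)%E.
    by rewrite poweR_EFin -powRrM mulfV ?powRr1// gt_eqF.
  apply: gt0_ler_poweR => //; first by rewrite invr_ge0 ltW.
    by rewrite in_itv/= Y0 leey.
  by rewrite in_itv/= lee_fin powR_ge0 leey.
split=> [h I J|h].
  rewrite -key; apply: le_trans h; apply: ereal_sup_ubound; exists I, J.
  by [].
apply: ge_ereal_sup => _ [I [J ->]].
by move: (h I J); rewrite -key.
Qed.

Lemma bmo_norm_ge0 p b : (0 <= bmo_norm p b)%E.
Proof.
apply: le_trans (ereal_sup_ubound _); last by exists (0, 0), (0, 0).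
exact: poweR_ge0.
Qed.

Lemma mfun_osc_pow p b (c : R) : mfun b -> mfun (fun z => `|b z - c| `^ p).
Proof.
move=> mb; apply: (measurableT_comp (@measurable_powR R p)).
by apply: mfun_norm; apply: measurable_funB.
Qed.

Lemma bmo1_norm B b : 0 <= B -> lint2 b -> (bmo_norm 1 b <= B%:E)%E -> bmo1 B b.
Proof.
move=> B0 lb /bmo_normP-/(_ ltr01 B0) h; split=> // I J; exists (average b I J).
have := h I J; rewrite powRr1//; apply: le_trans.
apply: eqle; apply: eq_integral => z _.
by rewrite powRr1.
Qed.

Lemma average_john_nirenberg B b k : 0 < B -> bmo1 B b -> forall I J,
  (rin (fun z => (`|b z - average b I J| ^+ k)%R) I J <=
   (2 ^+ k * (bmocst k + bmocst 1 ^+ k) * B ^+ k * (dlen I * dlen J))%:E)%E.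
Proof.
move=> B0 hb I J; have [lb _] := hb; have [mb _] := lb.
have [c hc] := rect_john_nirenberg I J B0 hb.
have d0 : 0 < dlen I * dlen J by rewrite mulr_gt0// dlen_gt0.
(* The same centre [c] serves all exponents, so its distance to the average is read off from
   exponent 1. *)
have ac : `|average b I J - c| <= bmocst 1 * B.
  have := le_trans (average_dist I J c lb) (hc 1%N).
  by rewrite lee_fin expr1 ler_pM2r.
have C0 : 0 <= bmocst 1 * B by apply: le_trans ac; exact: normr_ge0.
have mc : mfun (fun z => `|b z - c| ^+ k).
  by apply: measurable_funX; apply: mfun_norm; apply: measurable_funB.
apply: (@le_trans _ _ (rin (fun z => 2 ^+ k * (`|b z - c| ^+ k + (bmocst 1 * B) ^+ k)) I J)).
  apply: le_rin.
  - by apply: measurable_funX; apply: mfun_norm; apply: measurable_funB.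
  - by apply: measurable_funM => //; apply: measurable_funD.
  - by move=> z; rewrite exprn_ge0.
  - move=> z; apply: le_trans (exprD_le k (normr_ge0 _) C0).
    rewrite lerXn2r ?nnegrE ?addr_ge0//.
    rewrite (_ : b z - _ = (b z - c) - (average b I J - c)); last by ring.
    by apply: le_trans (ler_normB _ _) _; rewrite lerD2l.
rewrite rin_affine ?exprn_ge0//.
apply: (@le_trans _ _ ((2 ^+ k)%:E * ((bmocst k * B ^+ k * (dlen I * dlen J))%:E +
    ((bmocst 1 * B) ^+ k * (dlen I * dlen J))%:E))%E).
  by apply: lee_wpmul2l; [rewrite lee_fin exprn_ge0|apply: leeD].
by rewrite -EFinD -EFinM lee_fin; apply: eqle; rewrite exprMn; ring.
Qed.

Lemma powR_le_1X p k (t : R) : 0 < p -> p <= k%:R -> 0 <= t -> t `^ p <= t ^+ k + 1.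
Proof.
move=> p0 pk t0; have [t1|t1] := leP t 1.
  apply: (@le_trans _ _ 1); last by rewrite lerDr exprn_ge0.
  have -> : 1 = (1 : R) `^ p by rewrite powR1.
  by apply: ge0_ler_powR => //; rewrite ?nnegrE// ltW.
apply: (@le_trans _ _ (t ^+ k)); last by rewrite lerDl.
by rewrite -powR_mulrn//; apply: ler_powR => //; exact: ltW.
Qed.

(** With an integer $k \ge p$ one has $w^p \le B^p((w/B)^k + 1)$, so integer exponents suffice; the
    rescaling by $B$ makes the bound homogeneous. *)
Lemma bmo_norm_upper p : 0 < p -> exists2 C, 0 < C &
  forall B b, 0 < B -> bmo1 B b -> (bmo_norm p b <= (C * B)%:E)%E.
Proof.
move=> p0; pose k := Num.bound p.
have pk : p <= k%:R by apply: ltW; exact: archi_boundP (ltW p0).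
pose D := 2 ^+ k * (bmocst k + bmocst 1 ^+ k) : R.
have b0 m : 0 <= bmocst m :> R.
  by rewrite /bmocst !mulr_ge0 ?exprn_ge0 ?jncst_ge0.
have D0 : 0 <= D by rewrite mulr_ge0 ?addr_ge0 ?exprn_ge0.
have D1 : 0 < D + 1 by rewrite ltr_wpDl.
exists ((D + 1) `^ p^-1) => [|B b B0 hb]; first exact: powR_gt0.
have [[mb _] _] := hb.
apply/bmo_normP => // [|I J]; first by rewrite mulr_ge0 ?powR_ge0// ltW.
rewrite powRM ?powR_ge0 ?(ltW B0)// -powRrM mulVf ?gt_eqF// powRr1 ?(ltW D1)//.
have mc : mfun (fun z => `|b z - average b I J| ^+ k).
  by apply: measurable_funX; apply: mfun_norm; apply: measurable_funB.
have BX : 0 < B ^+ k by rewrite exprn_gt0.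
pose t := B `^ p / B ^+ k; have t0 : 0 <= t by rewrite divr_ge0 ?powR_ge0// ltW.
apply: (@le_trans _ _ (rin (fun z => t * (`|b z - average b I J| ^+ k + B ^+ k)) I J)).
  apply: le_rin.
  - exact: mfun_osc_pow.
  - by apply: measurable_funM => //; apply: measurable_funD.
  - by move=> z; exact: powR_ge0.
  - move=> z; set w := `|_|; have w0 : 0 <= w by exact: normr_ge0.
    have wB : 0 <= w / B by rewrite divr_ge0// ltW.
    have {1}-> : w = B * (w / B) by field; rewrite gt_eqF.
    rewrite powRM ?(ltW B0)//.
    have -> : t * (w ^+ k + B ^+ k) = B `^ p * ((w / B) ^+ k + 1).
      by rewrite /t expr_div_n; field; rewrite gt_eqF.
    by apply: ler_wpM2l; [exact: powR_ge0|exact: powR_le_1X].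
rewrite rin_affine ?(ltW BX)//.
apply: (@le_trans _ _ (t%:E * ((D * B ^+ k * (dlen I * dlen J))%:E + (B ^+ k * (dlen I * dlen J))%:E))%E).
  by apply: lee_wpmul2l => //; apply: leeD => //; exact: average_john_nirenberg.
rewrite -EFinD -EFinM lee_fin; apply: eqle.
by rewrite /t; field; rewrite gt_eqF.
Qed.

Lemma bmo_norm1_le p s b : 1 <= p -> 0 < s -> mfun b -> (bmo_norm p b <= s%:E)%E ->
  (bmo_norm 1 b <= (2 * s)%:E)%E.
Proof.
move=> p1 s0 mb; have p0 : 0 < p by rewrite (lt_le_trans ltr01).
move/bmo_normP => /(_ p0 (ltW s0)) h; apply/bmo_normP => //.
  by rewrite mulr_ge0// ltW.
move=> I J; rewrite powRr1 ?mulr_ge0 ?(ltW s0)//.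
have sp0 : 0 < s `^ p by rewrite powR_gt0.
(* [t <= s + s `^ (1 - p) * t `^ p]. *)
pose t := s / s `^ p; have t0 : 0 <= t by rewrite divr_ge0 ?powR_ge0// ltW.
apply: (@le_trans _ _ (rin (fun z => t * (`|b z - average b I J| `^ p + s `^ p)) I J)).
  apply: le_rin.
  - exact: mfun_osc_pow.
  - by apply: measurable_funM => //; apply: measurable_funD => //; exact: mfun_osc_pow.
  - by move=> z; exact: powR_ge0.
  - move=> z; set w := `|_|; have w0 : 0 <= w by exact: normr_ge0.
    rewrite powRr1//.
    have ws : 0 <= w / s by rewrite divr_ge0// ltW.
    have {2}-> : w = s * (w / s) by field; rewrite gt_eqF.
    rewrite powRM ?(ltW s0)//.
    have -> : t * (s `^ p * (w / s) `^ p + s `^ p) = s * ((w / s) `^ p + 1).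
      by rewrite /t; field; rewrite gt_eqF.
    rewrite mulrC -ler_pdivrMr//.
    have [h1|h1] := leP (w / s) 1.
      by rewrite (le_trans h1)// lerDr powR_ge0.
    apply: (@le_trans _ _ ((w / s) `^ p)); last by rewrite lerDl.
    by rewrite -[leLHS]powRr1//; apply: ler_powR => //; exact: ltW.
rewrite rin_affine ?powR_ge0//; last exact: mfun_osc_pow.
apply: (@le_trans _ _ (t%:E * ((s `^ p * (dlen I * dlen J))%:E + (s `^ p * (dlen I * dlen J))%:E))%E).
  by apply: lee_wpmul2l => //; apply: leeD.
rewrite -EFinD -EFinM lee_fin; apply: eqle.
by rewrite /t; field; rewrite gt_eqF.
Qed.

(** * The upper estimate *)

(** The variance is the oscillation with exponent 2, and the slices have mean oscillation at most
    [2 * B]: the John-Nirenberg inequality gives this [v]. *)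
Lemma bmo_var_slices B b : 0 < B -> bmo1 B b ->
  var_slices (Num.sqrt (jncst 2) * (2 * B)) b.
Proof.
move=> B0 hb; have B2 : 0 < 2 * B by rewrite mulr_gt0.
rewrite /var_slices exprMn sqr_sqrtr ?jncst_ge0//.
apply: filterS (ae_slice_osc hb) => x [lx hx].
set f := sl1 b x in lx *; have [mf _] := lx.
have h J : (lin (fun y => (`|f y - dav f J| ^+ 2)%R) J <=
    (jncst 2 * (2 * B) ^+ 2 * dlen J)%:E)%E := john_nirenberg 2 B2 lx hx J.
have md J : measurable_fun setT (fun y => `|f y - dav f J| ^+ 2).
  by apply: measurable_funX; apply: measurableT_comp => //; apply: measurable_funB.
have lf2 : locint2 f.
  split=> //; apply: locint_ge0; [exact: measurable_funX|by move=> y; exact: sqr_ge0|move=> J].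
  apply: (@le_lt_trans _ _ (lin (fun y => 2 * (`|f y - dav f J| ^+ 2 + dav f J ^+ 2)) J)).
    apply: lin_le.
    - exact: measurable_funX.
    - by apply: measurable_funM => //; apply: measurable_funD.
    - by move=> y; exact: sqr_ge0.
    - apply: aeW => y; rewrite real_normK ?num_real//.
      by have := sqr_ge0 (f y - 2 * dav f J); nra.
    - by move=> y; rewrite mulr_ge0 ?addr_ge0 ?sqr_ge0.
  rewrite lin_affine ?sqr_ge0//.
  apply: (@le_lt_trans _ _ (2%:E * ((jncst 2 * (2 * B) ^+ 2 * dlen J)%:E + (dav f J ^+ 2 * dlen J)%:E))%E).
    by apply: lee_wpmul2l => //; apply: leeD.
  by rewrite -EFinD -EFinM ltry.
split=> // J; rewrite dvarE// -lee_fin; apply: le_trans (h J).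
rewrite /Rintegral fineK; last first.
  exact: (integrable_fin_num (measurable_dset J) (integrable_dist2 J _ lf2)).
apply: eqle; apply: eq_integral => y _.
by rewrite real_normK ?num_real.
Qed.

(** * The commutator on bounded compactly supported functions and its extension *)

Lemma rect_box I J : exists M : R, rect I J `<=` `[- M, M]%classic `*` `[- M, M]%classic.
Proof.
exists (2 ^+ (`|I.1| + `|I.2| + 1)%N + 2 ^+ (`|J.1| + `|J.2| + 1)%N).
move=> z [/dset_bound hI /dset_bound hJ]; split; rewrite /= in_itv/= -ler_norml.
  by rewrite (le_trans (ltW hI))// lerDl exprn_ge0.
by rewrite (le_trans (ltW hJ))// lerDr exprn_ge0.
Qed.

Lemma compact_box (M : R) : @compact (R * R)%type (`[- M, M]%classic `*` `[- M, M]%classic).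
Proof. by apply: compact_setX; exact: segment_compact. Qed.

Lemma locally_integrable2_lint2 b : locally_integrable2 b -> lint2 b.
Proof.
move=> [mb bK]; split=> // I J; have [M] := rect_box I J.
set K := (X in _ `<=` X) => hM; have cK : @compact (R * R)%type K := @compact_box M.
apply: le_lt_trans (bK _ cK); apply: ge0_subset_integral.
- exact: measurable_rect.
- by apply: measurableX; exact: measurable_itv.
- exact: (measurable_EFinS (mfun_norm mb)).
- by move=> z _; rewrite lee_fin normr_ge0.
- exact: hM.
Qed.

Lemma rin_sqr_lty B b I J : 0 < B -> bmo1 B b -> (rin (fun z => (b z ^+ 2)%R) I J < +oo)%E.
Proof.
move=> B0 hb; have [[mb _] _] := hb.
have [c /(_ 2%N) hc] := rect_john_nirenberg I J B0 hb.
have mc : mfun (fun z => `|b z - c| ^+ 2).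
  by apply: measurable_funX; apply: mfun_norm; apply: measurable_funB.
apply: (@le_lt_trans _ _ (rin (fun z => 2 * (`|b z - c| ^+ 2 + c ^+ 2)) I J)).
  apply: le_rin.
  - exact: measurable_funX.
  - by apply: measurable_funM => //; apply: measurable_funD.
  - by move=> z; exact: sqr_ge0.
  - move=> z; rewrite real_normK ?num_real//.
    by have := sqr_ge0 (b z - 2 * c); nra.
rewrite rin_affine ?sqr_ge0//.
apply: (@le_lt_trans _ _ (2%:E * ((bmocst 2 * B ^+ 2 * (dlen I * dlen J))%:E +
    (c ^+ 2 * (dlen I * dlen J))%:E))%E).
  by apply: lee_wpmul2l => //; apply: leeD.
by rewrite -EFinD -EFinM ltry.
Qed.

Definition inbox m (z : RR * RR) := `|z.1| < 2 ^+ m /\ `|z.2| < 2 ^+ m.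

(** The top dyadic rectangles of the four quadrants: no single dyadic rectangle contains a
    neighbourhood of the origin. *)
Definition quad m : seq (dyadic * dyadic) :=
  [:: ((m%:Z, 0), (m%:Z, 0)); ((m%:Z, 0), (m%:Z, -1)); ((m%:Z, -1), (m%:Z, 0)); ((m%:Z, -1), (m%:Z, -1))].

Lemma sqint_quad G m : mfun G -> (forall I J, (rin (fun z => (G z ^+ 2)%R) I J < +oo)%E) ->
  (forall z, ~ inbox m z -> G z = 0) -> sqint mu2 G.
Proof.
move=> mG hG G0.
pose T (q : dyadic * dyadic) (z : RR * RR) := `|G z| * \1_(rect q.1 q.2) z.
have T0 q z : 0 <= T q z by rewrite mulr_ge0// indicE.
have sT q : sqint mu2 (T q).
  split.
    apply: measurable_funM; first exact: mfun_norm.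
    by apply: measurable_indic; exact: measurable_rect.
  apply: le_lt_trans (hG q.1 q.2); rewrite /rin integral_mkcond /esq.
  apply: eqle; apply: eq_integral => z _.
  rewrite /patch /T indicE; case: (_ \in _); rewrite ?mulr1 ?real_normK ?num_real//.
  by rewrite mulr0 expr0n.
apply: (@le_sqint _ _ R mu2 _ (fun z => \sum_(q <- quad m) T q z)) => //.
  exact: sqint_sum.
move=> z; rewrite [leRHS]ger0_norm; last by apply: sumr_ge0 => q _.
have [hz|hz] := pselect (inbox m z); last first.
  by rewrite G0// normr0; apply: sumr_ge0 => q _.
have [q qm qz] : exists2 q, q \in quad m & rect q.1 q.2 z.
  case: z hz => x y [/dset_cover hx /dset_cover hy]; case: hx => hx; case: hy => hy.
  - by exists ((m%:Z, 0), (m%:Z, 0)); rewrite ?inE ?eqxx ?orbT.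
  - by exists ((m%:Z, 0), (m%:Z, -1)); rewrite ?inE ?eqxx ?orbT.
  - by exists ((m%:Z, -1), (m%:Z, 0)); rewrite ?inE ?eqxx ?orbT.
  - by exists ((m%:Z, -1), (m%:Z, -1)); rewrite ?inE ?eqxx ?orbT.
rewrite (big_rem q)//= {1}/T indicE mem_set// mulr1 lerDl.
by apply: sumr_ge0 => q' _.
Qed.

Lemma compact_inbox (K : set (R * R)) : compact K -> exists m, forall z, K z -> inbox m z.
Proof.
move=> cK; have [M [_ MK]] := compact_bounded cK.
have {}MK : forall z, K z -> `|z| <= M + 1 by apply: MK; lra.
exists (Num.bound (M + 1)) => z Kz.
have h := MK z Kz.
have M0 : 0 <= M + 1 by exact: le_trans (normr_ge0 _) h.
have b1 : M + 1 < 2 ^+ (Num.bound (M + 1)).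
  apply: lt_le_trans (archi_boundP M0) _; rewrite -natrX ler_nat.
  by apply: ltnW; exact: ltn_expl.
split; apply: le_lt_trans b1; apply: le_trans h.
  by rewrite prod_normE le_max lexx.
by rewrite prod_normE le_max lexx orbT.
Qed.

(** This puts $bF$ into the domain of $S_1S_2$, so that the commutator is defined on bounded
    compactly supported functions; the local square integrability of [b] comes from the
    John-Nirenberg inequality. *)
Lemma sqint_mul_bcs b F : mfun b -> (forall I J, (rin (fun z => (b z ^+ 2)%R) I J < +oo)%E) ->
  bounded_compact_support F -> sqint mu2 (b \* F)%R.
Proof.
move=> mb hb [mF [N FN] [K cK FK]]; have [m hm] := compact_inbox cK.
have mF' : mfun F by exact: mF.
have mbF : mfun (b \* F)%R by exact: measurable_funM.
apply: (@sqint_quad _ m) => //; last first.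
  by move=> z hz /=; rewrite FK ?mulr0// => /hm.
move=> I J; have N0 : 0 <= N by exact: le_trans (normr_ge0 _) (FN (0, 0)).
apply: (@le_lt_trans _ _ (rin (fun z => N ^+ 2 * (b z ^+ 2 + 0)) I J)).
  apply: le_rin.
  - exact: measurable_funX.
  - by apply: measurable_funM => //; apply: measurable_funD => //; exact: measurable_funX.
  - by move=> z; exact: sqr_ge0.
  - move=> z; rewrite addr0 /= exprMn mulrC; apply: ler_wpM2r; first exact: sqr_ge0.
    by rewrite -[F z ^+ 2]real_normK ?num_real// lerXn2r ?nnegrE.
rewrite rin_affine ?sqr_ge0//; last 2 first.
- exact: measurable_funX.
- by move=> z; exact: sqr_ge0.
have := hb I J; have := @rin_ge0 (fun z => b z ^+ 2) I J (fun z => sqr_ge0 _).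
case: (rin _ I J) => [r| |]//= _ _.
by rewrite -EFinD -EFinM ltry.
Qed.

Lemma bcs_mfun F : bounded_compact_support F -> mfun F.
Proof. by case. Qed.

Lemma sqint_bcs F : bounded_compact_support F -> sqint mu2 F.
Proof.
move=> hF; rewrite (_ : F = (fun=> 1) \* F)%R; last by apply/funext => z /=; rewrite mul1r.
apply: sqint_mul_bcs => // I J; rewrite /rin integral_cst; last exact: measurable_rect.
have h : (mu2 (rect I J) < +oo)%E by rewrite mu2_rect ltry.
by rewrite expr1n mul1e; exact: h.
Qed.

(** The bound for unbounded symbols at $v^2 = 4\,$[jncst 2]$\,B^2$, divided by $B^2$. *)
Definition upcst : R := 8 * (comcst * (jncst 2 * 4)).

Lemma upcst_ge0 : 0 <= upcst.
Proof. by rewrite /upcst !mulr_ge0 ?comcst_ge0 ?jncst_ge0. Qed.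

Lemma commutator_initial_bound B b F G : 0 < B -> bmo1 B b -> commutator_initial b F G ->
  sqint mu2 F /\ mfun G /\ (esq mu2 G <= (upcst * B ^+ 2)%:E * esq mu2 F)%E.
Proof.
move=> B0 hb [U [V [hU hV ->]]]; have [[mb _] _] := hb.
have [sF [mV _]] := shift12_sqint hV; have [_ [mU _]] := shift12_sqint hU.
split=> //; split; first exact: (measurable_funB mU (measurable_funM mb mV)).
have v0 : 0 < Num.sqrt (jncst 2) * (2 * B).
  by rewrite mulr_gt0 ?mulr_gt0// sqrtr_gt0 /jncst /jnlam addr_gt0 ?mulr_gt0 ?exprn_gt0 ?mulr_gt0 ?exprn_gt0.
have := commutator_unbounded v0 mb (bmo_var_slices B0 hb) (bmo_var_slices B0 (bmo1_swp hb)) hV hU.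
rewrite exprMn sqr_sqrtr ?jncst_ge0//.
by rewrite (_ : 8 * _ = upcst * B ^+ 2)// /upcst; ring.
Qed.

Lemma commutator_initial_exists B b F : 0 < B -> bmo1 B b -> bounded_compact_support F ->
  exists G, commutator_initial b F G.
Proof.
move=> B0 hb hF; have [[mb _] _] := hb.
have [U hU] := shift12_exists (sqint_mul_bcs mb (fun I J => rin_sqr_lty I J B0 hb) hF).
have [V hV] := shift12_exists (sqint_bcs hF).
by exists (U \- b \* V)%R, U, V.
Qed.

Lemma commutator_initial_sub b F F' G G' : commutator_initial b F G -> commutator_initial b F' G' ->
  commutator_initial b (F \- F')%R (G \- G')%R.
Proof.
move=> [U [V [hU hV ->]]] [U' [V' [hU' hV' ->]]].
exists (U \- U')%R, (V \- V')%R; split.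
- rewrite (_ : b \* _ = (b \* F) \- (b \* F'))%R; first exact: shift12_sub.
  by apply/funext => z /=; rewrite mulrBr.
- exact: shift12_sub.
- by apply/funext => z /=; ring.
Qed.

Lemma norm2_le F (e : R) : 0 <= e -> (norm2 F <= e%:E)%E = (esq mu2 F <= (e ^+ 2)%:E)%E.
Proof.
move=> e0; rewrite norm2E; have E0 := @esq_ge0 _ _ R mu2 F.
move: E0; set E := esq mu2 F => E0; apply/idP/idP => h.
  have -> : E = ((E `^ 2^-1) `^ 2)%E by rewrite -poweRrM mulVf ?poweRe1// pnatr_eq0.
  rewrite -powR_mulrn// -poweR_EFin; apply: gt0_ler_poweR => //.
    by rewrite in_itv/= poweR_ge0 leey.
  by rewrite in_itv/= lee_fin e0 leey.
have -> : e%:E = ((e ^+ 2)%:E `^ 2^-1)%E.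
  by rewrite poweR_EFin -powR_mulrn// -powRrM mulfV ?powRr1// pnatr_eq0.
apply: gt0_ler_poweR => //; first by rewrite in_itv/= E0 leey.
by rewrite in_itv/= lee_fin exprn_ge0// leey.
Qed.

Lemma norm2_ge0 F : (0 <= norm2 F)%E.
Proof. by rewrite norm2E poweR_ge0. Qed.

Lemma cvg_norm2P (F_ : nat -> RR * RR -> R) : (norm2 (F_ n) @[n --> \oo] --> 0%E) <->
  (esq mu2 (F_ n) @[n --> \oo] --> 0%E).
Proof.
rewrite (cvge0P (fun n => norm2_ge0 _)) (cvge0P (fun n => esq_ge0 _ _)).
split=> h e e0.
  have se0 : 0 < Num.sqrt e by rewrite sqrtr_gt0.
  have [N hN] := h _ se0; exists N => n Nn.
  by have := hN n Nn; rewrite norm2_le ?(ltW se0)// sqr_sqrtr// ltW.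
have [N hN] := h (e ^+ 2) (exprn_gt0 _ e0); exists N => n Nn.
by rewrite norm2_le ?(ltW e0)//; exact: hN.
Qed.

Definition cutoff F n : RR * RR -> R :=
  F \* \1_[set z | `|F z| <= n%:R /\ (`|z.1| <= n%:R /\ `|z.2| <= n%:R)].

Lemma cutoff_set F n : mfun F ->
  measurable ([set z | `|F z| <= n%:R /\ (`|z.1| <= n%:R /\ `|z.2| <= n%:R)] : set (RR * RR)).
Proof.
move=> mF.
have h (G : RR * RR -> R) : mfun G -> measurable ([set z | `|G z| <= n%:R] : set (RR * RR)).
  move=> mG; have := mfun_norm mG.
  move=> /(_ measurableT `]-oo, n%:R]%classic (measurable_itv _)); rewrite setTI.
  by congr measurable; apply/seteqP; split => z; rewrite /= in_itv.
have h1 := h (fun z => z.1) (@measurable_fst _ _ RR RR).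
have h2 := h (fun z => z.2) (@measurable_snd _ _ RR RR).
exact: measurableI (h F mF) (measurableI _ _ h1 h2).
Qed.

Lemma cutoff_le F n z : `|cutoff F n z| <= `|F z|.
Proof. by rewrite /cutoff/= indicE; case: (_ \in _); rewrite ?mulr1// mulr0 normr0. Qed.

Lemma bcs_cutoff F n : mfun F -> bounded_compact_support (cutoff F n).
Proof.
move=> mF; split.
- by apply: measurable_funM => //; apply: measurable_indic; exact: cutoff_set.
- exists n%:R => z; rewrite /cutoff/= indicE.
  have [|_] := boolP (z \in _); last by rewrite mulr0 normr0.
  by rewrite inE => -[h _]; rewrite mulr1.
- exists (`[- n%:R, n%:R]%classic `*` `[- n%:R, n%:R]%classic); first exact: compact_box.
  move=> z hz; rewrite /cutoff/= indicE memNset ?mulr0// => -[_ [h1 h2]]; apply: hz.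
  by split; rewrite /= in_itv/= -ler_norml.
Qed.

Lemma cutoff_cvg F : sqint mu2 F -> esq mu2 (cutoff F n \- F)%R @[n --> \oo] --> 0%E.
Proof.
move=> sF; have [mF _] := sF; apply: cvg_esq_dominated => //.
- by move=> n; apply: measurable_funM => //; apply: measurable_indic; exact: cutoff_set.
- move=> n z; rewrite /cutoff/= indicE; case: (_ \in _); rewrite ?mulr1 ?subrr ?normr0//.
  by rewrite mulr0 sub0r normrN.
- move=> z; apply: cvg_near_cst; near=> n.
  rewrite /cutoff/= indicE mem_set ?mulr1//=; split; last split.
  + by near: n; exact: nbhs_infty_ger.
  + by near: n; exact: nbhs_infty_ger.
  + by near: n; exact: nbhs_infty_ger.
Unshelve. all: by end_near. Qed.

Lemma esq_triangle F G H : mfun F -> mfun G -> mfun H ->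
  (esq mu2 (F \- H)%R <= 2%:E * esq mu2 (F \- G)%R + 2%:E * esq mu2 (G \- H)%R)%E.
Proof.
move=> mF mG mH.
rewrite (_ : F \- H = (F \- G) \+ (G \- H))%R; last by apply/funext => z /=; ring.
by apply: esqD; apply: measurable_funB.
Qed.

Lemma mule_cvge0 (c : R) (a : nat -> \bar R) : 0 <= c -> a n @[n --> \oo] --> 0%E ->
  (c%:E * a n)%E @[n --> \oo] --> 0%E.
Proof. by move=> c0 h; rewrite -(mule0 c%:E); apply: cvgeZl. Qed.

Lemma squeeze_cvge0 (a c : nat -> \bar R) : (forall n, 0 <= a n <= c n)%E ->
  c n @[n --> \oo] --> 0%E -> a n @[n --> \oo] --> 0%E.
Proof. by move=> h hc; apply: (squeeze_cvge _ (cvg_cst _) hc); apply: nearW. Qed.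

(** The value is the limit along the cutoffs of [F]. Any other approximating sequence is compared
    with the cutoffs: by linearity the difference of the values is a commutator of
    [f_ n - cutoff F n], which tends to 0 by the initial bound. *)
Lemma commutator_exists B b F : 0 < B -> bmo1 B b -> L2 F -> exists G, commutator b F G.
Proof.
move=> B0 hb /L2P sF; have [mF eF] := sF; have [[mb _] _] := hb.
have /choice[g_ hg] : forall n, exists G, commutator_initial b (cutoff F n) G.
  by move=> n; apply: (commutator_initial_exists B0 hb); exact: bcs_cutoff.
have cF := cutoff_cvg sF.
have mc n : mfun (cutoff F n) by exact: bcs_mfun (bcs_cutoff n mF).
have gg n : mfun (g_ n) by have [_ []] := commutator_initial_bound B0 hb (hg n).
pose K := upcst * B ^+ 2; have K0 : 0 <= K by rewrite mulr_ge0 ?upcst_ge0// sqr_ge0.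
have sg n : sqint mu2 (g_ n).
  have [[_ sc] [mg eg]] := commutator_initial_bound B0 hb (hg n).
  by split=> //; apply: le_lt_trans eg _; rewrite lte_mul_pinfty.
have [G [k [sG _ _ gG]]] : exists H (k : nat -> nat), [/\ sqint mu2 H, forall j, (j <= k j)%N,
    {ae mu2, forall z, g_ (k j) z @[j --> \oo] --> H z} &
    esq mu2 (g_ n \- H)%R @[n --> \oo] --> 0%E].
  apply: riesz_fischer => // e e0.
  have K1 : 0 < K + 1 by rewrite ltr_wpDl.
  have e1 : 0 < e / (4 * (K + 1)) by rewrite divr_gt0 ?mulr_gt0.
  have [N hN] := (cvge0P (fun n => esq_ge0 _ _)).1 cF _ e1.
  exists N => n m Nn Nm.
  have [_ [_ h]] := commutator_initial_bound B0 hb (commutator_initial_sub (hg n) (hg m)).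
  apply: le_trans h _; rewrite -/K.
  have h2 : (esq mu2 (cutoff F n \- cutoff F m)%R <= (e / (K + 1))%:E)%E.
    apply: le_trans (esq_triangle (mc n) mF (mc m)) _.
    rewrite [X in (_ + _ * X <= _)%E]esq_subC.
    apply: (@le_trans _ _ (2%:E * (e / (4 * (K + 1)))%:E + 2%:E * (e / (4 * (K + 1)))%:E)%E).
      by apply: leeD; apply: lee_wpmul2l => //; exact: hN.
    rewrite -!EFinM -EFinD lee_fin; apply: eqle.
    by field; rewrite gt_eqF.
  apply: (@le_trans _ _ (K%:E * (e / (K + 1))%:E)%E); first exact: lee_wpmul2l.
  by rewrite -EFinM lee_fin mulrA ler_pdivrMr// mulrC ler_pM2l// lerDl.
have [mG _] := sG.
exists G; split; [exact/L2P|exact/L2P|].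
move=> f_ hf cf.
have /choice[g' hg'] : forall n, exists G, commutator_initial b (f_ n) G.
  by move=> n; exact: (commutator_initial_exists B0 hb).
exists g' => //; apply/(cvg_norm2P (fun n => g' n \- G)%R).
move/(cvg_norm2P (fun n => f_ n \- F)%R): cf => cf.
have mg' n : mfun (g' n) by have [_ []] := commutator_initial_bound B0 hb (hg' n).
have mf n : mfun (f_ n) by exact: bcs_mfun.
apply: (@squeeze_cvge0 _ (fun n => (2 * K * 2)%:E * esq mu2 (f_ n \- F)%R +
   ((2 * K * 2)%:E * esq mu2 (cutoff F n \- F)%R + 2%:E * esq mu2 (g_ n \- G)%R))%E).
  move=> n; rewrite esq_ge0/=; apply: le_trans (esq_triangle (mg' n) (gg n) mG) _.
  rewrite addeA; apply: leeD => //.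
  have [_ [_ h]] := commutator_initial_bound B0 hb (commutator_initial_sub (hg' n) (hg n)).
  have h' := le_trans h (lee_wpmul2l _ (esq_triangle (mf n) mF (mc n))).
  have {}h' := h' _; rewrite -/K in h'.
  rewrite -muleDr; last by rewrite ge0_adde_def// inE esq_ge0.
    rewrite -mulrA EFinM -muleA; apply: lee_wpmul2l => //.
    rewrite EFinM -muleA muleDr; last by rewrite ge0_adde_def// inE esq_ge0.
      by rewrite [X in (_ <= _ * (_ + _ * X))%E]esq_subC; apply: h'; rewrite lee_fin.
    by [].
  by [].
have K4 : 0 <= 2 * K * 2 by rewrite mulr_ge0 ?(mulr_ge0 _ K0).
rewrite -[X in _ --> X]adde0; apply: cvgeD => //; first exact: mule_cvge0.
rewrite -[X in _ --> X]adde0; apply: cvgeD => //; first exact: mule_cvge0.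
exact: mule_cvge0.
Qed.

(** The cutoffs form an admissible sequence of norm at most that of [F]; approximating [G] by their
    commutators costs the factor 2. *)
Lemma commutator_bound B b F G : 0 < B -> bmo1 B b -> commutator b F G ->
  (esq mu2 G <= (2 * upcst * B ^+ 2)%:E * esq mu2 F)%E.
Proof.
move=> B0 hb [/L2P sF /L2P sG h]; have [mF _] := sF; have [mG _] := sG.
have [||g_ hg cg] := h (cutoff F).
- by move=> n; exact: bcs_cutoff.
- by apply/(cvg_norm2P (fun n => cutoff F n \- F)%R); exact: cutoff_cvg.
move/(cvg_norm2P (fun n => g_ n \- G)%R): cg => cg.
pose K := upcst * B ^+ 2; have K0 : 0 <= K by rewrite mulr_ge0 ?upcst_ge0// sqr_ge0.
apply/lee_addgt0Pr => e e0.
have [N hN] := (cvge0P (fun n => esq_ge0 _ _)).1 cg (e / 2) (divr_gt0 e0 (ltr0n _ 2)).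
have [_ [mg eg]] := commutator_initial_bound B0 hb (hg N).
have -> : G = (g_ N \- (g_ N \- G))%R by apply/funext => z /=; ring.
apply: le_trans (@esqB _ _ R mu2 _ _ mg (measurable_funB mg mG)) _.
apply: leeD; last first.
  apply: (@le_trans _ _ (2%:E * (e / 2)%:E)%E); first by apply: lee_wpmul2l => //; exact: hN.
  by rewrite -EFinM lee_fin; lra.
rewrite -mulrA EFinM -muleA; apply: lee_wpmul2l => //.
apply: le_trans eg _; apply: lee_wpmul2l => //.
by apply: le_esq => //; [exact: bcs_mfun (bcs_cutoff N mF)|exact: cutoff_le].
Qed.

Lemma esq0_ae d (T : measurableType d) (mu : {measure set T -> \bar R}) (f : T -> R) :
  measurable_fun setT f -> (esq mu f <= 0)%E -> {ae mu, forall x, f x = 0}.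
Proof.
move=> mf f0; have e0 : esq mu f = 0%E by apply/eqP; rewrite eq_le f0 esq_ge0.
have : (\int[mu]_x `|((f x) ^+ 2)%:E| = 0)%E.
  by rewrite -[RHS]e0; apply: eq_integral => x _; rewrite gee0_abs// lee_fin sqr_ge0.
move=> /(ae_eq_integral_abs mu measurableT (measurable_sqr mf)); apply: filterS => x.
by move=> /(_ Logic.I)[] /eqP; rewrite sqrf_eq0 => /eqP.
Qed.

Lemma ae0_esq d (T : measurableType d) (mu : {measure set T -> \bar R}) (f : T -> R) :
  measurable_fun setT f -> {ae mu, forall x, f x = 0} -> esq mu f = 0%E.
Proof.
move=> mf f0; have m0 : measurable_fun setT (fun _ : T => 0 : R) by exact: measurable_cst.
rewrite (ae_eq_esq mf m0 f0) /esq; under eq_integral do rewrite expr0n/=.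
by rewrite integral0.
Qed.

(** * The lower estimate *)

Definition sib I : dyadic :=
  if I == dyadic_left (dparent I) then dyadic_right (dparent I) else dyadic_left (dparent I).

Lemma tw_sib (c : dyadic -> R) I : c (sib I) = 0 -> tw c I = 0.
Proof. by rewrite /tw /sib; case: ifP => _ ->; rewrite ?oppr0. Qed.

Lemma sib_neq I : sib I != I.
Proof.
rewrite /sib; case: ifPn => [/eqP {2}->|/eqP h]; first by rewrite eq_sym dleft_neq_right.
by case: (dparentP I) => // {2}->; rewrite dleft_neq_right.
Qed.

Lemma sib_scale I : (sib I).1 = I.1.
Proof. by rewrite /sib; case: ifP => _ /=; rewrite addrK. Qed.

Lemma sib_disj I x : dset I x -> ~ dset (sib I) x.
Proof.
by move=> /dsetP h /dsetP; rewrite sib_scale h => /eqP; rewrite eq_sym (negbTE (sib_neq I)).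
Qed.

Lemma dset_sib_parent I x : dset (sib I) x -> dset (dparent I) x.
Proof. by rewrite /sib; case: ifP => _; [exact: dset_right|exact: dset_left]. Qed.

Lemma fc_ae0 f K : measurable_fun setT f -> {ae leb, forall x, dset K x -> f x = 0} -> fc f K = 0.
Proof.
move=> mf f0; rewrite /fc /inner /Rintegral.
have -> : (\int[leb]_x (f x * haar K x)%:E)%E = (\int[leb]_x (0%:E : \bar R))%E.
  apply: ae_eq_integral => //.
    by apply/measurable_EFinP; apply: measurable_funM => //; exact: measurable_haar.
  apply: filterS f0 => x fx _; congr EFin.
  have [Kx|nK] := pselect (dset K x); first by rewrite fx ?mul0r.
  by rewrite haar0 ?mulr0.
by rewrite integral0.
Qed.

(* On a child [I0] of [I] the Haar coefficients of [S f] vanish at all scales up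
   to that of [I0], because their partners are coefficients of [f] on [I]. *)
Lemma shift_const f (F : RR -> R) I I0 : Defs.shift f F -> dparent I0 = I ->
  {ae leb, forall x, ~ dset (sib I) x -> f x = 0} ->
  {ae leb, forall x, dset I0 x -> F x = dav F I0}.
Proof.
move=> sh pI f0; have [sf sF] := shift_sqint sh; have [mf _] := sf.
have lF := locint_sqint sF.
have I1 : I.1 = I0.1 + 1 by rewrite -pI.
have fI : {ae leb, forall x, dset I x -> f x = 0}.
  by apply: filterS f0 => x h /sib_disj.
have fc0 x j : dset I0 x -> j <= I0.1 -> fc F (didx j x) = 0.
  move=> xI0 jI0; rewrite (fc_shift _ sh); apply: tw_sib; apply: fc_ae0 => //.
  apply: filterS fI => y h /dset_sib_parent; rewrite -didx_parent => /dsetP/= yx.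
  apply: h; apply/dsetP.
  have jI : j + 1 <= I.1 by rewrite I1 lerD2r.
  rewrite (didx_up jI yx) I1 didx_parent.
  by move/dsetP: xI0 => ->.
have dav0 x n : dset I0 x -> dav F (didx (I0.1 - n%:Z) x) = dav F I0.
  move=> xI0; elim: n => [|n IH]; first by rewrite subr0; move/dsetP: xI0 => ->.
  have jn : I0.1 - n%:Z <= I0.1 by lia.
  have := haar_dav (I0.1 - n%:Z) x lF; rewrite fc0// mul0r => /eqP.
  rewrite eq_sym subr_eq0 IH => /eqP <-.
  by congr (dav F (didx _ x)); lia.
apply: filterS (dyadic_differentiation lF) => x hx xI0.
rewrite -(cvg_lim (@Rhausdorff R) hx).
apply: (@cvg_lim _ (@Rhausdorff R)); apply: cvg_near_cst; near=> n.
rewrite (_ : - n%:Z = I0.1 - (`|(I0.1 + n%:Z)%R|%N)%:Z); last first.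
  have : (`|I0.1|%N <= n)%N by near: n; exact: nbhs_infty_ge.
  lia.
exact: dav0.
Unshelve. all: by end_near. Qed.

Definition sibsign I : R := if I == dyadic_left (dparent I) then 1 else -1.

Lemma sibsign_sqr I : sibsign I ^+ 2 = 1.
Proof. by rewrite /sibsign; case: ifP => _; rewrite ?sqrrN expr1n. Qed.

(** The scalar is meant for tensor products: on a slice the factor in the other variable is
    constant. *)
Lemma shift_haar (a : R) I :
  Defs.shift (fun x => a * haar (sib I) x) (fun x => a * (sibsign I * haar I x)).
Proof.
have s1 : sqint leb (fun x => a * haar (sib I) x) by apply: sqintZ; exact: sqint_haar.
have s2 : sqint leb (fun x => a * (sibsign I * haar I x)).
  by apply: sqintZ; apply: sqintZ; exact: sqint_haar.
apply: shiftI => // e e0; exists [fset dparent I]%fset => B; rewrite fsub1set => IB.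
have fcE J : fc (fun x => a * haar (sib I) x) J = a * (sib I == J)%:R.
  by rewrite /fc innerE ipZl ?haar_orthonormal//; [rewrite -innerE haar_orthonormal|exact: sqint_haar..].
set H := hs _ _; have -> : H = (fun x => a * (sibsign I * haar I x)).
  apply/funext => x; rewrite /H /hs big_cseq (bigD1_seq (dparent I))//=; last exact: fset_uniq.
  rewrite [X in _ + X]big1 ?addr0; last first.
    move=> K KI; rewrite !tw_left !tw_right !fcE /sib.
    by case: ifP => _; rewrite ?(inj_eq dleft_inj) ?(inj_eq dright_inj) ?(negbTE (dleft_neq_right _ _))
      1?[dyadic_right _ == _]eq_sym ?(negbTE (dleft_neq_right _ _)) 1?[dparent I == K]eq_sym ?(negbTE KI)
      ?mulr0 ?oppr0 ?mul0r ?addr0.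
  rewrite tw_left tw_right !fcE /sib /sibsign.
  case: ifPn => [/eqP h|/eqP h].
    have -> : haar I x = haar (dyadic_left (dparent I)) x by rewrite -h.
    by rewrite eqxx [_ == dyadic_left _]eq_sym (negbTE (dleft_neq_right _ _)) /=; ring.
  have hr : I = dyadic_right (dparent I) by case: (dparentP I).
  have -> : haar I x = haar (dyadic_right (dparent I)) x by rewrite -hr.
  by rewrite eqxx (negbTE (dleft_neq_right _ _)) /=; ring.
by rewrite ipBl ?subrr ?(ltW e0)//; exact: sqintB.
Qed.

Lemma shift_ae_eq f f' (F F' : RR -> R) : Defs.shift f F -> Defs.shift f' F' ->
  {ae leb, forall x, f x = f' x} -> {ae leb, forall x, F x = F' x}.
Proof.
move=> h h' ff; have hs := shift_sub h h'; have [sf sF] := shift_sqint hs.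
have [mf _] := sf; have [mF _] := sF.
have e0 : esq leb (f \- f')%R = 0%E.
  by apply: ae0_esq => //; apply: filterS ff => x /= ->; rewrite subrr.
have : (esq leb (F \- F')%R <= 0)%E.
  by rewrite -e0 !esqE// lee_fin; exact: esq_shift hs.
by move=> /(esq0_ae mF); apply: filterS => x /= /eqP; rewrite subr_eq0 => /eqP.
Qed.

Lemma mfun_indic1 (A : set RR) : measurable A -> mfun (fun z => \1_A z.1).
Proof.
move=> mA; have mi : measurable_fun setT (\1_A : RR -> R) by exact: measurable_indic.
exact: (measurableT_comp mi (@measurable_fst _ _ RR RR)).
Qed.

Lemma mfun_indic2 (A : set RR) : measurable A -> mfun (fun z => \1_A z.2).
Proof.
move=> mA; have mi : measurable_fun setT (\1_A : RR -> R) by exact: measurable_indic.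
exact: (measurableT_comp mi (@measurable_snd _ _ RR RR)).
Qed.

Lemma ae_of_slices F : mfun F -> {ae leb, forall x, {ae leb, forall y, F (x, y) = 0}} ->
  {ae mu2, forall z, F z = 0}.
Proof.
move=> mF h; apply: (esq0_ae mF); rewrite esq_xy//.
rewrite (ae_eq_integral (fun=> 0%E))//.
- by rewrite integral0.
- exact: measurable_esq_slice.
- apply: filterS h => x hx _; apply: ae0_esq => //; exact: measurable_slice1.
Qed.

Lemma ae_exists J (P : RR -> Prop) : {ae leb, forall x, P x} -> exists x, dset J x /\ P x.
Proof.
move=> [N [mN N0 PN]]; apply: contrapT => h.
have JN : dset J `<=` N by move=> x Jx; apply: PN => Px; apply: h; exists x.
have := le_measure leb; move=> /(_ (dset J) N).
rewrite !inE => /(_ (measurable_dset J) mN JN).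
have h0 : (leb N <= 0)%E by apply: eqle; exact: N0.
by move=> h1; have := le_trans h1 h0; rewrite /= leb_dset leNgt lte_fin dlen_gt0.
Qed.

(** The one-variable statement is applied in each variable in turn. First $G = S_2H$ does not depend
    on $y$ over [J0] and still vanishes for $x$ outside [sib I]; then $S_1G$ is constant in $x$ on
    [I0], with the same constant for almost all $y$ in [J0]. *)
Lemma shift12_const H U I J I0 J0 : dparent I0 = I -> dparent J0 = J -> shift12 H U ->
  (forall z, ~ rect (sib I) (sib J) z -> H z = 0) ->
  exists kappa : R, {ae mu2, forall z, rect I0 J0 z -> U z = kappa}.
Proof.
move=> pI pJ [G hG hU] H0.
have /shift2P[sH sG h2] := hG; have [_ /L2P sU h1] := hU.
have [mH _] := sH; have [mG _] := sG; have [mU _] := sU.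
pose gam x := dav (sl1 G x) J0.
have mgam : measurable_fun setT gam by exact: measurable_dav_slice.
(* The two properties of [G] are encoded as the vanishing of measurable functions: proved on
   vertical slices, they become statements on the plane and can be read off on horizontal slices. *)
pose D1 (z : RR * RR) := (G z - gam z.1) * \1_(dset J0) z.2.
pose D2 (z : RR * RR) := G z * \1_(~` dset (sib I)) z.1.
have m1 := mfun_indic2 (@measurable_dset R J0).
have m1' := mfun_indic1 (@measurable_dset R I0).
have m2 := mfun_indic1 (measurableC (@measurable_dset R (sib I))).
have mD1 : mfun D1.
  exact: (measurable_funM (measurable_funB mG (measurableT_comp mgam (@measurable_fst _ _ RR RR))) m1).
have mD2 : mfun D2 by exact: (measurable_funM mG m2).
have a1 : {ae mu2, forall z, D1 z = 0}.
  apply: ae_of_slices => //; apply: filterS h2 => x hx.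
  have : {ae leb, forall y, dset J0 y -> sl1 G x y = gam x}.
    apply: (shift_const hx pJ); apply: aeW => y nJ; apply: H0 => -[_ /= h].
    exact: nJ.
  apply: filterS => y hy; rewrite /D1/= indicE; case: (boolP (y \in _)); last by rewrite mulr0.
  by rewrite inE => /hy; rewrite /sl1 => ->; rewrite subrr mul0r.
have a2 : {ae mu2, forall z, D2 z = 0}.
  apply: ae_of_slices => //; apply: filterS h2 => x hx.
  have [xI|nI] := pselect (dset (sib I) x).
    by apply: aeW => y; rewrite /D2/= indicE memNset ?mulr0// => /(_ xI).
  have z0 : Defs.shift (sl1 H x \- sl1 H x)%R (sl1 G x \- sl1 G x)%R by exact: shift_sub.
  have e0 : {ae leb, forall y, sl1 H x y = (sl1 H x \- sl1 H x)%R y}.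
    apply: aeW => y /=; rewrite subrr /sl1 H0// => -[/= h _]; exact: nI.
  apply: filterS (shift_ae_eq hx z0 e0) => y; rewrite /sl1/= subrr /D2 => -> .
  by rewrite mul0r.
have good : {ae leb, forall y, Defs.shift (fun x => G (x, y)) (fun x => U (x, y)) /\
    {ae leb, forall x, D1 (x, y) = 0 /\ D2 (x, y) = 0}}.
  apply: filterS3 h1 (ae_slice2 a1) (ae_slice2 a2) => y hy b1 b2.
  by split=> //; apply: filterS2 b1 b2 => x ? ?.
(* One horizontal slice fixes the constant. On any other good slice over [J0] the function [G] is
   almost everywhere the same, hence so is its shift. *)
have [y0 [y0J [hy0 hD0]]] := ae_exists J0 good.
pose kap := dav (fun x => U (x, y0)) I0; exists kap.
have hU0 : {ae leb, forall x, dset I0 x -> U (x, y0) = kap}.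
  apply: (shift_const hy0 pI); apply: filterS hD0 => x [_ + nI].
  by rewrite /D2/= indicE mem_set// mulr1.
pose D3 (z : RR * RR) := (U z - kap) * (\1_(dset I0) z.1 * \1_(dset J0) z.2).
have mD3 : mfun D3.
  exact: (measurable_funM (measurable_funB mU (measurable_cst _)) (measurable_funM m1' m1)).
have a3 : {ae mu2, forall z, swp D3 z = 0}.
  apply: ae_of_slices; first exact: measurable_swp.
  apply: filterS good => y [hy hD]; rewrite /swp /tsw /D3/=.
  have [yJ|nJ] := pselect (dset J0 y); last first.
    by apply: aeW => x; rewrite [\1_(dset J0) _]indicE memNset ?mulr0.
  have GG : {ae leb, forall x, G (x, y) = G (x, y0)}.
    apply: filterS2 hD hD0 => x [+ _] [+ _]; rewrite /D1/= !indicE !mem_set// !mulr1.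
    by move=> /eqP; rewrite subr_eq0 => /eqP -> /eqP; rewrite subr_eq0 => /eqP ->.
  apply: filterS2 (shift_ae_eq hy hy0 GG) hU0 => x -> hx.
  rewrite [\1_(dset I0) _]indicE; case: (boolP (x \in _)); last by rewrite mul0r mulr0.
  by rewrite inE => /hx ->; rewrite subrr mul0r.
apply: filterS (ae_swap a3) => -[x y]; rewrite /swp /tsw /D3/= => + [/= xI yJ].
rewrite !indicE !mem_set// !mulr1 => /eqP.
by rewrite subr_eq0 => /eqP.
Qed.

Definition ten I J : RR * RR -> R := fun z => haar I z.1 * haar J z.2.

Lemma mfun_ten I J : mfun (ten I J).
Proof.
exact: (measurable_funM (measurableT_comp (@measurable_haar R I) (@measurable_fst _ _ RR RR))
  (measurableT_comp (@measurable_haar R J) (@measurable_snd _ _ RR RR))).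
Qed.

Lemma ten0 I J z : ~ rect I J z -> ten I J z = 0.
Proof.
move=> nz; rewrite /ten; have [h|h] := pselect (dset I z.1); last by rewrite haar0 ?mul0r.
by rewrite [haar J _]haar0 ?mulr0// => h'; apply: nz.
Qed.

Lemma haar_bound I x : `|haar I x| <= (Num.sqrt (dlen I))^-1.
Proof.
have s0 : 0 <= (Num.sqrt (dlen I))^-1 by rewrite invr_ge0 sqrtr_ge0.
have [/dset_child[h|h]|h] := pselect (dset I x).
- by rewrite (haar_left h) normrN ger0_norm.
- by rewrite (haar_right h) ger0_norm.
- by rewrite haar0// normr0.
Qed.

Lemma bcs_ten I J : bounded_compact_support (ten I J).
Proof.
split; first exact: mfun_ten.
  exists ((Num.sqrt (dlen I))^-1 * (Num.sqrt (dlen J))^-1) => z.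
  by rewrite /ten normrM; apply: ler_pM => //; exact: haar_bound.
have [M hM] := @rect_box I J.
exists (`[- M, M]%classic `*` `[- M, M]%classic); first exact: compact_box.
by move=> z nz; apply: ten0 => /hM.
Qed.

Lemma esq_haar I : esq leb (haar I) = 1%E.
Proof.
rewrite esqE; last exact: sqint_haar.
by have := @haar_orthonormal R I I; rewrite innerE eqxx => ->.
Qed.

Lemma esq_ten I J : esq mu2 (ten I J) = 1%E.
Proof.
rewrite esq_xy; last exact: mfun_ten.
rewrite -(esq_haar I) [RHS]/esq; apply: eq_integral => x _.
transitivity ((haar I x ^+ 2)%:E * esq leb (haar J))%E; last by rewrite esq_haar mule1.
exact: (@esqZ _ RR R leb (haar I x) (haar J) (measurable_haar J)).
Qed.

Lemma norm2_ten I J : norm2 (ten I J) = 1%E.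
Proof. by rewrite norm2E (_ : esq _ _ = 1%E) ?poweR1r//; exact: esq_ten. Qed.

Definition ten_shift I J : RR * RR -> R :=
  fun z => (sibsign I * haar I z.1) * (sibsign J * haar J z.2).

Lemma shift12_ten I J : shift12 (ten (sib I) (sib J)) (ten_shift I J).
Proof.
pose G (z : RR * RR) := haar (sib I) z.1 * (sibsign J * haar J z.2).
have sG : sqint mu2 G.
  rewrite (_ : G = fun z => sibsign J * ten (sib I) J z); first exact: sqintZ (sqint_bcs (bcs_ten _ _)).
  by apply/funext => z; rewrite /G /ten; ring.
have sU : sqint mu2 (ten_shift I J).
  rewrite (_ : ten_shift I J = fun z => (sibsign I * sibsign J) * ten I J z).
    exact: sqintZ (sqint_bcs (bcs_ten _ _)).
  by apply/funext => z; rewrite /ten_shift /ten; ring.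
exists G; split.
- exact/L2P/sqint_bcs/bcs_ten.
- exact/L2P.
- by apply: aeW => x; exact: (shift_haar (haar (sib I) x) J).
- exact/L2P.
- exact/L2P.
- apply: aeW => y; have := shift_haar (sibsign J * haar J y) I.
  by congr Defs.shift; apply/funext => x; rewrite mulrC.
Qed.

Lemma haar_child_const I0 : exists2 w : R, w ^+ 2 = (2 * dlen I0)^-1 &
  forall x, dset I0 x -> haar (dparent I0) x = w.
Proof.
have d0 := @dlen_gt0 R (dparent I0).
have sq : (Num.sqrt (dlen (dparent I0)))^-1 ^+ 2 = (2 * dlen I0)^-1.
  rewrite exprVn sqr_sqrtr ?(ltW d0)//; congr _^-1.
  by case: (dparentP I0) => {2}->; rewrite ?dlen_left ?dlen_right; field.
case: (dparentP I0) => h.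
  exists (- (Num.sqrt (dlen (dparent I0)))^-1); first by rewrite sqrrN.
  by move=> x xI; apply: haar_left; rewrite -h.
exists (Num.sqrt (dlen (dparent I0)))^-1 => // x xI.
by apply: haar_right; rewrite -h.
Qed.

(** On $I_0 \times J_0$ both $S_1S_2(bf)$ and $S_1S_2f$ are constants [kap] and [w], so $C_bf = -w(b
    - c)$ there with $c =$ [kap / w]. As $w^2 = 1/(4|I_0||J_0|)$, the norm of the commutator bounds
    the mean square of $b - c$. *)
Lemma osc_le_commutator B b T G I0 J0 : 0 < B -> bmo1 B b -> 0 < T ->
  commutator b (ten (sib (dparent I0)) (sib (dparent J0))) G -> (norm2 G <= T%:E)%E ->
  (rin (fun z => `|b z - average b I0 J0|%R) I0 J0 <= (8 * T * (dlen I0 * dlen J0))%:E)%E.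
Proof.
move=> B0 hb T0; set f := ten _ _ => -[_ /L2P sG h] GT; have [lb _] := hb; have [mb _] := lb.
have [mG _] := sG; have bf : bounded_compact_support f := bcs_ten _ _.
(* The constant sequence is admissible and gives values of the explicit form [U - b V], as the
   pointwise computation requires. They are only close to [G], and closeness [T] is enough. *)
have [//||g_ hg cg] := h (fun=> f).
  apply/(cvg_norm2P (fun=> f \- f)%R).
  rewrite ae0_esq; first exact: cvg_cst.
    by have mf := bcs_mfun bf; exact: measurable_funB.
  by apply: aeW => z /=; rewrite subrr.
move/(cvg_norm2P (fun n => g_ n \- G)%R): cg => cg.
have T2 : 0 < T ^+ 2 by rewrite exprn_gt0.
have [N /(_ N (leqnn N)) hN] := (cvge0P (fun n => esq_ge0 _ _)).1 cg (T ^+ 2) T2.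
have [_ [mg _]] := commutator_initial_bound B0 hb (hg N).
have eg : (esq mu2 (g_ N) <= (4 * T ^+ 2)%:E)%E.
  have -> : g_ N = ((g_ N \- G) \+ G)%R by apply/funext => z /=; ring.
  apply: le_trans (@esqD _ _ R mu2 _ _ (measurable_funB mg mG) mG) _.
  rewrite norm2_le ?(ltW T0)// in GT.
  apply: (@le_trans _ _ (2%:E * (T ^+ 2)%:E + 2%:E * (T ^+ 2)%:E)%E).
    by apply: leeD; apply: lee_wpmul2l.
  by rewrite -!EFinM -EFinD lee_fin; lra.
have [U [V [hU hV gE]]] := hg N.
have [kap hk] : exists kappa : R, {ae mu2, forall z, rect I0 J0 z -> U z = kappa}.
  apply: (shift12_const _ _ hU) => // z nz /=.
  by rewrite /f ten0 ?mulr0.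
have [_ sV] := shift12_sqint hV; have [mV _] := sV.
have V0 : {ae mu2, forall z, V z = ten_shift (dparent I0) (dparent J0) z}.
  have hS := shift12_ten (dparent I0) (dparent J0).
  have hd := shift12_sub hV hS; have [_ [md _]] := shift12_sqint hd.
  have e0 : (esq mu2 (V \- ten_shift (dparent I0) (dparent J0))%R <= 0)%E.
    apply: le_trans (esq_shift12 hd) _; rewrite ae0_esq//.
      by have mf := bcs_mfun bf; exact: measurable_funB.
    by apply: aeW => z /=; rewrite subrr.
  by apply: filterS (esq0_ae md e0) => z /= /eqP; rewrite subr_eq0 => /eqP.
have [w1 w1E hw1] := haar_child_const I0; have [w2 w2E hw2] := haar_child_const J0.
pose w := (sibsign (dparent I0) * w1) * (sibsign (dparent J0) * w2).
have dI := @dlen_gt0 R I0; have dJ := @dlen_gt0 R J0.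
pose A := dlen I0 * dlen J0; have A0 : 0 < A by rewrite mulr_gt0.
have wE : w ^+ 2 = (4 * A)^-1.
  by rewrite /w !exprMn !sibsign_sqr w1E w2E /A; field; rewrite !gt_eqF.
have w0 : w != 0.
  by rewrite -sqrf_eq0 wE invr_eq0 mulf_neq0// gt_eqF.
pose c := kap / w.
have mc : mfun (fun z => `|b z - c|) := mfun_norm (measurable_funB mb (measurable_cst c)).
have mc2 : mfun (fun z => `|b z - c| ^+ 2) by exact: measurable_funX.
have h2 : (rin (fun z => (`|b z - c| ^+ 2)%R) I0 J0 <= (16 * T ^+ 2 * A)%:E)%E.
  apply: (@le_trans _ _ ((4 * A)%:E * esq mu2 (g_ N))%E); last first.
    apply: (@le_trans _ _ ((4 * A)%:E * (4 * T ^+ 2)%:E)%E).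
      by apply: lee_wpmul2l => //; rewrite lee_fin mulr_ge0// ltW.
    by rewrite -EFinM lee_fin; apply: eqle; ring.
  have A4 : 0 <= 4 * A by rewrite mulr_ge0// ltW.
  have mg2 := measurable_sqr mg.
  rewrite /esq -ge0_integralZl_EFin//; last by move=> z _; rewrite lee_fin sqr_ge0.
  rewrite /rin [leLHS]integral_mkcond; apply: ae_ge0_le_integral => //.
  - by move=> z _; rewrite /patch; case: ifP => // _; rewrite lee_fin exprn_ge0.
  - apply: (measurable_restrictT _ (@measurable_rect I0 J0)).1.
    exact: (measurable_EFinS mc2).
  - by move=> z _; rewrite mule_ge0// lee_fin ?sqr_ge0.
  - exact: measurable_funeM.
  - apply: filterS2 hk V0 => z hU0 hV0 _; rewrite /patch.
    case: ifPn => [|_]; last by rewrite mule_ge0// lee_fin ?sqr_ge0.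
    rewrite inE => zR; have [z1 z2] := zR.
    rewrite -EFinM lee_fin gE /= hU0// hV0 /ten_shift hw1// hw2// -/w.
    rewrite real_normK ?num_real//.
    have -> : kap = c * w by rewrite /c divfK.
    rewrite -mulrBl exprMn wE -[c - _]opprB sqrrN.
    by rewrite mulrCA mulfV ?mulr1// gt_eqF// mulr_gt0.
(* From $t \le (t^2 + 16T^2)/(8T)$, the pointwise substitute for Cauchy-Schwarz. Passing from [c] to
   the average then doubles the constant. *)
have h1 : (rin (fun z => `|b z - c|%R) I0 J0 <= (4 * T * A)%:E)%E.
  have t0 : 0 <= (8 * T)^-1 by rewrite invr_ge0 mulr_ge0// ltW.
  apply: (@le_trans _ _ (rin (fun z => (8 * T)^-1 * (`|b z - c| ^+ 2 + 16 * T ^+ 2)) I0 J0)).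
    apply: le_rin; [exact: mc| |by move=> z; exact: normr_ge0|].
      exact: (measurable_funM (measurable_cst _) (measurable_funD mc2 (measurable_cst _))).
    move=> z; set t := `|_|; rewrite mulrC ler_pdivlMr; last by rewrite mulr_gt0.
    by have := sqr_ge0 (t - 4 * T); nra.
  have T16 : 0 <= 16 * T ^+ 2 by rewrite mulr_ge0 ?(ltW T2).
  rewrite rin_affine//.
  apply: (@le_trans _ _ (((8 * T)^-1)%:E * ((16 * T ^+ 2 * A)%:E + (16 * T ^+ 2 * A)%:E))%E).
    by apply: lee_wpmul2l; [rewrite lee_fin|apply: leeD].
  rewrite -EFinD -EFinM lee_fin; apply: eqle.
  by field; rewrite gt_eqF.
apply: (@le_trans _ _ (rin (fun z => 1 * (`|b z - c| + `|average b I0 J0 - c|)) I0 J0)).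
  apply: le_rin.
  - exact: (mfun_norm (measurable_funB mb (measurable_cst _))).
  - exact: (measurable_funM (measurable_cst _) (measurable_funD mc (measurable_cst _))).
  - by move=> z; exact: normr_ge0.
  - move=> z; rewrite mul1r.
    rewrite (_ : b z - average b I0 J0 = (b z - c) - (average b I0 J0 - c)); last by ring.
    exact: ler_normB.
rewrite rin_affine// mul1e.
apply: (@le_trans _ _ ((4 * T * A)%:E + (4 * T * A)%:E)%E).
  by apply: leeD => //; exact: le_trans (average_dist I0 J0 c lb) h1.
by rewrite -EFinD lee_fin; apply: eqle; rewrite /A; ring.
Qed.

(** * From rectangles to the norms and the operator norm *)

Lemma bmo_bmo1 b : bmo b -> exists2 B, 0 < B & bmo1 B b.
Proof.
move=> [/locally_integrable2_lint2 lb]; have := bmo_norm_ge0 1 b.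
case E : (bmo_norm 1 b) => [r| |]// r0 _.
have r1 : 0 < r + 1 by rewrite ltr_wpDl.
exists (r + 1) => //; apply: bmo1_norm => //; first exact: ltW.
by rewrite E lee_fin lerDl.
Qed.

Lemma bmo_norm_fin p b : 0 < p -> bmo b -> exists2 s : R, 0 <= s & bmo_norm p b = s%:E.
Proof.
move=> p0 hb; have [B B0 hB] := bmo_bmo1 hb; have [C C0 hC] := @bmo_norm_upper p p0.
have := hC B b B0 hB; have := bmo_norm_ge0 p b.
by case: (bmo_norm p b) => [s| |]// s0 _; exists s.
Qed.

Lemma bmo_bmo1_norm p b (s : R) : 1 <= p -> bmo b -> 0 < s -> (bmo_norm p b <= s%:E)%E ->
  bmo1 (2 * s) b.
Proof.
move=> p1 [/locally_integrable2_lint2 lb _] s0 hs; have [mb _] := lb.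
apply: bmo1_norm => //; first by rewrite mulr_ge0// ltW.
exact: bmo_norm1_le hs.
Qed.

(** Qualitative membership in bmo makes the commutators exist; the quantitative bound comes anew
    from the tests, rectangle by rectangle, and then passes from exponent 1 to [p]. *)
Lemma bmo_le_test p : 1 <= p -> exists2 C, 0 < C &
  forall b T, bmo b -> 0 < T ->
    (forall I J G, commutator b (ten I J) G -> (norm2 G <= T%:E)%E) ->
    (bmo_norm p b <= (C * T)%:E)%E.
Proof.
move=> p1; have p0 : 0 < p by rewrite (lt_le_trans ltr01).
have [C C0 hC] := @bmo_norm_upper p p0.
exists (C * 8) => [|b T hb T0 hT]; first by rewrite mulr_gt0.
have [B B0 hB] := bmo_bmo1 hb; have [lb _] := hB.
have T8 : 0 < 8 * T by rewrite mulr_gt0.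
rewrite -mulrA; apply: hC => //; split=> // I J; exists (average b I J).
have [G hG] := commutator_exists B0 hB
  ((L2P _).2 (sqint_bcs (bcs_ten (sib (dparent I)) (sib (dparent J))))).
exact: (osc_le_commutator B0 hB T0 hG (hT _ _ _ hG)).
Qed.

Lemma commutator_upper p : 1 <= p -> exists2 C, 0 < C &
  forall b F G, bmo b -> commutator b F G ->
    (norm2 G <= C%:E * bmo_norm p b * norm2 F)%E.
Proof.
move=> p1; have p0 : 0 < p by rewrite (lt_le_trans ltr01).
have u0 : 0 <= 2 * upcst :> R by rewrite mulr_ge0 ?upcst_ge0.
pose C0 : R := Num.sqrt (2 * upcst) * 2.
have C00 : 0 <= C0 by rewrite mulr_ge0 ?sqrtr_ge0.
have C0E : C0 ^+ 2 = 2 * upcst * 4.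
  by rewrite /C0 exprMn sqr_sqrtr//; ring.
exists (C0 + 1) => [|b F G hb hG]; first by rewrite ltr_wpDl.
have [s s0 sE] := bmo_norm_fin p0 hb.
have [/L2P[_ eF] _ _] := hG.
have [t t0 tE] : exists2 t : R, 0 <= t & norm2 F = t%:E.
  have := norm2_ge0 F; have : (norm2 F < +oo)%E by rewrite norm2E poweR_lty.
  by case: (norm2 F) => [t| |]// _ t0; exists t.
have et : (esq mu2 F <= (t ^+ 2)%:E)%E by rewrite -norm2_le// tE.
(* The norm [s] may vanish, while the estimates need a positive bound; [e] is let tend to 0
   afterwards. *)
have key (e : R) : 0 < e -> (norm2 G <= (C0 * (s + e) * t)%:E)%E.
  move=> e0; have se : 0 < s + e by rewrite ltr_wpDl.
  have hB : bmo1 (2 * (s + e)) b.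
    by apply: (bmo_bmo1_norm p1 hb) => //; rewrite sE lee_fin lerDl ltW.
  have B0 : 0 < 2 * (s + e) by rewrite mulr_gt0.
  rewrite norm2_le ?mulr_ge0 ?(ltW se)//.
  apply: le_trans (commutator_bound B0 hB hG) _.
  apply: (@le_trans _ _ ((2 * upcst * (2 * (s + e)) ^+ 2)%:E * (t ^+ 2)%:E)%E).
    by apply: lee_wpmul2l => //; rewrite lee_fin mulr_ge0 ?sqr_ge0.
  have -> : (C0 * (s + e) * t) ^+ 2 = C0 ^+ 2 * ((s + e) ^+ 2 * t ^+ 2) by ring.
  by rewrite C0E -EFinM lee_fin; apply: eqle; ring.
rewrite sE tE -!EFinM; apply/lee_addgt0Pr => d d0.
have q0 : 0 < C0 * t + 1 by rewrite ltr_wpDl ?mulr_ge0.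
apply: le_trans (key _ (divr_gt0 d0 q0)) _; rewrite -EFinD lee_fin.
have h1 : C0 * t * (d / (C0 * t + 1)) <= d.
  by rewrite mulrA ler_pdivrMr// mulrC ler_pM2l// lerDl.
have h2 : 0 <= s * t by rewrite mulr_ge0.
rewrite (_ : C0 * (s + d / (C0 * t + 1)) * t = C0 * s * t + C0 * t * (d / (C0 * t + 1))).
  by rewrite mulrDl mul1r [in leRHS]mulrDl; lra.
by field; rewrite gt_eqF.
Qed.

Lemma opnorm_le b p C : 0 < C ->
  (forall F G, commutator b F G -> (norm2 G <= C%:E * bmo_norm p b * norm2 F)%E) ->
  (opnorm (commutator b) <= C%:E * bmo_norm p b)%E.
Proof.
move=> C0 h; apply: ge_ereal_sup => _ [F [G [_ F1 hG ->]]].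
apply: le_trans (h F G hG) _; rewrite -[leRHS]mule1.
by apply: lee_wpmul2l => //; rewrite mule_ge0 ?bmo_norm_ge0// lee_fin ltW.
Qed.

Lemma le_opnorm b F G : L2 F -> (norm2 F <= 1)%E -> commutator b F G ->
  (norm2 G <= opnorm (commutator b))%E.
Proof. by move=> lF F1 hG; apply: ereal_sup_ubound; exists F, G. Qed.

Lemma opnorm_ge p : 1 <= p -> exists2 c, 0 < c & forall b, bmo b ->
  (c%:E * bmo_norm p b <= opnorm (commutator b))%E.
Proof.
move=> p1; have p0 : 0 < p by rewrite (lt_le_trans ltr01).
have [C C0 hC] := bmo_le_test p1.
exists C^-1 => [|b hb]; first by rewrite invr_gt0.
have [s s0 sE] := bmo_norm_fin p0 hb.
have [B B0 hB] := bmo_bmo1 hb.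
have lten I J : L2 (ten I J) by apply/L2P/sqint_bcs/bcs_ten.
(* One value of the commutator on the unit ball shows that the supremum is not over the empty set,
   hence is nonnegative rather than minus infinity. *)
have [G hG] := commutator_exists B0 hB (lten (0, 0) (0, 0)).
have ten1 I J : (norm2 (ten I J) <= 1)%E by rewrite norm2_ten.
have := le_opnorm (lten _ _) (ten1 _ _) hG; have := norm2_ge0 G.
case E : (opnorm (commutator b)) => [r| |]; last first.
- by move=> h1 h2; have := le_trans h1 h2.
- by move=> _ _; exact: leey.
move=> h1 h2; have r0 : 0 <= r by have := le_trans h1 h2; rewrite lee_fin.
apply/lee_addgt0Pr => e e0; have re : 0 < r + e by rewrite ltr_wpDl.
have h : (bmo_norm p b <= (C * (r + e))%:E)%E.
  apply: hC => // I J H hH; apply: le_trans (le_opnorm (lten _ _) (ten1 _ _) hH) _.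
  by rewrite E lee_fin lerDl ltW.
by rewrite -EFinD lee_pdivrMl// -EFinM.
Qed.

Lemma commutator_lower p : 1 <= p -> exists2 C, 0 < C & forall b, bmo b ->
  exists F G, [/\ L2 F, ~ {ae leb2, forall z, F z = 0}, commutator b F G &
    (C%:E * bmo_norm p b * norm2 F <= norm2 G)%E].
Proof.
move=> p1; have p0 : 0 < p by rewrite (lt_le_trans ltr01).
have [C C0 hC] := bmo_le_test p1.
exists (2 * C)^-1 => [|b hb]; first by rewrite invr_gt0 mulr_gt0.
have [s s0 sE] := bmo_norm_fin p0 hb.
have [B B0 hB] := bmo_bmo1 hb.
have lten I J : L2 (ten I J) by apply/L2P/sqint_bcs/bcs_ten.
have nz I J : ~ {ae leb2, forall z, ten I J z = 0}.
  move=> /(ae0_esq (@mfun_ten I J)); rewrite (_ : esq _ _ = 1%E); last exact: esq_ten.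
  by move=> /eqP; rewrite eqe oner_eq0.
(* The 2 in [2 * C] is slack: if every test function failed, [hC] would give $s \le s/2$. For $s =
   0$ any test function serves. *)
have [I [J [G [hG hs]]]] : exists I J G, commutator b (ten I J) G /\
    (((2 * C)^-1 * s)%:E <= norm2 G)%E.
  move: s0; rewrite le_eqVlt => /predU1P[s0|s0].
    have [G hG] := commutator_exists B0 hB (lten (0, 0) (0, 0)).
    by exists (0, 0), (0, 0), G; rewrite -s0 mulr0 norm2_ge0.
  apply: contrapT => nG.
  have T0 : 0 < (2 * C)^-1 * s by rewrite mulr_gt0// invr_gt0 mulr_gt0.
  have := hC b _ hb T0; rewrite sE lee_fin => h.
  have : s <= C * ((2 * C)^-1 * s).
    apply: h => I J G hG; rewrite leNgt; apply/negP => h'; apply: nG.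
    by exists I, J, G; split=> //; exact: ltW.
  rewrite (_ : C * _ = s / 2); last by field; rewrite gt_eqF.
  by lra.
exists (ten I J), G; split; [exact: lten|exact: nz|exact: hG|].
by rewrite sE norm2_ten mule1 -EFinM.
Qed.

End Plane.

Theorem theorem1p1 (R : realType) (p : R) (p_ge1 : 1 <= p) :
  [/\
    (exists c C : R, [/\ 0 < c, 0 < C &
      forall b : R * R -> R, bmo b ->
        (c%:E * bmo_norm p b <= opnorm (commutator b))%E /\
        (opnorm (commutator b) <= C%:E * bmo_norm p b)%E]),
    (exists2 C : R, 0 < C &
      forall b : R * R -> R, bmo b ->
        exists f g : R * R -> R,
          [/\ L2 f, ~ {ae leb2, forall z, f z = 0}, commutator b f g &
            (C%:E * bmo_norm p b * norm2 f <= norm2 g)%E])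
  & (exists2 C : R, 0 < C &
      forall b : R * R -> R, bmo b -> forall f : R * R -> R, L2 f ->
        (exists g, commutator b f g) /\
        forall g, commutator b f g ->
          (norm2 g <= C%:E * bmo_norm p b * norm2 f)%E)].
Proof.
have [C C0 hC] := @commutator_upper R p p_ge1.
split.
- have [c c0 hc] := @opnorm_ge R p p_ge1.
  exists c, C; split=> // b hb; split; first exact: hc.
  by apply: opnorm_le => // F G; exact: hC.
- exact: commutator_lower.
- exists C => // b hb f lf; split; last by move=> g; exact: hC.
  by have [B B0 hB] := bmo_bmo1 hb; exact: commutator_exists B0 hB lf.
Qed.
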